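(* Let $n\ge3$, let $k=k(H_{n^2})$, and let $\phi_{\nu(n)}$ be the coefficient of $q_2^{\nu(n)}$ in the Fourier–Jacobi expansion of $G_{n^2}$. Let $\tau_1$ be generic, and let $E_n\subset\mathbb{C}/\Lambda_{\tau_1}$ be the set of the $\varphi(n)\psi(n)$ points of exact order $n$, a disjoint union of $\nu(n)$ inversion orbits $\{x,-x\}$. Then $$\phi_{\nu(n)}(\tau_1,z)=\phi_{\nu(n)}(\tau_1,0)\prod_{\{x,-x\}\subset E_n}\frac{\theta_{11}(\tau_1,z-x)\,\theta_{11}(\tau_1,z+x)}{-\,\theta_{11}(\tau_1,x)^2},$$ and $\phi_{\nu(n)}(\tau_1,0)=c\,\Delta(\tau_1)^{k/12}$ with $c\in\mathbb{C}^\times$ independent of $\tau_1$.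
   Context: Let $\mathbb{H}_2$ be the Siegel upper half-space of degree two, with points $\tau=\begin{pmatrix}\tau_1&z\\ z&\tau_2\end{pmatrix}$, $q_2=e^{2\pi i\tau_2}$, and $\mathcal{A}_2=\mathbb{H}_2/\mathrm{Sp}_4(\mathbb{Z})$. For $D>0$, $D\equiv 0,1\pmod 4$, the Humbert surface $H_D\subset\mathcal{A}_2$ is the irreducible divisor whose preimage in $\mathbb{H}_2$ is the union over all primitive $(a,b,c,d,e)\in\mathbb{Z}^5$ with $b^2-4ac-4de=D$ of the loci $a\tau_1+bz+c\tau_2+d(z^2-\tau_1\tau_2)+e=0$. The exact Humbert form $G_D$ is the scalar Siegel modular form for $\mathrm{Sp}_4(\mathbb{Z})$ with divisor (on $\mathcal{A}_2$) exactly $H_D$, unique up to a nonzero scalar; $k(H_D)$ is its weight (for $D=n^2$, $n\ge2$, it is divisible by 12). The Fourier–Jacobi expansion is $G_{n^2}=\sum_{m\ge0}\phi_m(\tau_1,z)q_2^m$. ''Generic'' $\tau_1$ means that $z\mapsto\phi_{\nu(n)}(\tau_1,z)$ is not identically zero. $\Lambda_{\tau_1}=\mathbb{Z}\tau_1+\mathbb{Z}$; $\Delta$ is the discriminant cusp form of weight 12; $\varphi$ is Euler's function, $\psi(n)=n\prod_{p\mid n}(1+1/p)$, $\nu(n)=\frac12\varphi(n)\psi(n)$ for $n\ge3$. With $q_1=e^{2\pi i\tau_1}$, $\zeta=e^{2\pi iz}$, $$\theta_{11}(\tau_1,z)=\sum_{i\in\mathbb{Z}}(-1)^i q_1^{(2i+1)^2/8}\zeta^{(2i+1)/2}.$$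 In the product, $x$ is represented by a lift to $\mathbb{C}$ (and $-x$ by its negative); each factor is meant for a fixed choice of lift. *)

(* Defs.v *)
From mathcomp Require Import all_boot all_order all_algebra.
From mathcomp Require Import complex.
From mathcomp Require Import all_classical all_reals all_analysis.
From mathcomp Require Import ring.

Set Implicit Arguments.
Unset Strict Implicit.
Unset Printing Implicit Defensive.

Import Order.TTheory GRing.Theory Num.Theory.
Import numFieldNormedType.Exports.

Local Open Scope classical_set_scope.
Local Open Scope ring_scope.
Local Open Scope complex_scope.

(* Complex numbers are R[i] for R : realType. The topology and the normed
   module structure are attached to the regular module R[i]^o. *)

Section Arithmetic.
Local Open Scope nat_scope.

(* psi(n) = n * \prod_(p | n) (1 + 1/p), see psiE *)
Definition psi (n : nat) : nat :=
  \prod_(p <- primes n) (p.+1 * p ^ (logn p n).-1).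

(* The halving is exact for n >= 3, see nu_double *)
Definition nu (n : nat) : nat := (totient n * psi n)./2.

Lemma psiE (n : nat) : 0 < n ->
  ((psi n)%:R = n%:R * \prod_(p <- primes n) (1 + p%:R^-1) :> rat)%R.
Proof.
move=> n_gt0; rewrite {2}(prod_prime_decomp n_gt0) prime_decompE big_map /=.
rewrite /psi !natr_prod -big_split /= !big_seq.
apply: eq_bigr => p; rewrite mem_primes => /and3P[p_pr _ p_dvd].
have p_neq0 : (p%:R != 0 :> rat)%R by rewrite pnatr_eq0 -lt0n prime_gt0.
have : 0 < logn p n by rewrite logn_gt0 mem_primes p_pr n_gt0.
case: (logn p n) => // l _ /=.
rewrite natrM expnS natrM mulrDr mulr1 mulrAC divff // mul1r.
by rewrite -natr1; ring.
Qed.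

Lemma totient_even (n : nat) : 2 < n -> ~~ odd (totient n).
Proof.
move=> n_gt2; have n_gt0 : 0 < n by apply: leq_trans n_gt2.
have main p : p \in primes n -> ~~ odd (p.-1 * p ^ (logn p n).-1) ->
    ~~ odd (totient n).
  move=> p_n even_p; rewrite totientE // (big_rem p) //= oddM.
  by rewrite (negbTE even_p).
have [/hasP[p p_n p_odd]|/hasPn no_odd] := boolP (has odd (primes n)).
  apply: (main p) => //; rewrite oddM.
  have := p_n; rewrite mem_primes => /and3P[/prime_gt0].
  by case: p p_odd {p_n} => //= p /negbTE->.
have two_n : 2.-nat n.
  apply/pnatP => // p p_pr p_n; rewrite inE.
  have := no_odd p; rewrite mem_primes p_pr n_gt0 p_n => /(_ isT).
  by case: (even_prime p_pr) => [->//|->].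
have [l def_n] := p_natP two_n.
case: l def_n => [|[|l]] def_n; [by rewrite def_n in n_gt2..|].
by apply: (main 2); rewrite def_n ?primesX // pfactorK // oddM oddX.
Qed.

Lemma nu_double (n : nat) : 2 < n -> (nu n).*2 = totient n * psi n.
Proof.
move=> /totient_even /negbTE even_n.
by rewrite -[RHS]odd_double_half oddM even_n.
Qed.

End Arithmetic.

Section Definitions.
Variable R : realType.
Local Notation C := R[i].

Definition cexp (z : C) : C :=
  (expR (complex.Re z))%:C *
    (cos (complex.Im z) +i* sin (complex.Im z)).

(* e(z) = exp(2 i pi z), so that q_1^r = e(r tau_1) and zeta^r = e(r z) *)
Definition ce (z : C) : C := cexp ((0 +i* (2 * pi)) * z).

(* the sum over Z of a doubly infinite series; Negz i is -(i+1) *)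
Definition bilateral_sum (u : int -> C^o) : C :=
  limn (series (fun i : nat => u (Posz i))) +
  limn (series (fun i : nat => u (Negz i))).

Definition theta11 (tau1 z : C) : C :=
  bilateral_sum (fun i : int =>
    (-1) ^ i * ce (((2 * i + 1) ^ 2)%:~R / 8 * tau1)
             * ce ((2 * i + 1)%:~R / 2 * z)).

(* Normalized by Delta = q - 24 q^2 + ... *)
Definition Delta (tau1 : C) : C :=
  limn (fun N : nat =>
    ce tau1 * \prod_(1 <= m < N.+1) (1 - ce tau1 ^+ m) ^+ 24 : C^o).

Definition upper_half_plane (tau1 : C) : Prop := 0 < complex.Im tau1.

Definition siegel_half_space (tau : 'M[C]_2) : Prop :=
  tau^T = tau /\
  forall v : 'rV[R]_2, v != 0 ->
    0 < (v *m map_mx (@complex.Im R) tau *m v^T) 0 0.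

Definition siegel_point (tau1 z tau2 : C) : 'M[C]_2 :=
  \matrix_(i, j) (if i != j then z else if i == 0 then tau1 else tau2).

(* Holomorphy in the three coordinates (tau1, z, tau2): complex
   differentiability at every point. Values of F outside the half-space are
   irrelevant, as the half-space is open in the symmetric matrices. *)
Definition siegel_holomorphic (F : 'M[C]_2 -> C) : Prop :=
  forall p : C^o * C^o * C^o,
    siegel_half_space (siegel_point p.1.1 p.1.2 p.2) ->
    differentiable
      (fun w : C^o * C^o * C^o => F (siegel_point w.1.1 w.1.2 w.2) : C^o) p.

Definition symplectic_form : 'M[int]_(2 + 2) :=
  block_mx 0 1%:M (- 1%:M) 0.

Definition is_Sp4Z (g : 'M[int]_(2 + 2)) : Prop :=
  g^T *m symplectic_form *m g = symplectic_form.

Definition siegel_denom (g : 'M[int]_(2 + 2)) (tau : 'M[C]_2) : 'M[C]_2 :=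
  map_mx intr (dlsubmx g) *m tau + map_mx intr (drsubmx g).

Definition siegel_action (g : 'M[int]_(2 + 2)) (tau : 'M[C]_2) : 'M[C]_2 :=
  (map_mx intr (ulsubmx g) *m tau + map_mx intr (ursubmx g))
    *m invmx (siegel_denom g tau).

(* In degree two no condition at the cusps is needed (Koecher). *)
Definition siegel_modular_form (k : int) (F : 'M[C]_2 -> C) : Prop :=
  siegel_holomorphic F /\
  forall (g : 'M[int]_(2 + 2)) (tau : 'M[C]_2),
    is_Sp4Z g -> siegel_half_space tau ->
    F (siegel_action g tau) = \det (siegel_denom g tau) ^ k * F tau.

Definition humbert_index (D a b c d e : int) : Prop :=
  gcdz a (gcdz b (gcdz c (gcdz d e))) = 1 /\
  b ^ 2 - 4 * a * c - 4 * d * e = D.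

Definition humbert_eqn (a b c d e : int) (tau : 'M[C]_2) : C :=
  a%:~R * tau 0 0 + b%:~R * tau 0 1 + c%:~R * tau 1 1
  + d%:~R * (tau 0 1 ^+ 2 - tau 0 0 * tau 1 1) + e%:~R.

(* F vanishes to order exactly m along {l = 0}. This is the order along a
   prime divisor when {l = 0} is irreducible and l is a reduced equation of
   it; this is the case of every humbert_eqn a b c d e with
   b^2 - 4ac - 4de > 0: its gradient has no zero on its zero locus, which is
   connected (a translate of the diagonal matrices under Sp_4(R)). *)
Definition siegel_order (l F : 'M[C]_2 -> C) (m : nat) : Prop :=
  exists g : 'M[C]_2 -> C,
    [/\ siegel_holomorphic g,
        forall tau, siegel_half_space tau -> F tau = l tau ^+ m * g tau &
        exists2 tau, siegel_half_space tau & l tau = 0 /\ g tau != 0].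

(* Ramification index of H_2 -> A_2 along the preimage of H_D: the quotient
   map is branched exactly along H_1 and H_4, each fixed by an involution of
   Sp_4(Z)/{1, -1}. The divisor H_D on A_2 thus pulls back to
   humbert_ramification D times the reduced preimage. *)
Definition humbert_ramification (D : int) : nat :=
  if (D == 1) || (D == 4) then 2 else 1.

Definition exact_humbert_form (D k : int) (F : 'M[C]_2 -> C) : Prop :=
  [/\ siegel_modular_form k F,
      forall a b c d e : int, humbert_index D a b c d e ->
        siegel_order (humbert_eqn a b c d e) F (humbert_ramification D) &
      forall tau, siegel_half_space tau -> F tau = 0 ->
        exists a b c d e : int,
          humbert_index D a b c d e /\ humbert_eqn a b c d e tau = 0].

(* phi m is the coefficient of q_2^m. These power series in q_2 determine
   phi m tau1 z whenever Im tau1 > 0; its other values are irrelevant. *)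
Definition fourier_jacobi_expansion (F : 'M[C]_2 -> C) (phi : nat -> C -> C -> C)
    : Prop :=
  forall tau1 z tau2 : C, siegel_half_space (siegel_point tau1 z tau2) ->
    series (fun m : nat => phi m tau1 z * ce tau2 ^+ m : C^o) @ \oo -->
      (F (siegel_point tau1 z tau2) : C^o).

Definition lattice (tau1 x : C) : Prop :=
  exists a b : int, x = a%:~R * tau1 + b%:~R.

(* the class of x in C / Lambda_tau1 has order exactly n (for n > 0) *)
Definition exact_order (tau1 : C) (n : nat) (x : C) : Prop :=
  lattice tau1 (x *+ n) /\
  forall m : nat, (0 < m < n)%N -> ~ lattice tau1 (x *+ m).

(* s consists of one lift to C of one point of each inversion orbit {x, -x}
   of points of exact order n in C / Lambda_tau1 *)
Definition inversion_orbit_lifts (tau1 : C) (n : nat) (s : seq C) : Prop :=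
  (forall x, x \in s -> exact_order tau1 n x) /\
  (forall y, exact_order tau1 n y ->
     exists! i : 'I_(size s),
       lattice tau1 (y - s`_i) \/ lattice tau1 (y + s`_i)).

Definition generic (f : C -> C -> C) (tau1 : C) : Prop :=
  upper_half_plane tau1 /\ exists z : C, f tau1 z != 0.

End Definitions.

(* Main.v *)
(* The surface H_(n^2) contains every point (t1, x, t2) with x of exact order n in C / (Z t1 + Z),
   so each Fourier-Jacobi coefficient phi_m(t1, z) vanishes at the torsion points of exact order n.
   By the quasi-periodicity of a Jacobi form of index m, the quotient of phi_m by the product of
   the theta factors is an entire function of z, elliptic when m = nu(n), and elliptic after
   multiplication by theta^(2 (nu(n) - m)), which has a zero, when m < nu(n). By Liouville's
   theorem phi_m = 0 for m < nu(n), and the product formula holds for m = nu(n).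

   The function h(t1) = phi_nu(n)(t1, 0) is therefore the limit of q2^(-nu(n)) G(t1, 0, t2) as
   t2 -> i oo, so it has weight k under t1 -> -1/t1, and it is a power series in q1. Since G has no
   zeros at z = 0, t2 = i y, y large, Hurwitz's theorem shows that h vanishes nowhere, unless it is
   identically zero. If N is its order at q1 = 0, then h^12 / Delta^k or its inverse is invariant
   and vanishes at the cusp when 12 N <> k, which contradicts the maximum principle; so 12 N = k
   and h / Delta^N is constant.

   The needed modularity of Delta comes from the inversion formula of the theta function, whose
   constant is determined by evaluating at the points of order two. *)
Require Import Defs.
From mathcomp Require Import all_boot all_order all_algebra.
From mathcomp Require Import complex.
From mathcomp Require Import all_classical all_reals all_analysis.
From mathcomp Require Import ring lra zify.

Set Implicit Arguments.
Unset Strict Implicit.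
Unset Printing Implicit Defensive.

Import Order.TTheory GRing.Theory Num.Theory.
Import numFieldNormedType.Exports.
Local Open Scope ring_scope.
Local Open Scope complex_scope.

(** * Complex limits and differentiability *)

Section ComplexBasics.
Variable R : realType.
Local Notation C := R[i].

(** Nothing is assumed about the coefficients [phi m] beyond pointwise convergence of the expansion,
    so their holomorphy in z has to be earned. It is available only for a coefficient all of whose
    predecessors vanish: then [phi m] is the locally uniform limit of q2^(-m) G as t2 goes to i oo.
    This forces the vanishing below nu(n) to be a strong induction on m.

    Theta enters through its product form [thetaP], whose zeros can be read off. It agrees with
    [theta11] up to a factor constant in z, and such a factor cancels because every factor of the
    product formula has degree 0 in theta.

    The point z = 0 is a good place to evaluate because it does not have exact order n, so the theta
    product is non-zero there and genericity at t1 becomes h(t1) <> 0. A single generic t1 excludes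
    the identically zero alternative in Hurwitz's theorem, after which h has no zeros at all.

    Contours are circles around the origin (up to translation), and an integral is a sequence of
    averages [circ n f r]. A limit of such a sequence is asserted only where its value is known or
    where the sequence is shown to be Cauchy. *)

Definition cabs (z : C) : R := Normc.normc z.

Lemma cabs0 : cabs 0 = 0. Proof. exact: Normc.normc0. Qed.
Lemma cabs1 : cabs 1 = 1. Proof. exact: Normc.normc1. Qed.
Lemma cabsM x y : cabs (x * y) = cabs x * cabs y.
Proof. exact: Normc.normcM. Qed.
Lemma cabsV x : cabs x^-1 = (cabs x)^-1. Proof. exact: Normc.normcV. Qed.
Lemma cabsN x : cabs (- x) = cabs x. Proof. exact: normcN. Qed.
Lemma cabsD x y : cabs (x + y) <= cabs x + cabs y. Proof. exact: le_normcD. Qed.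
Lemma cabsE x : (cabs x)%:C = `|x| :> C. Proof. by case: x. Qed.
Lemma cabs_sqr x : cabs x ^+ 2 = complex.Re x ^+ 2 + complex.Im x ^+ 2.
Proof. by case: x => a b; rewrite sqr_sqrtr // addr_ge0 // sqr_ge0. Qed.
Lemma cabs_ge0 x : 0 <= cabs x.
Proof. by case: x => a b; apply: sqrtr_ge0. Qed.
Lemma cabs_eq0 x : (cabs x == 0) = (x == 0).
Proof.
by apply/eqP/eqP => [|->]; [apply: Normc.eq0_normc | exact: cabs0].
Qed.
Lemma cabs_gt0 x : (0 < cabs x) = (x != 0).
Proof. by rewrite lt_neqAle cabs_ge0 andbT eq_sym cabs_eq0. Qed.
Lemma cabsB x y : cabs (x - y) = cabs (y - x).
Proof. by rewrite -cabsN opprB. Qed.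
Lemma cabsX x n : cabs (x ^+ n) = cabs x ^+ n.
Proof. by elim: n => [|n IH]; rewrite ?expr0 ?cabs1 // !exprS cabsM IH. Qed.
Lemma cabs_real (x : R) : cabs x%:C = `|x|.
Proof. by rewrite /cabs /= expr0n /= addr0 sqrtr_sqr. Qed.
Lemma cabsBD (z x y : C) : cabs (x - y) <= cabs (x - z) + cabs (z - y).
Proof. by rewrite -[x in x - y](subrK z) -addrA; exact: cabsD. Qed.
Lemma cabs_subl x y : cabs x - cabs y <= cabs (x - y).
Proof.
have := cabsD (x - y) y; rewrite subrK; lra.
Qed.
Lemma cabs_Re x : `|complex.Re x| <= cabs x.
Proof.
rewrite -(ler_pXn2r (n := 2)) ?nnegrE ?cabs_ge0 // cabs_sqr real_normK ?num_real //.
by rewrite lerDl sqr_ge0.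
Qed.
Lemma cabs_Im x : `|complex.Im x| <= cabs x.
Proof.
rewrite -(ler_pXn2r (n := 2)) ?nnegrE ?cabs_ge0 // cabs_sqr real_normK ?num_real //.
by rewrite lerDr sqr_ge0.
Qed.
Lemma cabs_ReIm x : cabs x <= `|complex.Re x| + `|complex.Im x|.
Proof.
rewrite -(ler_pXn2r (n := 2)) ?nnegrE ?cabs_ge0 ?addr_ge0 //.
rewrite cabs_sqr -[X in X + _]real_normK ?num_real // -[X in _ + X]real_normK ?num_real //.
have := normr_ge0 (complex.Re x); have := normr_ge0 (complex.Im x); nra.
Qed.
Lemma cabs_small x : (forall e : R, 0 < e -> cabs x <= e) -> x = 0.
Proof.
move=> h; apply/eqP; rewrite -cabs_eq0 eq_le cabs_ge0 andbT.
by apply/ler_addgt0Pr => e e0; rewrite add0r; apply: h.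
Qed.
Definition clim (u : nat -> C) (l : C) :=
  forall e : R, 0 < e -> exists N, forall n, (N <= n)%N -> cabs (u n - l) < e.

Lemma climP (u : nat -> C) (l : C) :
  clim u l <-> ((u : nat -> C^o) @ \oo --> (l : C^o))%classic.
Proof.
split=> [h|/(@cvgrPdist_lt _ C^o _ _ _) h e e0].
  apply/(@cvgrPdist_lt _ C^o _ _ _) => e e0.
  (* In the order of [C] a positive element is real, so both notions of epsilon agree. *)
  have e_real : e = (complex.Re e)%:C.
    by case: e e0 => a b; rewrite ltcE /= => /andP[/eqP ->].
  have {}e0 : 0 < complex.Re e by move: e0; rewrite {1}e_real ltcR.
  have [N hN] := h _ e0; exists N => // n /= /hN.
  by rewrite e_real -[`|_|]cabsE ltcR cabsB.
have /h[N _ hN] : 0 < e%:C by rewrite ltcR.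
by exists N => n /hN /=; rewrite -cabsE ltcR cabsB.
Qed.

Lemma clim_unique u l l' : clim u l -> clim u l' -> l = l'.
Proof.
move=> h h'; apply/eqP; rewrite -subr_eq0; apply/eqP; apply: cabs_small => e e0.
have [N hN] := h (e / 2) ltac:(lra); have [N' hN'] := h' (e / 2) ltac:(lra).
have := hN (maxn N N') (leq_maxl _ _); have := hN' (maxn N N') (leq_maxr _ _).
have := cabsBD (u (maxn N N')) l l'; rewrite (cabsB l (u _)); lra.
Qed.

Lemma clim_le u l (B : R) :
  clim u l -> (exists N, forall n, (N <= n)%N -> cabs (u n) <= B) -> cabs l <= B.
Proof.
move=> h [N hN]; apply/ler_addgt0Pr => e e0; have [N' hN'] := h e e0.
have := hN (maxn N N') (leq_maxl _ _); have := hN' (maxn N N') (leq_maxr _ _).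
have := cabs_subl l (u (maxn N N')); rewrite (cabsB l); lra.
Qed.

Lemma clim_le_all u l (B : R) : clim u l -> (forall n, cabs (u n) <= B) -> cabs l <= B.
Proof. by move=> h hB; apply: (clim_le h); exists 0%N. Qed.

Lemma clim_cst l : clim (fun _ => l) l.
Proof. by move=> e e0; exists 0%N => n _; rewrite subrr cabs0. Qed.

Lemma clim_ext u v l : clim u l -> u =1 v -> clim v l.
Proof. by move=> h /funext <-. Qed.

Lemma climD u v l m : clim u l -> clim v m -> clim (fun n => u n + v n) (l + m).
Proof.
move=> h h' e e0; have [N hN] := h (e / 2) ltac:(lra).
have [N' hN'] := h' (e / 2) ltac:(lra); exists (maxn N N') => n.
rewrite geq_max => /andP[/hN ? /hN' ?].
have -> : u n + v n - (l + m) = (u n - l) + (v n - m) by ring.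
have := cabsD (u n - l) (v n - m); lra.
Qed.

Lemma climMl u l a : clim u l -> clim (fun n => a * u n) (a * l).
Proof.
move=> h e e0; have a0 := cabs_ge0 a.
have [N hN] := h (e / (cabs a + 1)) ltac:(rewrite divr_gt0 //; lra).
exists N => n /hN; rewrite -mulrBr cabsM ltr_pdivlMr; last lra.
have := cabs_ge0 (u n - l); nra.
Qed.

Lemma climN u l : clim u l -> clim (fun n => - u n) (- l).
Proof. by move=> /(climMl (-1)); rewrite mulN1r; under eq_fun do rewrite mulN1r. Qed.

Lemma climB u v l m : clim u l -> clim v m -> clim (fun n => u n - v n) (l - m).
Proof. by move=> h /climN; apply: climD. Qed.

Lemma clim_bounded u l : clim u l -> exists2 B, 0 < B & forall n, cabs (u n) <= B.
Proof.
move=> h; have [N hN] := h 1 ltr01.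
exists (\sum_(i < N) cabs (u i) + (cabs l + 1)).
  apply: ltr_wpDl; first by apply: sumr_ge0 => i _; apply: cabs_ge0.
  by have := cabs_ge0 l; lra.
move=> n; case: (ltnP n N) => hn.
  rewrite (bigD1 (Ordinal hn)) //=.
  have : 0 <= \sum_(i < N | i != Ordinal hn) cabs (u i).
    by apply: sumr_ge0 => i _; apply: cabs_ge0.
  have := cabs_ge0 l; lra.
have : 0 <= \sum_(i < N) cabs (u i) by apply: sumr_ge0 => i _; apply: cabs_ge0.
by have := hN n hn; have := cabsD (u n - l) l; rewrite subrK; lra.
Qed.

Lemma climM u v l m : clim u l -> clim v m -> clim (fun n => u n * v n) (l * m).
Proof.
move=> h h'; have [B B0 hB] := clim_bounded h => e e0.
have m0 := cabs_ge0 m.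
have [N hN] := h (e / 2 / (cabs m + 1)) ltac:(rewrite !divr_gt0 //; lra).
have [N' hN'] := h' (e / 2 / B) ltac:(rewrite !divr_gt0 //; lra).
exists (maxn N N') => n; rewrite geq_max => /andP[/hN h1 /hN' h2].
have -> : u n * v n - l * m = (u n - l) * m + u n * (v n - m) by ring.
apply: (le_lt_trans (cabsD _ _)); rewrite !cabsM.
move: h1 h2; rewrite !ltr_pdivlMr //; last lra.
have := cabs_ge0 (u n - l); have := cabs_ge0 (v n - m); have := hB n.
move=> *.
have : cabs (u n) * cabs (v n - m) <= B * cabs (v n - m) by apply: ler_wpM2r.
nra.
Qed.

Lemma climX u l k : clim u l -> clim (fun n => u n ^+ k) (l ^+ k).
Proof.
move=> h; elim: k => [|k IH].
  by rewrite expr0; under eq_fun do rewrite expr0; exact: clim_cst.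
by rewrite exprS; under eq_fun do rewrite exprS; apply: climM.
Qed.

Lemma clim_shift u l k : clim u l -> clim (fun n => u (n + k)%N) l.
Proof.
move=> h e /h[N hN]; exists N => n hn; apply: hN.
by rewrite (leq_trans hn) ?leq_addr.
Qed.

Lemma clim_unshift u l k : clim (fun n => u (n + k)%N) l -> clim u l.
Proof.
move=> h e /h[N hN]; exists (N + k)%N => n hn.
by rewrite -(subnK (leq_trans (leq_addl N k) hn)); apply: hN; lia.
Qed.

(** Real and imaginary parts are 1-Lipschitz for [cabs], so completeness of [R] applies to each of
    them. *)
Lemma ccomplete u :
  (forall e : R, 0 < e -> exists N, forall n, (N <= n)%N -> cabs (u n - u N) < e) ->
  exists l, clim u l.
Proof.
move=> h.
have aux (f : C -> R) : (forall x y, `|f x - f y| <= cabs (x - y)) ->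
    exists l : R, forall e : R, 0 < e -> exists N, forall n, (N <= n)%N -> `|f (u n) - l| < e.
  move=> hf.
  have /cauchy_cvgP /cvg_ex[l /cvgrPdist_lt hl] : cauchy ((f \o u) @ \oo)%classic.
    apply: cauchy_exP => e e0; have [N hN] := h e e0.
    exists (f (u N)); exists N => // n /= /hN; apply: le_lt_trans.
    by rewrite distrC; exact: hf.
  exists l => e /hl[N _ hN]; exists N => n /hN /=; by rewrite distrC.
have [a ha] := aux (@complex.Re R) ltac:(by case=> a b [c d]; exact: (cabs_Re ((a +i* b) - (c +i* d)))).
have [b hb] := aux (@complex.Im R) ltac:(by case=> a' b' [c d]; exact: (cabs_Im ((a' +i* b') - (c +i* d)))).
exists (a +i* b) => e e0.
have [N hN] := ha (e / 2) ltac:(lra); have [N' hN'] := hb (e / 2) ltac:(lra).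
exists (maxn N N') => n; rewrite geq_max => /andP[/hN h1 /hN' h2].
apply: le_lt_trans (cabs_ReIm _) _; move: h1 h2; case: (u n) => c d /=; lra.
Qed.

Definition cont (f : C -> C) (z : C) :=
  forall e : R, 0 < e -> exists2 d : R, 0 < d &
    forall w, cabs (w - z) < d -> cabs (f w - f z) < e.

Lemma cont_near f g z (d : R) : 0 < d -> (forall w, cabs (w - z) < d -> f w = g w) ->
  cont f z -> cont g z.
Proof.
move=> d0 hfg h e /h[d' d'0 hd]; exists (Num.min d d'); first by rewrite lt_min d0.
move=> w; rewrite lt_min => /andP[h1 h2]; rewrite -!hfg //; first exact: hd.
by rewrite subrr cabs0.
Qed.

Lemma cont_cst a z : cont (fun _ => a) z.
Proof. by move=> e e0; exists 1 => // w _; rewrite subrr cabs0. Qed.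

Lemma cont_id z : cont id z.
Proof. by move=> e e0; exists e. Qed.

Lemma contD f g z : cont f z -> cont g z -> cont (fun w => f w + g w) z.
Proof.
move=> hf hg e e0; have [d d0 h] := hf (e / 2) ltac:(lra).
have [d' d'0 h'] := hg (e / 2) ltac:(lra).
exists (Num.min d d') => [|w]; first by rewrite lt_min d0.
rewrite lt_min => /andP[/h ? /h' ?].
have -> : f w + g w - (f z + g z) = (f w - f z) + (g w - g z) by ring.
have := cabsD (f w - f z) (g w - g z); lra.
Qed.

Lemma contM f g z : cont f z -> cont g z -> cont (fun w => f w * g w) z.
Proof.
move=> hf hg e e0; have fz := cabs_ge0 (f z); have gz := cabs_ge0 (g z).
have [d1 d10 h1] := hf 1 ltr01.
have [d d0 h] := hf (e / 2 / (cabs (g z) + 1)) ltac:(rewrite !divr_gt0 //; lra).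
have [d' d'0 h'] := hg (e / 2 / (cabs (f z) + 1)) ltac:(rewrite !divr_gt0 //; lra).
exists (Num.min d1 (Num.min d d')) => [|w]; first by rewrite !lt_min d10 d0.
rewrite !lt_min => /and3P[/h1 k1 /h k2 /h' k3].
have -> : f w * g w - f z * g z = (f w - f z) * g z + f w * (g w - g z) by ring.
apply: (le_lt_trans (cabsD _ _)); rewrite !cabsM.
move: k2 k3; rewrite !ltr_pdivlMr; try lra.
have := cabs_subl (f w) (f z).
have := cabs_ge0 (f w - f z); have := cabs_ge0 (g w - g z); move=> *.
have : cabs (f w) * cabs (g w - g z) <= (cabs (f z) + 1) * cabs (g w - g z).
  by apply: ler_wpM2r => //; lra.
nra.
Qed.

Lemma cont_comp f g z : cont f z -> cont g (f z) -> cont (fun w => g (f w)) z.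
Proof.
move=> hf hg e /hg[d d0 hd]; have [d' d'0 hd'] := hf d d0.
by exists d' => // w /hd' /hd.
Qed.

Lemma contN f z : cont f z -> cont (fun w => - f w) z.
Proof.
by move=> h; under eq_fun do rewrite -mulN1r; apply: contM => //; apply: cont_cst.
Qed.

Lemma contB f g z : cont f z -> cont g z -> cont (fun w => f w - g w) z.
Proof. by move=> hf /contN; apply: contD. Qed.

Lemma contV_id z : z != 0 -> cont (@GRing.inv C) z.
Proof.
move=> z0 e e0; have az : 0 < cabs z by rewrite cabs_gt0.
exists (Num.min (cabs z / 2) (e * cabs z ^+ 2 / 2)).
  by rewrite lt_min !divr_gt0 ?mulr_gt0 ?exprn_gt0.
move=> w; rewrite lt_min => /andP[h1 h2].
have aw : cabs z / 2 < cabs w by have := cabs_subl z w; rewrite cabsB; lra.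
have w0 : w != 0 by rewrite -cabs_gt0; lra.
have -> : w^-1 - z^-1 = (z - w) / (w * z) by field; rewrite w0 z0.
rewrite cabsM cabsV cabsM ltr_pdivrMr; last by rewrite mulr_gt0 //; lra.
rewrite cabsB; apply: (lt_trans h2).
have : e * cabs z * (cabs z / 2) < e * cabs z * cabs w by rewrite ltr_pM2l // mulr_gt0.
lra.
Qed.

Lemma contV f z : cont f z -> f z != 0 -> cont (fun w => (f w)^-1) z.
Proof. by move=> h /contV_id; apply: cont_comp. Qed.

(** Serves to extend an identity across an isolated point where the function to be divided by
    vanishes. *)
Lemma cont_eq0 f z (r : R) : 0 < r -> cont f z ->
  (forall w, 0 < cabs (w - z) < r -> f w = 0) -> f z = 0.
Proof.
move=> r0 hf h; apply: cabs_small => e /hf[d d0 hd].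
pose s := Num.min d r / 2.
have s0 : 0 < s by rewrite divr_gt0 // lt_min d0.
have sd : s < d /\ s < r.
  have : Num.min d r <= d /\ Num.min d r <= r by rewrite !ge_min !lexx orbT.
  by rewrite /s in s0 *; lra.
have hs : cabs (z + s%:C - z) = s by rewrite addrC addKr cabs_real ger0_norm // ltW.
have := hd (z + s%:C); rewrite hs h ?hs ?s0 ?sd.2 // sub0r cabsN => k.
by apply: ltW; apply: k; case: sd.
Qed.

(* Caratheodory's form of differentiability: the slope function is continuous *)
Definition hol (f : C -> C) (z : C) :=
  exists2 p : C -> C, cont p z & forall w, f w = f z + (w - z) * p w.

Lemma hol_cont f z : hol f z -> cont f z.
Proof.
move=> [p hp /funext ->]; apply: contD; first exact: cont_cst.
by apply: contM => //; apply: contB; [exact: cont_id | exact: cont_cst].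
Qed.

Lemma hol_near f g z (d : R) : 0 < d -> (forall w, cabs (w - z) < d -> f w = g w) ->
  hol f z -> hol g z.
Proof.
move=> d0 hfg [p hp hf]; have fz : f z = g z by apply: hfg; rewrite subrr cabs0.
exists (fun w => if w == z then p z else (g w - g z) / (w - z)).
  apply: cont_near d0 _ hp => w hw; case: eqP => [->//|/eqP wz].
  rewrite -fz -hfg //.
  by rewrite (hf w) [_ + _ * _]addrC addrK mulrC mulKf // subr_eq0.
move=> w; case: eqP => [->|/eqP wz]; first by rewrite subrr mul0r addr0.
by rewrite mulrC divfK ?subr_eq0 // addrC subrK.
Qed.

Lemma hol_cst a z : hol (fun _ => a) z.
Proof. by exists (fun _ => 0) => [|w]; [exact: cont_cst | rewrite mulr0 addr0]. Qed.

Lemma hol_id z : hol id z.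
Proof. by exists (fun _ => 1) => [|w]; [exact: cont_cst | rewrite mulr1 addrC subrK]. Qed.

Lemma holD f g z : hol f z -> hol g z -> hol (fun w => f w + g w) z.
Proof.
move=> [p hp hf] [q hq hg]; exists (fun w => p w + q w); first exact: contD.
by move=> w; rewrite hf hg; ring.
Qed.

Lemma holM f g z : hol f z -> hol g z -> hol (fun w => f w * g w) z.
Proof.
move=> holf [q hq hg]; have [p hp hf] := holf.
exists (fun w => p w * g z + f w * q w).
  apply: contD; first by apply: contM => //; apply: cont_cst.
  by apply: contM => //; apply: hol_cont.
by move=> w; rewrite (hg w) mulrDr {1}(hf w) hg; ring.
Qed.

Lemma holN f z : hol f z -> hol (fun w => - f w) z.
Proof.
by move=> h; under eq_fun do rewrite -mulN1r; apply: holM => //; apply: hol_cst.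
Qed.

Lemma holB f g z : hol f z -> hol g z -> hol (fun w => f w - g w) z.
Proof. by move=> hf /holN; apply: holD. Qed.

Lemma hol_comp f g z : hol f z -> hol g (f z) -> hol (fun w => g (f w)) z.
Proof.
move=> holf [q hq hg]; have [p hp hf] := holf.
exists (fun w => p w * q (f w)).
  by apply: contM => //; apply: cont_comp hq; apply: hol_cont.
by move=> w; rewrite (hg (f w)) {1}(hf w); ring.
Qed.

Lemma holV f z : hol f z -> f z != 0 -> hol (fun w => (f w)^-1) z.
Proof.
move=> holf fz; have [p hp hf] := holf; have hc := hol_cont holf.
have [d d0 hd] := hc (cabs (f z)) ltac:(by rewrite cabs_gt0).
have nz w : cabs (w - z) < d -> f w != 0.
  move=> /hd h; rewrite -cabs_gt0; have := cabs_subl (f z) (f w).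
  by rewrite cabsB; lra.
apply: (@hol_near (fun w => (f z)^-1 + (w - z) * - (p w / (f w * f z)))) d0 _ _.
  move=> w /nz fw; have e : (w - z) * p w = f w - f z by rewrite (hf w); ring.
  by rewrite mulrN mulrA e; field; rewrite fw fz.
exists (fun w => - (p w / (f w * f z))).
  apply: contN; apply: contM => //; apply: contV; last by rewrite mulf_neq0.
  by apply: contM => //; apply: cont_cst.
by move=> w; rewrite subrr mul0r addr0.
Qed.

Lemma holX f z k : hol f z -> hol (fun w => f w ^+ k) z.
Proof.
move=> h; elim: k => [|k IH]; first exact: hol_cst.
by under eq_fun do rewrite exprS; apply: holM.
Qed.

Lemma hol_prod (I : Type) (s : seq I) (F : I -> C -> C) z :
  (forall i, hol (F i) z) -> hol (fun w => \prod_(i <- s) F i w) z.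
Proof.
move=> h; elim: s => [|i s IH].
  by under eq_fun do rewrite big_nil; exact: hol_cst.
by under eq_fun do rewrite big_cons; apply: holM.
Qed.

Lemma hol_sum (I : Type) (s : seq I) (F : I -> C -> C) z :
  (forall i, hol (F i) z) -> hol (fun w => \sum_(i <- s) F i w) z.
Proof.
move=> h; elim: s => [|i s IH].
  by under eq_fun do rewrite big_nil; exact: hol_cst.
by under eq_fun do rewrite big_cons; apply: holD.
Qed.

Lemma hol_slope f z : hol f z -> exists l : C, forall e : R, 0 < e ->
  exists2 d : R, 0 < d &
    forall w, cabs (w - z) < d -> cabs (f w - f z - l * (w - z)) <= e * cabs (w - z).
Proof.
move=> [p hp hf]; exists (p z) => e /hp[d d0 hd]; exists d => // w /hd h.
have -> : f w - f z - p z * (w - z) = (p w - p z) * (w - z) by rewrite (hf w); ring.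
by rewrite cabsM ler_wpM2r ?cabs_ge0 // ltW.
Qed.

(** The slope function is completed by the value [l] at [z]; the hypothesis is exactly its
    continuity there. *)
Lemma slope_hol f z l :
  (forall e : R, 0 < e -> exists2 d : R, 0 < d &
    forall w, cabs (w - z) < d -> cabs (f w - f z - l * (w - z)) <= e * cabs (w - z)) ->
  hol f z.
Proof.
move=> h; exists (fun w => if w == z then l else (f w - f z) / (w - z)).
  move=> e e0; have [d d0 hd] := h (e / 2) ltac:(lra); exists d => // w /hd.
  rewrite eqxx; case: eqP => [-> _|/eqP]; first by rewrite subrr cabs0.
  rewrite -subr_eq0 => wz; have wz0 : 0 < cabs (w - z) by rewrite cabs_gt0.
  move=> k; have -> : (f w - f z) / (w - z) - l = (f w - f z - l * (w - z)) / (w - z).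
    by field.
  rewrite cabsM cabsV; apply: (@le_lt_trans _ _ (e / 2)); last lra.
  by rewrite ler_pdivrMr.
move=> w; case: eqP => [->|/eqP wz]; first by rewrite subrr mul0r addr0.
by rewrite mulrC divfK ?subr_eq0 // addrC subrK.
Qed.

End ComplexBasics.

Arguments cabs {R} z : simpl never.

(** * The exponential *)

Section ComplexExponential.
Variable R : realType.
Local Notation C := R[i].

Lemma is_derive_slope (f : R -> R) (x l : R) : is_derive x (1 : R) f l ->
  forall e : R, 0 < e -> exists2 d : R, 0 < d &
    forall h, `|h| < d -> `|f (x + h) - f x - l * h| <= e * `|h|.
Proof.
move=> [hd hl] e e0; move/cvg_ex: hd => [l' hl'].
have ll' : l' = l by rewrite -hl /derive; apply/esym/cvg_lim.
move: hl' => /cvgrPdist_lt /(_ e e0) /nbhs_ballP[d /= d0 hd].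
exists d => // h hh; have [->|h0] := eqVneq h 0.
  by rewrite addr0 subrr mulr0 subrr normr0 mulr0.
have := hd h; rewrite /ball /= sub0r normrN => /(_ hh h0) /=.
rewrite ll' -[(h *: (1 : R))]/(h * 1) mulr1 (addrC h x) => k.
have -> : f (x + h) - f x - l * h = - ((l - h^-1 * (f (x + h) - f x)) * h).
  by field.
by rewrite normrN normrM ler_wpM2r // ltW.
Qed.

Lemma cexpD (x y : C) : cexp (x + y) = cexp x * cexp y.
Proof.
case: x y => [a b] [c d]; rewrite /cexp /= expRD cosD sinD.
by apply/eqP; rewrite eq_complex /=; apply/andP; split; apply/eqP; ring.
Qed.

Lemma cexp0 : cexp (0 : C) = 1.
Proof.
by rewrite /cexp /= expR0 cos0 sin0; apply/eqP; rewrite eq_complex /=; apply/andP; split; apply/eqP; ring.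
Qed.

Lemma cabs_cexp (z : C) : cabs (cexp z) = expR (complex.Re z).
Proof.
rewrite /cexp cabsM cabs_real ger0_norm ?expR_ge0 //.
have -> : cabs (cos (complex.Im z) +i* sin (complex.Im z)) = 1; last by rewrite mulr1.
by apply/eqP; rewrite -(@eqrXn2 _ 2) ?cabs_ge0 // cabs_sqr /= cos2Dsin2 expr1n.
Qed.

Lemma cexp_slope0 (e0 : R) : 0 < e0 -> exists2 d : R, 0 < d &
  forall w : C, cabs w < d -> cabs (cexp w - 1 - w) <= e0 * cabs w.
Proof.
move=> e00.
(* The remainder splits into nine terms, each at most [e * cabs w]; [e <= 1] absorbs the second
   factor in the products of two small terms. *)
have [e ee0 ee] : exists2 e : R, 0 < e <= 1 & e <= e0 / 10.
  exists (Num.min (e0 / 10) 1); last by rewrite ge_min lexx.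
  by rewrite lt_min ge_min lexx orbT ltr01 divr_gt0.
have [d1 d10 h1] := is_derive_slope (is_derive_expR (0:R)) (ltac:(lra) : 0 < e).
have [d2 d20 h2] := is_derive_slope (is_derive_cos (0:R)) (ltac:(lra) : 0 < e).
have [d3 d30 h3] := is_derive_slope (is_derive_sin (0:R)) (ltac:(lra) : 0 < e).
exists (Num.min (Num.min d1 d2) (Num.min d3 e)); first by rewrite !lt_min d10 d20 d30; lra.
case=> a b; rewrite !lt_min => /andP[/andP[l1 l2] /andP[l3 l4]].
have ha := cabs_Re (a +i* b); have hb := cabs_Im (a +i* b).
move: (cabs (a +i* b)) l1 l2 l3 l4 ha hb => r l1 l2 l3 l4 /= ha hb.
have {l1}ka := h1 a (le_lt_trans ha l1); have {l2}kb := h2 b (le_lt_trans hb l2).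
have {h1 h2 h3 l3} := h3 b (le_lt_trans hb l3); move: ka kb.
rewrite !add0r expR0 cos0 sin0 !mul1r oppr0 mul0r !subr0 addr0 => k1 k2 k3.
apply: le_trans (cabs_ReIm _) _ => /=.
set A := expR a - 1 - a in k1; set B := cos b - 1 in k2; set D := sin b - b in k3.
have -> : expR a * cos b - 0 * sin b - 1 - a = A + B + a * B + A * B by rewrite /A /B; ring.
have -> : expR a * sin b + 0 * cos b - 0 - b = D + A * b + A * D + a * b + a * D.
  by rewrite /A /D; ring.
have r0 : 0 <= r by apply: le_trans ha.
have e1 : 0 <= e by lra.
have kA : `|A| <= e * r by apply: (le_trans k1); rewrite ler_wpM2l.
have kB : `|B| <= e * r by apply: (le_trans k2); rewrite ler_wpM2l.
have kD : `|D| <= e * r by apply: (le_trans k3); rewrite ler_wpM2l.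
have er : e * r <= 1 by rewrite mulr_ile1 //; lra.
have eer : e * r <= e0 / 10 * r by rewrite ler_wpM2r.
have mulb x y (u v : R) : `|x| <= u -> `|y| <= v -> `|x * y| <= u * v.
  by move=> hx hy; rewrite normrM ler_pM.
have a1 : `|a| <= 1 by lra.
have b1 : `|b| <= 1 by lra.
have t1 := mulb _ _ _ _ a1 kB. have t2 := mulb _ _ _ _ kA (le_trans kB er).
have t3 := mulb _ _ _ _ kA b1. have t4 := mulb _ _ _ _ kA (le_trans kD er).
have ae : `|a| <= e by lra.
have t5 := mulb _ _ _ _ ae hb. have t6 := mulb _ _ _ _ a1 kD.
have := ler_normD (A + B + a * B) (A * B); have := ler_normD (A + B) (a * B).
have := ler_normD A B; have := ler_normD (D + A * b + A * D + a * b) (a * D).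
have := ler_normD (D + A * b + A * D) (a * b); have := ler_normD (D + A * b) (A * D).
have := ler_normD D (A * b); have : 0 <= e0 * r by rewrite mulr_ge0 // ltW.
lra.
Qed.

Lemma hol_cexp0 : hol (@cexp R) 0.
Proof.
apply: (@slope_hol _ _ _ 1) => e /cexp_slope0[d d0 hd]; exists d => // w.
by rewrite subr0 mul1r cexp0; exact: hd.
Qed.

Lemma hol_cexp z : hol (@cexp R) z.
Proof.
have -> : @cexp R = fun w => cexp z * cexp (w - z).
  by apply/funext => w; rewrite -cexpD addrC subrK.
apply: holM; first exact: hol_cst.
apply: (@hol_comp _ (fun w => w - z) (@cexp R)).
  by apply: holB; [exact: hol_id | exact: hol_cst].
by rewrite subrr; exact: hol_cexp0.
Qed.

Lemma ceD (x y : C) : ce (x + y) = ce x * ce y.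
Proof. by rewrite /ce mulrDr cexpD. Qed.

Lemma ce0 : ce (0 : C) = 1. Proof. by rewrite /ce mulr0 cexp0. Qed.

Lemma ceN (x : C) : ce (- x) = (ce x)^-1.
Proof.
have h : ce (- x) * ce x = 1 by rewrite -ceD addNr ce0.
by apply: (mulIf (_ : ce x != 0)); rewrite ?mulVf ?h //; apply: contra_eq_neq h => ->; rewrite mulr0 eq_sym oner_eq0.
Qed.

Lemma ceB (x y : C) : ce (x - y) = ce x / ce y.
Proof. by rewrite ceD ceN. Qed.

Lemma cabs_ce (z : C) : cabs (ce z) = expR (- (2 * pi * complex.Im z)).
Proof. by case: z => a b; rewrite /ce cabs_cexp /= mul0r sub0r. Qed.

Lemma ce_neq0 (z : C) : ce z != 0.
Proof. by rewrite -cabs_eq0 cabs_ce expR_eq0. Qed.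

Lemma ceX (z : C) k : ce z ^+ k = ce (k%:R * z).
Proof.
by elim: k => [|k IH]; rewrite ?mul0r ?ce0 // exprS IH -ceD -natr1 mulrDl mul1r addrC.
Qed.

Lemma ce1 : ce (1 : C) = 1.
Proof.
rewrite /ce /cexp mulr1 /= expR0 (_ : 2 * pi = pi *+ 2); last by rewrite mulr_natl.
by rewrite cos2pi sin2pi; apply/eqP; rewrite eq_complex /=; apply/andP; split; apply/eqP; ring.
Qed.

Lemma ce_nat k : ce (k%:R : C) = 1.
Proof. by rewrite -[_%:R]mulr1 -ceX ce1 expr1n. Qed.

Lemma ce_int (k : int) : ce (k%:~R : C) = 1.
Proof.
by case: k => k; rewrite ?NegzE ?mulrNz ?ceN ?natz ce_nat ?invr1.
Qed.

Lemma ceDint (z : C) (k : int) : ce (z + k%:~R) = ce z.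
Proof. by rewrite ceD ce_int mulr1. Qed.

Lemma ce_half : ce (1 / 2 : C) = -1.
Proof.
rewrite /ce /cexp (_ : _ * (1 / 2) = 0 +i* pi).
  by rewrite /= expR0 cospi sinpi; apply/eqP; rewrite eq_complex /=; apply/andP; split; apply/eqP; ring.
rewrite (_ : 1 / 2 = (1 / 2 : R)%:C); last by rewrite rmorphM rmorph1 fmorphV rmorphMn.
by apply/eqP; rewrite eq_complex /=; apply/andP; split; apply/eqP; field.
Qed.

Lemma ce_quarter : ce (1 / 4 : C) = 'i.
Proof.
rewrite /ce /cexp (_ : _ * (1 / 4) = 0 +i* (pi / 2)).
  by rewrite /= expR0 cos_pihalf sin_pihalf; apply/eqP; rewrite eq_complex /=; apply/andP; split; apply/eqP; ring.
rewrite (_ : 1 / 4 = (1 / 4 : R)%:C); last by rewrite rmorphM rmorph1 fmorphV rmorphMn.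
by apply/eqP; rewrite eq_complex /=; apply/andP; split; apply/eqP; field.
Qed.

(** The modulus gives Im z = 0. For the fractional part t of Re z, cos (2 pi t) = 1 - 2 sin^2 (pi t)
    forces sin (pi t) = 0, and the sine is positive on the open interval from 0 to pi. *)
Lemma ce_eq1 (z : C) : ce z = 1 -> exists k : int, z = k%:~R.
Proof.
case: z => x y h.
have y0 : y = 0.
  have := cabs_ce (x +i* y); rewrite h cabs1 => /= e1.
  have /expR_inj h' : expR (- (2 * pi * y)) = expR 0 by rewrite -e1 expR0.
  have p0 := @pi_gt0 R; apply: (@mulfI _ (2 * pi)); first by rewrite gt_eqF // mulr_gt0.
  by rewrite mulr0; lra.
rewrite {}y0 in h *; pose k := Num.floor x; exists k.
have hk := floor_itv x; rewrite -/k in hk.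
have : ce ((x - k%:~R)%:C) = (1 : C).
  rewrite rmorphB /= ceB h; have -> : (k%:~R : R)%:C = k%:~R :> C by rewrite rmorph_int.
  by rewrite ce_int divr1.
rewrite /ce /cexp /= => /eqP; rewrite eq_complex /= => /andP[+ _].
rewrite !mul0r !mulr0 !subr0 expR0 mul1r add0r => /eqP.
set t := x - _; have -> : 2 * pi * t = (pi * t) *+ 2 by rewrite -mulr_natl; ring.
rewrite cos_mulr2n cos2sin2 => hs.
have s0 : sin (pi * t) = 0.
  by apply/eqP; rewrite -sqrf_eq0; apply/eqP; move: hs; rewrite -mulr_natr; lra.
have tI : 0 <= t < 1.
  by move: hk; rewrite /t intrD => /andP[? ?]; apply/andP; split; lra.
have [t0|t0] := ltP 0 t.
  have := @sin_gt0_pi R (pi * t); rewrite s0 ltxx => k0.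
  have := @pi_gt0 R; have /k0 // : 0 < pi * t < pi.
  have := @pi_gt0 R; nra.
have {}t0 : t = 0 by lra.
by apply/eqP; rewrite eq_complex -[k%:~R]/(k%:~R : C) -(rmorph_int (real_complex R)) /= eqxx andbT; apply/eqP; move: t0; rewrite /t; lra.
Qed.

(** Polar coordinates: [acos] gives the angle up to sign, and the sign is that of the imaginary
    part. *)
Lemma ce_surj (q : C) : q != 0 -> exists z, ce z = q.
Proof.
rewrite -cabs_gt0 => q0.
have [y hy] := expR_total q0.
have hq := cabs_sqr q; case: q q0 hy hq => a b; set r := cabs _ => r0 hy /= hq.
have hx : -1 <= a / r <= 1.
  rewrite ler_pdivlMr // ler_pdivrMr //; apply/andP; split; nra.
pose t := acos (a / r).
have ct : cos t = a / r by apply: acosK.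
have st : sin t = Num.sqrt (1 - (a / r) ^+ 2) by apply: sin_acos.
have [s [cs ss]] : exists s, cos s = a / r /\ sin s = b / r.
  have hb : 1 - (a / r) ^+ 2 = (b / r) ^+ 2.
    apply: (mulIf (_ : r ^+ 2 != 0)); first by rewrite expf_neq0 // gt_eqF.
    by rewrite mulrBl -!exprMn !divfK ?gt_eqF // hq; ring.
  have [b0|b0] := leP 0 b.
    by exists t; rewrite ct st hb sqrtr_sqr ger0_norm // divr_ge0 // ltW.
  exists (- t); rewrite cosN sinN ct st hb sqrtr_sqr ler0_norm ?opprK //.
  by rewrite ler_pdivrMr // mul0r ltW.
exists ((s / (2 * pi)) +i* (- (y / (2 * pi)))).
have p0 := @pi_gt0 R; have p1 : pi != 0 :> R by rewrite gt_eqF.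
rewrite /ce /cexp /= !mul0r !add0r; move: (pi : R) p0 p1 => p p0 p1.
have -> : - (2 * p * - (y / (2 * p))) = y by field.
have -> : 2 * p * (s / (2 * p)) = s by field.
rewrite hy cs ss; apply/eqP; rewrite eq_complex /=.
by apply/andP; split; apply/eqP; field; rewrite gt_eqF.
Qed.

Lemma hol_ce z : hol (@ce R) z.
Proof.
apply: (@hol_comp _ (fun w => (0 +i* (2 * pi)) * w) (@cexp R)); last exact: hol_cexp.
by apply: holM; [exact: hol_cst | exact: hol_id].
Qed.

Lemma hol_ceM (a : C) z : hol (fun w => ce (a * w)) z.
Proof.
apply: (@hol_comp _ (fun w => a * w) (@ce R)); last exact: hol_ce.
by apply: holM; [exact: hol_cst | exact: hol_id].
Qed.

Lemma cabs_ce_lt1 (z : C) : (cabs (ce z) < 1) = (0 < complex.Im z).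
Proof.
rewrite cabs_ce expR_lt1 oppr_lt0 pmulr_rgt0 //.
by rewrite mulr_gt0 // pi_gt0.
Qed.

End ComplexExponential.

(** * Goursat's theorem *)

Section Goursat.
Variable R : realType.
Local Notation C := R[i].

(** Powers of one half: the side of a dyadic cell after [k] bisections. *)
Definition pow2 (k : nat) : R := (2^-1) ^+ k.

Lemma pow2_gt0 k : 0 < pow2 k. Proof. by rewrite exprn_gt0. Qed.

Lemma pow2S k : pow2 k = pow2 k.+1 + pow2 k.+1.
Proof. by rewrite /pow2 exprS; field. Qed.

Lemma pow2_small (e : R) : 0 < e -> exists k, pow2 k < e.
Proof.
move=> e0; have [k hk] : exists k : nat, e^-1 < k%:R.
  by exists (Num.truncn e^-1).+1; apply: truncnS_gt.
exists k; rewrite /pow2 exprVn invf_plt ?posrE ?exprn_gt0 //.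
by apply: lt_le_trans hk _; rewrite -natrX ler_nat ltnW // ltn_expl.
Qed.

Lemma pow2_le k m : (k <= m)%N -> pow2 m <= pow2 k.
Proof. by move=> km; apply: ler_wiXn2l => //; lra. Qed.

Lemma nested (a : nat -> R) :
  (forall k, a k <= a k.+1 /\ a k.+1 + pow2 k.+1 <= a k + pow2 k) ->
  exists x, forall k, a k <= x <= a k + pow2 k.
Proof.
move=> h.
have up k m : a k <= a (k + m)%N /\ a (k + m)%N + pow2 (k + m) <= a k + pow2 k.
  elim: m => [|m [IH1 IH2]]; first by rewrite addn0.
  by rewrite addnS; have := h (k + m)%N; lra.
have ub k m : a m <= a k + pow2 k.
  have := up k m; have := up m k; rewrite (addnC m) => -[? ?] [? ?].
  by have := pow2_gt0 (k + m); lra.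
exists (sup (range a)) => k; apply/andP; split.
  by apply: ub_le_sup; [exists (a 0%N + pow2 0) => _ [m _ <-]; apply: ub | exists k].
by apply: ge_sup; [exists (a 0%N); exists 0%N | move=> _ [m _ <-]; apply: ub].
Qed.

(** Compactness of the unit cube as an induction principle; [P a b c k] speaks of the cube with
    corner [(a, b, c)] and side [pow2 k]. If [P] failed for the whole cube, one of the eight halves
    would fail again and again, and these cubes would shrink to a point at which the local
    hypothesis is violated. *)
Lemma bisect3 (P : R -> R -> R -> nat -> Prop) :
  (forall a b c k, (forall e e' e'' : bool, P (a + e%:R * pow2 k.+1) (b + e'%:R * pow2 k.+1)
      (c + e''%:R * pow2 k.+1) k.+1) -> P a b c k) ->
  (forall x y z, 0 <= x <= 1 -> 0 <= y <= 1 -> 0 <= z <= 1 ->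
    exists K, forall k a b c, (K <= k)%N -> a <= x <= a + pow2 k -> b <= y <= b + pow2 k ->
      c <= z <= c + pow2 k -> P a b c k) ->
  P 0 0 0 0%N.
Proof.
move=> step loc; apply: contrapT => nP.
(* [f] selects a failing subcube of each failing cube; on the other cubes its value is arbitrary. *)
have /choice[f hf] : forall s : (R * R * R * nat), exists e : bool * bool * bool,
    ~ P s.1.1.1 s.1.1.2 s.1.2 s.2 -> ~ P (s.1.1.1 + e.1.1%:R * pow2 s.2.+1)
      (s.1.1.2 + e.1.2%:R * pow2 s.2.+1) (s.1.2 + e.2%:R * pow2 s.2.+1) s.2.+1.
  move=> [[[a b] c] k] /=; apply: contrapT => h.
  have nPa : ~ P a b c k by move=> p; apply: h; exists (true, true, true).
  apply: nPa; apply: step => e e' e''; apply: contrapT => n; apply: h.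
  by exists (e, e', e'').
pose nx (s : R * R * R * nat) := (s.1.1.1 + (f s).1.1%:R * pow2 s.2.+1,
  s.1.1.2 + (f s).1.2%:R * pow2 s.2.+1, s.1.2 + (f s).2%:R * pow2 s.2.+1, s.2.+1).
pose s k := iter k nx (0, 0, 0, 0%N).
have s2 k : (s k).2 = k by elim: k => //= k ->.
have sP k : ~ P (s k).1.1.1 (s k).1.1.2 (s k).1.2 k.
  elim: k => [//|k IH]; have := hf (s k); rewrite s2 => /(_ IH).
  by rewrite /= s2.
have bb (e : bool) (x : R) k : x <= x + e%:R * pow2 k.+1 /\
    x + e%:R * pow2 k.+1 + pow2 k.+1 <= x + pow2 k.
  have := pow2_gt0 k.+1; rewrite (pow2S k); case: e => /=; lra.
have n1 : forall k, (s k).1.1.1 <= (s k.+1).1.1.1 /\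
  (s k.+1).1.1.1 + pow2 k.+1 <= (s k).1.1.1 + pow2 k by move=> k; rewrite /= s2; apply: bb.
have n2 : forall k, (s k).1.1.2 <= (s k.+1).1.1.2 /\
  (s k.+1).1.1.2 + pow2 k.+1 <= (s k).1.1.2 + pow2 k by move=> k; rewrite /= s2; apply: bb.
have n3 : forall k, (s k).1.2 <= (s k.+1).1.2 /\
  (s k.+1).1.2 + pow2 k.+1 <= (s k).1.2 + pow2 k by move=> k; rewrite /= s2; apply: bb.
have [x hx] := nested n1; have [y hy] := nested n2; have [z hz] := nested n3.
have p01 : 0 + pow2 0 = 1 by rewrite add0r /pow2 expr0.
have [K hK] := loc x y z ltac:(by have := hx 0%N; rewrite /= p01)
  ltac:(by have := hy 0%N; rewrite /= p01) ltac:(by have := hz 0%N; rewrite /= p01).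
exact: (sP K (hK K _ _ _ (leqnn K) (hx K) (hy K) (hz K))).
Qed.

Lemma bisect1 (P : R -> nat -> Prop) :
  (forall a k, P a k.+1 -> P (a + pow2 k.+1) k.+1 -> P a k) ->
  (forall x, 0 <= x <= 1 -> exists K, forall k a, (K <= k)%N -> a <= x <= a + pow2 k -> P a k) ->
  P 0 0%N.
Proof.
move=> step loc; apply: (@bisect3 (fun a _ _ k => P a k)).
  move=> a b c k h; apply: step.
    by have := h false false false; rewrite mul0r addr0.
  by have := h true false false; rewrite mul1r.
move=> x y z hx _ _; have [K hK] := loc x hx; exists K => k a b c Kk ha _ _.
exact: hK.
Qed.

(* Midpoint sums over the dyadic subdivisions of [0, 1] stand for integrals: all that Cauchy's
   formula needs is their behaviour under bisection. *)
Fixpoint mean (n : nat) (g : R -> C) : C :=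
  if n is n'.+1 then
    (mean n' (fun t => g (t / 2)) + mean n' (fun t => g ((1 + t) / 2))) / 2
  else g (1 / 2).

Lemma eq_mean n g h : (forall t, 0 <= t <= 1 -> g t = h t) -> mean n g = mean n h.
Proof.
elim: n g h => [|n IH] g h gh /=; first by apply: gh; lra.
by congr ((_ + _) / 2); apply: IH => t ht; apply: gh; lra.
Qed.

Lemma meanD n g h : mean n (fun t => g t + h t) = mean n g + mean n h.
Proof. by elim: n g h => [//|n IH] g h /=; rewrite !IH; field. Qed.

Lemma meanMl n a g : mean n (fun t => a * g t) = a * mean n g.
Proof. by elim: n g => [//|n IH] g /=; rewrite !IH; field. Qed.

Lemma meanB n g h : mean n (fun t => g t - h t) = mean n g - mean n h.
Proof.
rewrite -mulN1r -meanMl -meanD; apply: eq_mean => t _; by rewrite mulN1r.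
Qed.

Lemma mean_cst n a : mean n (fun _ => a) = a.
Proof. by elim: n => [//|n IH] /=; rewrite !IH; field. Qed.

Lemma realC2 (a : R) : (a / 2)%:C = a%:C / 2.
Proof. by rewrite rmorphM fmorphV rmorphMn. Qed.

Lemma mean_id n : mean n (fun t => t%:C) = 1 / 2.
Proof.
elim: n => [|n IH]; first exact: realC2.
rewrite -[LHS]/((mean n (fun t => (t / 2)%:C) + mean n (fun t => ((1 + t) / 2)%:C)) / 2).
have e1 : mean n (fun t => (t / 2)%:C) = (1 / 2) * mean n (fun t => t%:C).
  by rewrite -meanMl; apply: eq_mean => t _; rewrite realC2; field.
have e2 : mean n (fun t => ((1 + t) / 2)%:C) = mean n (fun=> 1 / 2) + mean n (fun t => (t / 2)%:C).
  by rewrite -meanD; apply: eq_mean => t _; rewrite !realC2 rmorphD rmorph1; field.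
by rewrite e2 e1 mean_cst IH; field.
Qed.

Lemma mean_le n g (B : R) : (forall t, 0 <= t <= 1 -> cabs (g t) <= B) -> cabs (mean n g) <= B.
Proof.
elim: n g => [|n IH] g gB /=; first by apply: gB; lra.
have c2 : cabs (2^-1 : C) = 2^-1.
  by rewrite -[2^-1]mul1r -(realC2 1) cabs_real ger0_norm ?divr_ge0 // mul1r.
rewrite cabsM c2 ler_pdivrMr //; apply: (le_trans (cabsD _ _)).
have := IH (fun t => g (t / 2)) ltac:(by move=> t ht; apply: gB; lra).
have := IH (fun t => g ((1 + t) / 2)) ltac:(by move=> t ht; apply: gB; lra).
lra.
Qed.

Local Notation I := ('i%C : C).

(** The midpoint sum, with 2^n pieces on each side, of the contour integral of [f] around the
    rectangle with corner [p] and sides [a] and [b I]. *)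
Definition rect_sum n (f : C -> C) (p : C) (a b : R) : C :=
  a%:C * (mean n (fun t => f (p + (t * a)%:C)) - mean n (fun t => f (p + (t * a)%:C + b%:C * I)))
  + b%:C * I * (mean n (fun t => f (p + a%:C + (t * b)%:C * I))
                - mean n (fun t => f (p + (t * b)%:C * I))).

(** Inner edges are traversed twice in opposite directions with the same sample points, so they
    cancel exactly and not just in the limit. *)
Lemma rect_sumS n f p (a b : R) : rect_sum n.+1 f p a b =
  rect_sum n f p (a / 2) (b / 2) + rect_sum n f (p + (a / 2)%:C) (a / 2) (b / 2)
  + rect_sum n f (p + (b / 2)%:C * I) (a / 2) (b / 2)
  + rect_sum n f (p + (a / 2)%:C + (b / 2)%:C * I) (a / 2) (b / 2).
Proof.
(* The rewrites by [E] bring the sample points of both sides to one normal form, so that the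
   cancelling means become syntactically equal. *)
have E (g h : R -> C) : g =1 h -> mean n (fun t => f (g t)) = mean n (fun t => f (h t)).
  by move=> gh; apply: eq_mean => t _; rewrite gh.
rewrite /rect_sum /=.
rewrite (E (fun t => p + (t / 2 * a)%:C) (fun t => p + (t * (a / 2))%:C)); last by move=> t; congr (_ + _%:C); ring.
rewrite (E (fun t => p + ((1 + t) / 2 * a)%:C) (fun t => p + (a / 2)%:C + (t * (a / 2))%:C)); last by move=> t; rewrite -addrA -rmorphD; congr (_ + _%:C); ring.
rewrite (E (fun t => p + (t / 2 * a)%:C + b%:C * I) (fun t => p + (b / 2)%:C * I + (t * (a / 2))%:C + (b / 2)%:C * I)); last by move=> t; rewrite !realC2 !rmorphM !fmorphV !rmorphMn; field.
rewrite (E (fun t => p + ((1 + t) / 2 * a)%:C + b%:C * I) (fun t => p + (a / 2)%:C + (b / 2)%:C * I + (t * (a / 2))%:C + (b / 2)%:C * I)); last by move=> t; rewrite !realC2 !rmorphM !fmorphV !rmorphMn !rmorphD !rmorph1; field.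
rewrite (E (fun t => p + a%:C + (t / 2 * b)%:C * I) (fun t => p + (a / 2)%:C + (a / 2)%:C + (t * (b / 2))%:C * I)); last by move=> t; rewrite !realC2 !rmorphM !fmorphV !rmorphMn; field.
rewrite (E (fun t => p + a%:C + ((1 + t) / 2 * b)%:C * I) (fun t => p + (a / 2)%:C + (b / 2)%:C * I + (a / 2)%:C + (t * (b / 2))%:C * I)); last by move=> t; rewrite !realC2 !rmorphM !fmorphV !rmorphMn !rmorphD !rmorph1; field.
rewrite (E (fun t => p + (t / 2 * b)%:C * I) (fun t => p + (t * (b / 2))%:C * I)); last by move=> t; congr (_ + _%:C * _); ring.
rewrite (E (fun t => p + ((1 + t) / 2 * b)%:C * I) (fun t => p + (b / 2)%:C * I + (t * (b / 2))%:C * I)); last by move=> t; rewrite !realC2 !rmorphM !fmorphV !rmorphMn !rmorphD !rmorph1; field.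
rewrite (E (fun t => p + (a / 2)%:C + (b / 2)%:C * I + (t * (b / 2))%:C * I) (fun t => p + (b / 2)%:C * I + (a / 2)%:C + (t * (b / 2))%:C * I)); last by move=> t; ring.
rewrite (E (fun t => p + (a / 2)%:C + (t * (a / 2))%:C + (b / 2)%:C * I) (fun t => p + (a / 2)%:C + (b / 2)%:C * I + (t * (a / 2))%:C)); last by move=> t; ring.
rewrite (E (fun t => p + (t * (a / 2))%:C + (b / 2)%:C * I) (fun t => p + (b / 2)%:C * I + (t * (a / 2))%:C)); last by move=> t; ring.
by rewrite !realC2; field.
Qed.

(** The midpoint rule is exact on affine functions, so the vanishing holds for every [n]. *)
Lemma rect_sum_affine n (L l p : C) (a b : R) : rect_sum n (fun w => L + l * w) p a b = 0.
Proof.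
have E (u v : C) (c : R) : mean n (fun t => L + l * (u + (t * c)%:C * v)) = L + l * (u + c%:C * v / 2).
  have -> : mean n (fun t => L + l * (u + (t * c)%:C * v)) = mean n (fun=> L + l * u) + l * c%:C * v * mean n (fun t => t%:C).
    by rewrite -meanMl -meanD; apply: eq_mean => t _; rewrite rmorphM /=; ring.
  by rewrite mean_cst mean_id; field.
rewrite /rect_sum.
have -> : mean n (fun t => L + l * (p + (t * a)%:C)) = L + l * (p + a%:C * 1 / 2).
  by rewrite -E; apply: eq_mean => t _; rewrite mulr1.
have -> : mean n (fun t => L + l * (p + (t * a)%:C + b%:C * I)) = L + l * (p + b%:C * I + a%:C * 1 / 2).
  by rewrite -E; apply: eq_mean => t _; rewrite mulr1; ring.
by rewrite !E; field.
Qed.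

Lemma rect_sumB n f g p (a b : R) :
  rect_sum n (fun w => f w - g w) p a b = rect_sum n f p a b - rect_sum n g p a b.
Proof. by rewrite /rect_sum !meanB; ring. Qed.

Lemma rect_sum_le n f p (a b B : R) :
  (forall x y, 0 <= x <= 1 -> 0 <= y <= 1 -> cabs (f (p + (x * a)%:C + (y * b)%:C * I)) <= B) ->
  cabs (rect_sum n f p a b) <= 2 * (`|a| + `|b|) * B.
Proof.
move=> h.
have m1 : cabs (mean n (fun t => f (p + (t * a)%:C))) <= B.
  by apply: mean_le => t ht; have := h t 0 ht ltac:(lra); rewrite mul0r mul0r addr0.
have m2 : cabs (mean n (fun t => f (p + (t * a)%:C + b%:C * I))) <= B.
  by apply: mean_le => t ht; have := h t 1 ht ltac:(lra); rewrite mul1r.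
have m3 : cabs (mean n (fun t => f (p + a%:C + (t * b)%:C * I))) <= B.
  by apply: mean_le => t ht; have := h 1 t ltac:(lra) ht; rewrite mul1r.
have m4 : cabs (mean n (fun t => f (p + (t * b)%:C * I))) <= B.
  by apply: mean_le => t ht; have := h 0 t ltac:(lra) ht; rewrite mul0r addr0.
have cI : cabs I = 1 by rewrite /cabs /= expr0n /= expr1n add0r sqrtr1.
apply: (le_trans (cabsD _ _)); rewrite !cabsM !cabs_real cI mulr1.
have := cabsD (mean n (fun t => f (p + (t * a)%:C))) (- mean n (fun t => f (p + (t * a)%:C + b%:C * I))).
have := cabsD (mean n (fun t => f (p + a%:C + (t * b)%:C * I))) (- mean n (fun t => f (p + (t * b)%:C * I))).
rewrite !cabsN => k1 k2.
have a0 := normr_ge0 a; have b0 := normr_ge0 b.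
apply: (@le_trans _ _ (`|a| * (B + B) + `|b| * (B + B))); last by lra.
by apply: lerD; apply: ler_wpM2l => //; lra.
Qed.

(* Goursat: on small squares around a point f is affine up to o(side), and the sums of
   affine functions vanish; subdividing gives the claim for the whole rectangle *)
Lemma goursat f p (a b : R) :
  (forall x y, 0 <= x <= 1 -> 0 <= y <= 1 -> hol f (p + (x * a)%:C + (y * b)%:C * I)) ->
  clim (fun n => rect_sum n f p a b) 0.
Proof.
move=> hf e0 e00.
pose D := `|a| + `|b| + 1; have D0 : 0 < D by have := normr_ge0 a; have := normr_ge0 b; rewrite /D; lra.
pose q (x y : R) := p + (x * a)%:C + (y * b)%:C * I.
(* The tolerated error is proportional to the area of the cell, so the errors of four quarters add
   up to the error of the whole. *)
pose P (x y z : R) k := exists N, forall n, (N <= n)%N ->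
  cabs (rect_sum n f (q x y) (a * pow2 k) (b * pow2 k)) <= e0 / 2 * (pow2 k) ^+ 2.
have [N hN] : P 0 0 0 0%N.
  apply: bisect3.
    move=> x y z k h.
    have [N1 h1] := h false false false; have [N2 h2] := h true false false.
    have [N3 h3] := h false true false; have [N4 h4] := h true true false.
    exists (N1 + N2 + N3 + N4).+1 => -[//|n] hn; rewrite rect_sumS.
    have := h1 n ltac:(lia); have := h2 n ltac:(lia).
    have := h3 n ltac:(lia); have := h4 n ltac:(lia).
    rewrite !mul0r !mul1r !addr0.
    have hk c : c * pow2 k / 2 = c * pow2 k.+1 by rewrite (pow2S k); field.
    have hs : (pow2 k) ^+ 2 = 4 * (pow2 k.+1) ^+ 2 by rewrite (pow2S k); ring.
    rewrite !hk hs.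
    have -> : q (x + pow2 k.+1) (y + pow2 k.+1) = q x y + (a * pow2 k.+1)%:C + (b * pow2 k.+1)%:C * I.
      by rewrite /q !mulrDl !rmorphD /= !rmorphM /=; ring.
    have -> : q (x + pow2 k.+1) y = q x y + (a * pow2 k.+1)%:C.
      by rewrite /q !mulrDl !rmorphD /= !rmorphM /=; ring.
    have -> : q x (y + pow2 k.+1) = q x y + (b * pow2 k.+1)%:C * I.
      by rewrite /q !mulrDl !rmorphD /= !rmorphM /=; ring.
    move=> k4 k3 k2 k1.
    apply: (le_trans (cabsD _ _)); have := cabsD (rect_sum n f (q x y) (a * pow2 k.+1) (b * pow2 k.+1)
      + rect_sum n f (q x y + (a * pow2 k.+1)%:C) (a * pow2 k.+1) (b * pow2 k.+1)) (rect_sum n f (q x y + (b * pow2 k.+1)%:C * I) (a * pow2 k.+1) (b * pow2 k.+1)).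
    have := cabsD (rect_sum n f (q x y) (a * pow2 k.+1) (b * pow2 k.+1)) (rect_sum n f (q x y + (a * pow2 k.+1)%:C) (a * pow2 k.+1) (b * pow2 k.+1)).
    lra.
  move=> x y z hx hy _.
  have [l hl] := hol_slope (hf x y hx hy); rewrite -/(q x y) in hl.
  (* A cell of scale h has a perimeter of at most 2 D h and stays within D h of the chosen point, so
     this slope error costs at most e0 / 2 times h^2. *)
  have [d d0 hd] := hl (e0 / (4 * D ^+ 2)) ltac:(by rewrite divr_gt0 // mulr_gt0 // exprn_gt0).
  have [K hK] := pow2_small (ltac:(by rewrite divr_gt0) : 0 < d / D).
  exists K => k x' y' z' Kk hx' hy' _; exists 0%N => n _.
  set h := pow2 k in hx' hy' *; have h0 : 0 < h by apply: pow2_gt0.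
  have hD : h * D < d by rewrite -ltr_pdivlMr //; apply: le_lt_trans hK; apply: pow2_le.
  have dist s t : 0 <= s <= 1 -> 0 <= t <= 1 ->
      cabs (q x' y' + (s * (a * h))%:C + (t * (b * h))%:C * I - q x y) <= h * D.
    move=> hs ht.
    have -> : q x' y' + (s * (a * h))%:C + (t * (b * h))%:C * I - q x y =
       ((x' + s * h - x) * a) +i* ((y' + t * h - y) * b).
      rewrite /q; move: (p) => [p1 p2]; apply/eqP; rewrite eq_complex /=.
      by apply/andP; split; apply/eqP; ring.
    apply: (le_trans (cabs_ReIm _)) => /=; rewrite !normrM.
    have e1 : `|x' + s * h - x| <= h by rewrite ler_norml; nra.
    have e2 : `|y' + t * h - y| <= h by rewrite ler_norml; nra.
    have := ler_wpM2r (normr_ge0 a) e1; have := ler_wpM2r (normr_ge0 b) e2.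
    by rewrite /D; lra.
  have -> : rect_sum n f (q x' y') (a * h) (b * h) = rect_sum n
      (fun w => f w - ((f (q x y) - l * q x y) + l * w)) (q x' y') (a * h) (b * h).
    by rewrite rect_sumB rect_sum_affine subr0.
  apply: le_trans (rect_sum_le _ (B := e0 / (4 * D ^+ 2) * (h * D)) _) _.
    move=> s t hs ht; set w := _ + _ + _.
    have hw : cabs (w - q x y) <= h * D by apply: dist.
    have -> : f w - (f (q x y) - l * q x y + l * w) = f w - f (q x y) - l * (w - q x y) by ring.
    apply: (le_trans (hd w (le_lt_trans hw hD))); apply: ler_wpM2l => //.
    by rewrite divr_ge0 ?mulr_ge0 ?exprn_ge0 // ltW.
  rewrite !normrM (gtr0_norm h0).
  have -> : 2 * (`|a| * h + `|b| * h) * (e0 / (4 * D ^+ 2) * (h * D)) =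
    e0 / 2 * h ^+ 2 * ((`|a| + `|b|) / D) by field; rewrite gt_eqF.
  rewrite -[X in _ <= X]mulr1; apply: ler_wpM2l; last by rewrite ler_pdivrMr // /D; lra.
  by rewrite mulr_ge0 ?exprn_ge0 ?divr_ge0 // ltW.
exists N => n /hN; rewrite subr0 /q /pow2 !expr0 !mulr1 !mul0r !addr0 expr1n mulr1; lra.
Qed.

End Goursat.
Arguments mean {R} n g.
Arguments pow2 {R} k.

(** * Cauchy's formula and its consequences *)

Section Cauchy.
Variable R : realType.
Local Notation C := R[i].
Local Notation I := ('i%C : C).
Implicit Types (f g : C -> C) (z w c : C).

(** Around a rectangle of width 1, periodicity makes the two vertical sides cancel; Goursat then
    compares the horizontal ones. *)
Lemma mean_strip f (b : R) :
  (forall x y, 0 <= x <= 1 -> 0 <= y <= 1 -> hol f (x%:C + (y * b)%:C * I)) ->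
  (forall y, 0 <= y <= 1 -> f (1 + (y * b)%:C * I) = f ((y * b)%:C * I)) ->
  clim (fun n => mean n (fun t => f t%:C) - mean n (fun t => f (t%:C + b%:C * I))) 0.
Proof.
move=> hf per; apply: clim_ext (goursat (p := 0) (a := 1) (b := b) _) _.
  by move=> x y hx hy; rewrite add0r mulr1; apply: hf.
move=> n; rewrite /rect_sum rmorph1 mul1r add0r.
rewrite (_ : mean n (fun t => f (1 + (t * b)%:C * I)) = mean n (fun t => f (0 + (t * b)%:C * I))).
  rewrite subrr mulr0 addr0; congr (_ - _); apply: eq_mean => t _; by rewrite mulr1 add0r.
by apply: eq_mean => t ht; rewrite per // add0r.
Qed.

(** An average over the circle approximates the contour integral of f(z) / z divided by 2 pi i; this
    is why Cauchy's kernel appears below as [z / (z - w)]. *)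
Definition circ n f (r : R) : C := mean n (fun t => f (r%:C * ce t%:C)).

Lemma cabs_circle (r t : R) : 0 <= r -> cabs (r%:C * ce t%:C) = r.
Proof.
by move=> r0; rewrite cabsM cabs_real cabs_ce /= mulr0 oppr0 expR0 mulr1 ger0_norm.
Qed.

Lemma circ_le n f (r B : R) : 0 <= r -> (forall z, cabs z = r -> cabs (f z) <= B) ->
  cabs (circ n f r) <= B.
Proof. by move=> r0 h; apply: mean_le => t _; apply: h; apply: cabs_circle. Qed.

Lemma eq_circ n f g (r : R) : 0 <= r -> (forall z, cabs z = r -> f z = g z) ->
  circ n f r = circ n g r.
Proof. by move=> r0 h; apply: eq_mean => t _; apply: h; apply: cabs_circle. Qed.

Lemma circD n f g (r : R) : circ n (fun z => f z + g z) r = circ n f r + circ n g r.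
Proof. exact: meanD. Qed.

Lemma circB n f g (r : R) : circ n (fun z => f z - g z) r = circ n f r - circ n g r.
Proof. exact: meanB. Qed.

Lemma circMl n a f (r : R) : circ n (fun z => a * f z) r = a * circ n f r.
Proof. exact: meanMl. Qed.

Lemma circ_cst n a (r : R) : circ n (fun _ => a) r = a.
Proof. exact: mean_cst. Qed.

(** The annulus is the image under w -> r2 e(w) of a rectangle of width 1 and height b, where b =
    log (r2 / r1) / (2 pi), and the pulled-back function is 1-periodic. *)
Lemma circ_annulus f (r1 r2 : R) : 0 < r1 -> r1 <= r2 ->
  (forall z, r1 <= cabs z <= r2 -> hol f z) ->
  clim (fun n => circ n f r2 - circ n f r1) 0.
Proof.
move=> r10 r12 hf; have r20 : 0 < r2 by lra.
have p0 := @pi_gt0 R; have p20 : 0 < 2 * pi :> R by lra.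
pose b := ln (r2 / r1) / (2 * pi).
have eb : expR (- (2 * pi * b)) = r1 / r2.
  rewrite /b (mulrC (2 * pi)) divfK ?gt_eqF // expRN lnK ?posrE ?divr_gt0 //.
  by rewrite invf_div.
have b0 : 0 <= b.
  apply: divr_ge0; last by lra.
  by rewrite ln_ge0 // ler_pdivlMr // mul1r.
apply: clim_ext (@mean_strip (fun w => f (r2%:C * ce w)) b _ _) _.
- move=> x y hx hy.
  apply: (@hol_comp _ (fun w => r2%:C * ce w)).
    by apply: holM; [exact: hol_cst | exact: hol_ce].
  apply: hf; rewrite cabsM cabs_real gtr0_norm // cabs_ce /=.
  have -> : 0 + (y * b * 1 + 0 * 0) = y * b by ring.
  have m1 : expR (- (2 * pi * b)) <= expR (- (2 * pi * (y * b))).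
    rewrite ler_expR lerN2; apply: ler_wpM2l; first by lra.
    by rewrite -[X in _ <= X]mul1r; apply: ler_wpM2r => //; lra.
  have m2 : expR (- (2 * pi * (y * b))) <= 1.
    rewrite expR_le1 oppr_le0; apply: mulr_ge0; first by lra.
    by apply: mulr_ge0 => //; case/andP: hy.
  move: m1; rewrite eb ler_pdivrMr // => m1.
  by apply/andP; split; nra.
- by move=> y _; rewrite ceD ce1 mul1r.
move=> n; congr (_ - _); apply: eq_mean => t _; congr f.
rewrite ceD mulrCA mulrC; congr (_ * _).
have -> : ce (b%:C * I) = (r1 / r2)%:C.
  rewrite -eb /ce /cexp /=.
  have -> : 0 * (b * 0 - 0 * 1) - 2 * pi * (b * 1 + 0 * 0) = - (2 * pi * b) by ring.
  have -> : 0 * (b * 1 + 0 * 0) + 2 * pi * (b * 0 - 0 * 1) = 0 by ring.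
  by rewrite cos0 sin0; apply/eqP; rewrite eq_complex /=; apply/andP; split; apply/eqP; ring.
by rewrite mulrC -rmorphM divfK ?gt_eqF.
Qed.

(** Compactness of the angle interval makes radial continuity uniform over the circle. It lets a
    contour cross a circle on which [f] is merely continuous. *)
Lemma circ_tube f (r : R) : 0 < r -> (forall z, cabs z = r -> cont f z) ->
  forall e : R, 0 < e -> exists2 h : R, 0 < h & forall t s, 0 <= t <= 1 -> `|s - r| < h ->
    cabs (f (s%:C * ce t%:C) - f (r%:C * ce t%:C)) < e.
Proof.
move=> r0 hf e e0.
have : exists2 h : R, 0 < h & forall t s, 0 <= t <= 0 + pow2 0 -> `|s - r| < h ->
    cabs (f (s%:C * ce t%:C) - f (r%:C * ce t%:C)) < e.
  apply: (@bisect1 _ (fun a k => exists2 h : R, 0 < h & forall t s, a <= t <= a + pow2 k ->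
    `|s - r| < h -> cabs (f (s%:C * ce t%:C) - f (r%:C * ce t%:C)) < e)).
    move=> a k [h1 h10 H1] [h2 h20 H2].
    exists (Num.min h1 h2); first by rewrite lt_min h10.
    move=> t s /andP[ta tb]; rewrite lt_min => /andP[s1 s2].
    have [ht|ht] := leP t (a + pow2 k.+1).
      by apply: H1 => //; rewrite ta.
    by apply: H2 => //; move: tb; rewrite (pow2S R k); lra.
  move=> t0 ht0; have zr := cabs_circle t0 (ltW r0).
  have [d d0 hd] := hf _ zr (e / 2) ltac:(lra).
  have hc := hol_cont (hol_ce t0%:C).
  have [d' d'0 hd'] := hc (d / (2 * r)) ltac:(by rewrite divr_gt0 // mulr_gt0).
  have [K hK] := pow2_small d'0.
  exists K => k a Kk ha; exists (d / 2); first lra.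
  move=> t s ht hs.
  have near (s' : R) : `|s' - r| < d / 2 -> cabs (f (s'%:C * ce t%:C) - f (r%:C * ce t0%:C)) < e / 2.
    move=> hs'; apply: hd.
    have -> : s'%:C * ce t%:C - r%:C * ce t0%:C = (s' - r)%:C * ce t%:C + r%:C * (ce t%:C - ce t0%:C).
      by rewrite rmorphB; ring.
    apply: (le_lt_trans (cabsD _ _)).
    have h1 : cabs ((s' - r)%:C * ce t%:C) < d / 2.
      by rewrite cabsM cabs_real cabs_ce /= mulr0 oppr0 expR0 mulr1.
    have h2 : cabs (r%:C * (ce t%:C - ce t0%:C)) < d / 2.
      rewrite cabsM cabs_real gtr0_norm //.
      have -> : d / 2 = r * (d / (2 * r)) by field; rewrite gt_eqF.
      rewrite ltr_pM2l //; apply: hd'; rewrite -rmorphB cabs_real.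
      have := pow2_le R Kk; rewrite ltr_norml; lra.
    lra.
  have n1 := near s hs; have n2 := near r ltac:(rewrite subrr normr0; lra).
  apply: (le_lt_trans (cabsBD (f (r%:C * ce t0%:C)) _ _)).
  by rewrite (cabsB (f (r%:C * ce t0%:C))); lra.
by move=> [h h0 H]; exists h => // t s ht; apply: H; rewrite add0r /pow2 expr0.
Qed.

Lemma clim0P (u : nat -> C) : (forall e : R, 0 < e -> exists N, forall n, (N <= n)%N -> cabs (u n) <= e) ->
  clim u 0.
Proof.
move=> h e e0; have [N hN] := h (e / 2) ltac:(lra); exists N => n /hN.
by rewrite subr0; lra.
Qed.

Lemma hol_ratio f w z : hol f z -> z != w -> hol (fun z => (f z - f w) / (z - w)) z.
Proof.
move=> hf zw; apply: holM; first by apply: holB => //; exact: hol_cst.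
apply: holV; last by rewrite subr_eq0.
by apply: holB; [exact: hol_id | exact: hol_cst].
Qed.

Lemma cabs_neq (z w : C) : cabs w < cabs z -> z != w.
Proof. by apply: contraTneq => ->; rewrite ltxx. Qed.

(** The circle may be moved outwards, and far away the integrand is close to 1. *)
Lemma circ_kernel w (r : R) : cabs w < r -> clim (fun n => circ n (fun z => z / (z - w)) r) 1.
Proof.
move=> wr; have w0 := cabs_ge0 w.
have : clim (fun n => circ n (fun z => z / (z - w)) r - 1) 0.
  apply: clim0P => e e0.
  (* Chosen so that [cabs w / (r' - cabs w) <= e / 2]. *)
  pose r' := r + 2 * cabs w / e.
  have rr' : r <= r' by rewrite lerDl divr_ge0 ?mulr_ge0 // ltW.
  have [N hN] := circ_annulus (f := fun z => z / (z - w)) (ltac:(lra) : 0 < r) rr' ltac:(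
    move=> z /andP[h _]; apply: holM; [exact: hol_id | apply: holV;
     [by apply: holB; [exact: hol_id | exact: hol_cst] | rewrite subr_eq0; apply: cabs_neq; lra]])
    (ltac:(lra) : 0 < e / 2).
  exists N => n /hN; rewrite subr0 => h1.
  have h2 : cabs (circ n (fun z => z / (z - w)) r' - 1) <= e / 2.
    rewrite -(circ_cst n 1 r') -circB; apply: circ_le; first lra.
    move=> z hz; have zw : cabs w < cabs z by rewrite hz; lra.
    have zw0 : z - w != 0 by rewrite subr_eq0; apply: cabs_neq.
    have -> : z / (z - w) - 1 = w / (z - w) by field.
    have k := cabs_subl z w; rewrite cabsM cabsV ler_pdivrMr; last lra.
    rewrite hz in k; have k2 : e / 2 * (r' - cabs w) <= e / 2 * cabs (z - w) by rewrite ler_pM2l //; lra.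
    apply: (le_trans _ k2); rewrite /r'.
    have -> : e / 2 * (r + 2 * cabs w / e - cabs w) = cabs w + e / 2 * (r - cabs w) by field; rewrite gt_eqF.
    by rewrite lerDl mulr_ge0 //; lra.
  have := cabsBD (circ n (fun z => z / (z - w)) r') (circ n (fun z => z / (z - w)) r) 1.
  by rewrite cabsB in h1; lra.
by move=> /climD /(_ (clim_cst 1)); rewrite add0r => /clim_ext; apply => n; rewrite subrK.
Qed.

(** With [p] the slope function of [f] at [w], the integrand is f(w) z / (z - w) + z p(z). The first
    term is settled by [circ_kernel]. The second, [u], is holomorphic except possibly at [w],
    continuous at [w] and zero at the origin, so its averages tend to 0 once the contour is shrunk
    to the origin. *)
Lemma cauchy0 f (rho r : R) w : (forall z, cabs z < rho -> hol f z) -> r < rho -> cabs w < r ->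
  clim (fun n => circ n (fun z => f z * z / (z - w)) r) (f w).
Proof.
move=> hf rrho wr; have w0 := cabs_ge0 w; have r0 : 0 < r by lra.
have [p hp fp] := hf w (lt_trans wr rrho).
pose u z := z * p z.
have pE z : z != w -> p z = (f z - f w) / (z - w).
  by move=> zw; rewrite (fp z) addrC addKr mulrC mulKf // subr_eq0.
have hu z : cabs z < rho -> z != w -> hol u z.
  move=> hz zw; apply: holM; first exact: hol_id.
  have d0 : 0 < cabs (z - w) by rewrite cabs_gt0 subr_eq0.
  apply: hol_near d0 _ (hol_ratio (hf z hz) zw) => z' h; rewrite pE //.
  by apply: contraTneq h => ->; rewrite cabsB ltxx.
have cu z : cabs z < rho -> cont u z.
  move=> hz; have [->|zw] := eqVneq z w; last exact: hol_cont (hu z hz zw).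
  by apply: contM => //; exact: cont_id.
have small (e : R) : 0 < e -> exists s, 0 < s /\ forall s', 0 < s' < s -> forall z, cabs z = s' -> cabs (u z) <= e.
  move=> e0; have [d d0 hd] := cu 0 ltac:(rewrite cabs0; lra) e e0.
  exists d; split=> // s' hs' z hz; have := hd z.
  by rewrite subr0 /u mul0r subr0 hz => /(_ ltac:(lra)) /ltW.
(* The circle through [w] blocks the shrinking, since [u] is only continuous at [w]. [circ_tube]
   jumps from a circle just outside it to one just inside at the cost e; shrinking from there and
   the small final circle cost e each. *)
have hs1 (e : R) : 0 < e -> exists s, cabs w < s <= r /\ exists N, forall n, (N <= n)%N -> cabs (circ n u s) <= 3 * e.
  move=> e0; have [s3 [s30 h3]] := small e e0.
  have [w00|wn0] := eqVneq (cabs w) 0.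
    pose s := Num.min r s3 / 2.
    have [sr ss3 s0] : [/\ s <= r, s < s3 & 0 < s].
      have : Num.min r s3 <= r /\ Num.min r s3 <= s3 by rewrite !ge_min !lexx orbT.
      have : 0 < Num.min r s3 by rewrite lt_min r0.
      by rewrite /s => ? [? ?]; split; lra.
    exists s; split; first by rewrite w00 s0.
    exists 0%N => n _; apply: circ_le; first lra.
    by move=> z hz; have := h3 s ltac:(by rewrite s0) z hz; lra.
  have wp : 0 < cabs w by rewrite lt_neqAle eq_sym wn0.
  have [h h0 H] := circ_tube wp (f := u) ltac:(by move=> z hz; apply: cu; lra) (ltac:(lra) : 0 < e / 2).
  pose m := Num.min (Num.min h s3) (Num.min (cabs w) (r - cabs w)).
  have [m0 mh ms mw mr] : [/\ 0 < m, m <= h, m <= s3, m <= cabs w & m <= r - cabs w].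
    by split; rewrite /m ?lt_min ?ge_min ?lexx ?orbT //= ?h0 ?s30 ?wp //=; lra.
  pose s1 := cabs w + m / 2; pose s2 := cabs w - m / 2; pose s0 := m / 4.
  exists s1; split; first by rewrite /s1; lra.
  have [N hN] := circ_annulus (f := u) (ltac:(rewrite /s0; lra) : 0 < s0) (ltac:(rewrite /s0 /s2; lra) : s0 <= s2)
    ltac:(move=> z hz; apply: hu; [move: hz; rewrite /s2; lra | rewrite eq_sym; apply: cabs_neq; move: hz; rewrite /s2; lra]) e0.
  exists N => n /hN; rewrite subr0 => k1.
  have k2 : cabs (circ n u s0) <= e.
    apply: circ_le; first by rewrite /s0; lra.
    by apply: (h3 s0); rewrite /s0; lra.
  have k3 : cabs (circ n u s1 - circ n u s2) <= e.
    rewrite /circ -meanB; apply: mean_le => t ht.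
    have a1 := H t s1 ht ltac:(rewrite /s1 addrC addKr gtr0_norm; lra).
    have a2 := H t s2 ht ltac:(rewrite /s2 addrC addKr normrN gtr0_norm; lra).
    apply: (le_trans (cabsBD (u ((cabs w)%:C * ce t%:C)) _ _)).
    by rewrite (cabsB (u ((cabs w)%:C * ce t%:C))); lra.
  have := cabsD (circ n u s1 - circ n u s2) (circ n u s2); rewrite subrK.
  have := cabsD (circ n u s2 - circ n u s0) (circ n u s0); rewrite subrK.
  lra.
have lim0 : clim (fun n => circ n u r) 0.
  apply: clim0P => e e0; have [s [/andP[ws sr] [N hN]]] := hs1 (e / 4) ltac:(lra).
  have [N' hN'] := circ_annulus (f := u) (ltac:(lra) : 0 < s) sr ltac:(
    move=> z hz; apply: hu; [lra | apply: cabs_neq; lra]) (ltac:(lra) : 0 < e / 4).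
  exists (maxn N N') => n; rewrite geq_max => /andP[/hN h1 /hN'].
  rewrite subr0; have := cabsD (circ n u r - circ n u s) (circ n u s); rewrite subrK; lra.
have := climD (climMl (f w) (circ_kernel wr)) lim0.
rewrite mulr1 addr0 => /clim_ext; apply => n.
rewrite -circMl -circD; apply: eq_circ; first lra.
move=> z hz; have zw : z - w != 0 by rewrite subr_eq0; apply: cabs_neq; rewrite hz.
by rewrite /u [in RHS](fp z); field.
Qed.

End Cauchy.

(** * Cauchy estimates, removable singularities, uniform limits, zeros *)

Section CauchyConsequences.
Variable R : realType.
Local Notation C := R[i].
Implicit Types (f g : C -> C) (z w c : C).

(** Bisection of the angle interval bounds [f] there; every point of the circle is then shown to
    have an angle in that interval. *)
Lemma circ_bounded f (r : R) : 0 <= r -> (forall z, cabs z = r -> cont f z) ->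
  exists2 B, 0 <= B & forall z, cabs z = r -> cabs (f z) <= B.
Proof.
move=> r0 hf.
have : exists2 B : R, 0 <= B & forall t, 0 <= t <= 0 + pow2 0 -> cabs (f (r%:C * ce t%:C)) <= B.
  apply: (@bisect1 _ (fun a k => exists2 B : R, 0 <= B & forall t, a <= t <= a + pow2 k ->
    cabs (f (r%:C * ce t%:C)) <= B)).
    move=> a k [B1 B10 H1] [B2 B20 H2]; exists (B1 + B2); first lra.
    move=> t /andP[ta tb]; have [ht|ht] := leP t (a + pow2 k.+1).
      by have := H1 t; rewrite ta ht => /(_ isT); lra.
    by have := H2 t; move: tb; rewrite (pow2S R k) => tb /(_ ltac:(lra)); lra.
  move=> t0 _.
  have hc : cont (fun t => f (r%:C * ce t)) t0%:C.
    apply: (@cont_comp _ (fun t => r%:C * ce t)); last by apply: hf; apply: cabs_circle.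
    by apply: contM; [exact: cont_cst | exact: hol_cont (hol_ce _)].
  have [d d0 hd] := hc 1 ltr01; have [K hK] := pow2_small d0.
  exists K => k a Kk ha; exists (cabs (f (r%:C * ce t0%:C)) + 1).
    by have := cabs_ge0 (f (r%:C * ce t0%:C)); lra.
  move=> t ht; have := hd t%:C; rewrite -rmorphB cabs_real.
  have := pow2_le R Kk => k1 /(_ ltac:(rewrite ltr_norml; lra)).
  have := cabs_subl (f (r%:C * ce t%:C)) (f (r%:C * ce t0%:C)); lra.
move=> [B B0 hB]; exists B => // z zr.
have [z0|z0] := eqVneq z 0.
  have := hB 0; rewrite ce0 mulr1 (_ : r%:C = z); last by move: zr; rewrite z0 cabs0 => <-.
  by apply; rewrite lexx add0r ltW ?pow2_gt0.
have [x hx] := ce_surj z0.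
have r1 : 0 < r by rewrite -zr cabs_gt0.
pose s := complex.Re x - (Num.floor (complex.Re x))%:~R.
have hs : 0 <= s <= 0 + pow2 0.
  have := floor_itv (complex.Re x); rewrite intrD add0r /pow2 expr0 /s => /andP[? ?].
  by apply/andP; split; lra.
suff -> : z = r%:C * ce s%:C by apply: hB.
have -> : ce s%:C = ce ((complex.Re x)%:C).
  rewrite /s rmorphB rmorph_int ceB ce_int divr1 //.
have hx2 : ce x = ce ((complex.Re x)%:C) * ce (0 +i* complex.Im x).
  by rewrite -ceD; congr ce; case: (x) => a b; apply/eqP; rewrite eq_complex /= addr0 add0r !eqxx.
have hr : ce (0 +i* complex.Im x) = r%:C.
  have := cabs_ce x; rewrite hx zr => ->.
  rewrite /ce /cexp /=.
  have -> : 0 * 0 - 2 * pi * complex.Im x = - (2 * pi * complex.Im x) by ring.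
  have -> : 0 * complex.Im x + 2 * pi * 0 = 0 by ring.
  by rewrite cos0 sin0; apply/eqP; rewrite eq_complex /=; apply/andP; split; apply/eqP; ring.
by rewrite -hr mulrC -hx2.
Qed.

Lemma hol_shift f c z : hol f (c + z) <-> hol (fun w => f (c + w)) z.
Proof.
split=> h.
  apply: (@hol_comp _ (fun w => c + w)) => //.
  by apply: holD; [exact: hol_cst | exact: hol_id].
have -> : f = fun w => f (c + (w - c)) by apply/funext => w; rewrite addrC subrK.
apply: (@hol_comp _ (fun w => w - c) (fun w => f (c + w))).
  by apply: holB; [exact: hol_id | exact: hol_cst].
by rewrite addrC addKr.
Qed.

(** Subtracting Cauchy's formulas at [w] and at 0 leaves the kernel [w / (z - w)]. *)
Lemma cauchy_diff0 f (rho r B : R) w : (forall z, cabs z < rho -> hol f z) -> r < rho -> cabs w < r ->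
  (forall z, cabs z = r -> cabs (f z) <= B) -> cabs (f w - f 0) <= B * cabs w / (r - cabs w).
Proof.
move=> hf rrho wr hB; have w0 := cabs_ge0 w; have r0 : 0 < r by lra.
have h1 := cauchy0 hf rrho wr; have h2 := cauchy0 (w := 0) hf rrho ltac:(by rewrite cabs0).
apply: (clim_le_all (climB h1 h2)) => n; rewrite -circB; apply: circ_le; first lra.
move=> z hz; have z0 : z != 0 by rewrite -cabs_gt0 hz.
have zw : z - w != 0 by rewrite subr_eq0; apply: cabs_neq; rewrite hz.
have -> : f z * z / (z - w) - f z * z / (z - 0) = f z * w / (z - w) by rewrite subr0; field; rewrite z0 zw.
rewrite !cabsM cabsV; have := cabs_subl z w; rewrite hz => k.
have rw : 0 < r - cabs w by lra.
apply: ler_pM; rewrite ?mulr_ge0 ?cabs_ge0 ?invr_ge0 ?cabs_ge0 //.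
  by apply: ler_wpM2r => //; apply: hB.
by rewrite lef_pV2 ?posrE //; lra.
Qed.

Lemma cauchy_bound0 f (rho r B : R) w : (forall z, cabs z < rho -> hol f z) -> r < rho -> cabs w < r ->
  (forall z, cabs z = r -> cabs (f z) <= B) -> cabs (f w) <= B * r / (r - cabs w).
Proof.
move=> hf rrho wr hB; have w0 := cabs_ge0 w; have r0 : 0 < r by lra.
apply: (clim_le_all (cauchy0 hf rrho wr)) => n; apply: circ_le; first lra.
move=> z hz; have zw : z - w != 0 by rewrite subr_eq0; apply: cabs_neq; rewrite hz.
rewrite !cabsM cabsV; have := cabs_subl z w; rewrite hz => k.
have rw : 0 < r - cabs w by lra.
apply: ler_pM; rewrite ?mulr_ge0 ?cabs_ge0 ?invr_ge0 ?cabs_ge0 //; try lra.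
  by apply: ler_wpM2r; [lra | apply: hB].
by rewrite lef_pV2 ?posrE //; lra.
Qed.

Lemma cauchy_bound f c (rho r B : R) w : (forall z, cabs (z - c) < rho -> hol f z) -> r < rho ->
  cabs (w - c) < r -> (forall z, cabs (z - c) = r -> cabs (f z) <= B) ->
  cabs (f w) <= B * r / (r - cabs (w - c)).
Proof.
move=> hf hr hw hB.
have := @cauchy_bound0 (fun z => f (c + z)) rho r B (w - c) _ hr hw _.
rewrite (addrC c) subrK; apply.
  by move=> z hz; apply/hol_shift; apply: hf; rewrite addrC addKr.
by move=> z hz; apply: hB; rewrite addrC addKr.
Qed.

Lemma liouville f (B : R) : (forall z, hol f z) -> (forall z, cabs (f z) <= B) ->
  forall w, f w = f 0.
Proof.
move=> hf hB w; apply/eqP; rewrite -subr_eq0; apply/eqP; apply: cabs_small => e e0.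
have B0 : 0 <= B by apply: le_trans (hB 0); apply: cabs_ge0.
have w0 := cabs_ge0 w.
pose r := cabs w + (B * cabs w + 1) / e.
have bw : 0 <= B * cabs w by rewrite mulr_ge0.
have rw : cabs w < r by rewrite ltrDl divr_gt0 //; lra.
apply: (le_trans (@cauchy_diff0 f (r + 1) r B w (fun z _ => hf z) ltac:(lra) rw (fun z _ => hB z))).
rewrite ler_pdivrMr; last lra.
have -> : e * (r - cabs w) = B * cabs w + 1 by rewrite /r; field; rewrite gt_eqF.
lra.
Qed.

(** [d] is the Cauchy transform of the boundary values [phi], with convergence known only off the
    centre. The sums at 0 and at a small [w] differ by a multiple of [cabs w] uniformly in [n], so
    the sums at 0 form a Cauchy sequence and the bound passes to the limit. *)
Lemma circ_lip phi (d : C -> C) (r B : R) : 0 < r ->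
  (forall z, cabs z = r -> cabs (phi z) <= B) ->
  (forall w, 0 < cabs w < r -> clim (fun n => circ n (fun z => phi z / (z - w)) r) (d w)) ->
  exists2 L, clim (fun n => circ n (fun z => phi z / z) r) L &
    forall w, 0 < cabs w < r / 2 -> cabs (d w - L) <= 2 * B / r ^+ 2 * cabs w.
Proof.
move=> r0 hB hd.
have B0 : 0 <= B by apply: le_trans (hB (r%:C) _); rewrite ?cabs_ge0 // cabs_real gtr0_norm.
have lip n w : cabs w < r / 2 ->
    cabs (circ n (fun z => phi z / (z - w)) r - circ n (fun z => phi z / z) r) <= 2 * B / r ^+ 2 * cabs w.
  move=> hw; have w0 := cabs_ge0 w; rewrite -circB; apply: circ_le; first lra.
  move=> z hz; have z0 : z != 0 by rewrite -cabs_gt0 hz.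
  have zw : z - w != 0 by rewrite subr_eq0; apply: cabs_neq; rewrite hz; lra.
  have -> : phi z / (z - w) - phi z / z = phi z * w / (z * (z - w)) by field; rewrite z0 zw.
  rewrite !cabsM cabsV cabsM hz; have := cabs_subl z w; rewrite hz => k.
  rewrite ler_pdivrMr; last by rewrite mulr_gt0 //; lra.
  have -> : 2 * B / r ^+ 2 * cabs w * (r * cabs (z - w)) = B * cabs w * (2 * cabs (z - w) / r).
    by field; rewrite gt_eqF.
  apply: (@le_trans _ _ (B * cabs w * 1)).
    by rewrite mulr1; apply: ler_wpM2r => //; apply: hB.
  apply: ler_wpM2l; first by rewrite mulr_ge0.
  by rewrite ler_pdivlMr //; lra.
have [L hL] : exists L, clim (fun n => circ n (fun z => phi z / z) r) L.
  apply: ccomplete => e e0.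
  pose K := 2 * B / r ^+ 2; have K0 : 0 <= K by rewrite divr_ge0 ?mulr_ge0 ?exprn_ge0 // ltW.
  pose s := Num.min (r / 4) (e / (4 * (K + 1))).
  have [s0 sr se] : [/\ 0 < s, s <= r / 4 & s <= e / (4 * (K + 1))].
    rewrite /s !ge_min !lexx orbT lt_min !divr_gt0 ?mulr_gt0 //; lra.
  have cs : cabs (s%:C : C) = s by rewrite cabs_real gtr0_norm.
  have [N hN] := hd s%:C ltac:(rewrite cs; lra) (e / 8) ltac:(lra).
  exists N => n hn.
  have h1 := hN n hn; have h2 := hN N (leqnn N).
  have l1 := lip n s%:C ltac:(rewrite cs; lra); have l2 := lip N s%:C ltac:(rewrite cs; lra).
  rewrite cs -/K in l1 l2.
  have Ks : K * s <= e / 4.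
    move: se; rewrite ler_pdivlMr; last by rewrite mulr_gt0 //; lra.
    have : 0 <= s by lra.
    nra.
  have := cabsBD (circ n (fun z => phi z / (z - s%:C)) r) (circ n (fun z => phi z / z) r) (circ N (fun z => phi z / z) r).
  rewrite (cabsB (circ n (fun z => phi z / z) r) (circ n (fun z => phi z / (z - s%:C)) r)).
  have := cabsBD (d s%:C) (circ n (fun z => phi z / (z - s%:C)) r) (circ N (fun z => phi z / z) r).
  have := cabsBD (circ N (fun z => phi z / (z - s%:C)) r) (d s%:C) (circ N (fun z => phi z / z) r).
  rewrite (cabsB (d s%:C) (circ N (fun z => phi z / (z - s%:C)) r)); lra.
exists L => // w /andP[w0 wr].
have := climB (hd w ltac:(lra)) hL => /clim_le_all; apply => n; exact: lip.
Qed.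


(** The difference quotient at the centre of a Cauchy transform is the Cauchy transform of
    [phi z / z], so a second use of [circ_lip] supplies the derivative. *)
Lemma circ_hol phi (d : C -> C) L (r B : R) : 0 < r ->
  (forall z, cabs z = r -> cabs (phi z) <= B) ->
  (forall w, 0 < cabs w < r -> clim (fun n => circ n (fun z => phi z / (z - w)) r) (d w)) ->
  clim (fun n => circ n (fun z => phi z / z) r) L ->
  hol (fun w => if w == 0 then L else d w) 0.
Proof.
move=> r0 hB hd hL.
have [] := @circ_lip (fun z => phi z / z) (fun w => (d w - L) / w) r (B / r) r0.
- move=> z hz; rewrite cabsM cabsV hz; apply: ler_wpM2r; last exact: hB.
  by rewrite invr_ge0 ltW.
- move=> w hw; have w0 : w != 0 by rewrite -cabs_gt0; case/andP: hw.
  have := climMl w^-1 (climB (hd w hw) hL); rewrite (mulrC w^-1) => /clim_ext; apply => n.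
  rewrite -circB -circMl; apply: eq_circ; first lra.
  move=> z hz; have z0 : z != 0 by rewrite -cabs_gt0 hz.
  have zw : z - w != 0 by rewrite subr_eq0; apply: cabs_neq; rewrite hz; case/andP: hw.
  by field; rewrite z0 w0 zw.
move=> l _ hl; apply: (@slope_hol _ _ _ l) => e e0.
pose K := 2 * (B / r) / r ^+ 2.
have B0 : 0 <= B by apply: le_trans (hB (r%:C) _); rewrite ?cabs_ge0 // cabs_real gtr0_norm.
have K0 : 0 <= K by rewrite !divr_ge0 ?mulr_ge0 ?invr_ge0 ?exprn_ge0 // ltW.
exists (Num.min (r / 2) (e / (K + 1))).
  by rewrite lt_min !divr_gt0 //; lra.
move=> w; rewrite subr0 eqxx lt_min => /andP[h1 h2].
have [->|w0] := eqVneq w 0; first by rewrite subrr mulr0 subr0 cabs0 mulr0.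
have aw : 0 < cabs w by rewrite cabs_gt0.
have -> : d w - L - l * w = ((d w - L) / w - l) * w by field.
rewrite cabsM ler_wpM2r ?cabs_ge0 //.
apply: (le_trans (hl w ltac:(lra))); rewrite -/K.
move: h2; rewrite ltr_pdivlMr; last lra.
lra.
Qed.

(** The difference quotient has a removable singularity at [c]: by Cauchy's formula it is the Cauchy
    transform of the translate [F], to which [circ_hol] applies. *)
Lemma division f c (rho : R) : (forall z, cabs (z - c) < rho -> hol f z) -> 0 < rho ->
  exists2 g, forall z, cabs (z - c) < rho -> hol g z & forall z, f z = f c + (z - c) * g z.
Proof.
move=> hf rho0; pose F z := f (c + z); pose r := rho / 2.
have hF z : cabs z < rho -> hol F z.
  by move=> hz; apply/hol_shift; apply: hf; rewrite addrC addKr.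
have r0 : 0 < r by rewrite /r; lra.
have rr : r < rho by rewrite /r; lra.
have [B B0 hB] := @circ_bounded F r (ltW r0) ltac:(move=> z hz; apply: hol_cont; apply: hF; lra).
have lim0 := cauchy0 (w := 0) hF rr ltac:(by rewrite cabs0).
have lim w : 0 < cabs w < r -> clim (fun n => circ n (fun z => F z / (z - w)) r) ((F w - F 0) / w).
  move=> /andP[w0 wr]; have w1 : w != 0 by rewrite -cabs_gt0.
  have := climMl w^-1 (climB (cauchy0 hF rr wr) lim0); rewrite (mulrC w^-1) => /clim_ext; apply => n.
  rewrite -circB -circMl; apply: eq_circ; first lra.
  move=> z hz; have z0 : z != 0 by rewrite -cabs_gt0 hz.
  have zw : z - w != 0 by rewrite subr_eq0; apply: cabs_neq; rewrite hz.
  by rewrite subr0; field; rewrite z0 w1 zw.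
have [L hL _] := circ_lip r0 hB lim.
have hg := circ_hol r0 hB lim hL.
pose g z := if z == 0 then L else (F z - F 0) / z.
exists (fun z => g (z - c)).
  move=> z hz; have -> : z = c + (z - c) by rewrite addrC subrK.
  apply/hol_shift; have -> : (fun w => g (c + w - c)) = g.
    by apply/funext => w; rewrite addrC addKr.
  move: (z - c) hz => {}z hz; have [->|z0] := eqVneq z 0; first exact: hg.
  apply: hol_near (_ : 0 < cabs z) _ (hol_ratio (w := 0) (hF z hz) z0); first by rewrite cabs_gt0.
  move=> w hw; rewrite /g subr0; case: eqP => // w0.
  by move: hw; rewrite w0 sub0r cabsN ltxx.
move=> z; rewrite /g subr_eq0; case: eqP => [->|/eqP zc]; first by rewrite subrr mul0r addr0.
by rewrite mulrC divfK ?subr_eq0 // /F addr0 (addrC c) subrK addrC subrK.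
Qed.

(** Cauchy's formula survives a uniform limit, and [circ_hol] turns it back into differentiability
    at the centre. *)
Lemma hol_limit (fk : nat -> C -> C) f c (rho : R) : 0 < rho ->
  (forall k z, cabs (z - c) < rho -> hol (fk k) z) ->
  (forall e : R, 0 < e -> exists K, forall k z, (K <= k)%N -> cabs (z - c) < rho -> cabs (fk k z - f z) <= e) ->
  hol f c.
Proof.
move=> rho0 hfk lim; pose F z := f (c + z); pose Fk k z := fk k (c + z); pose r := rho / 2.
have hF k z : cabs z < rho -> hol (Fk k) z.
  by move=> hz; apply/hol_shift; apply: hfk; rewrite addrC addKr.
have {}lim e : 0 < e -> exists K, forall k z, (K <= k)%N -> cabs z < rho -> cabs (Fk k z - F z) <= e.
  by move=> /lim[K hK]; exists K => k z Kk hz; apply: hK => //; rewrite addrC addKr.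
have r0 : 0 < r by rewrite /r; lra.
have rr : r < rho by rewrite /r; lra.
have [B hB] : exists B, forall z, cabs z = r -> cabs (F z) <= B.
  have [K hK] := lim 1 ltr01.
  have [B B0 hB] := @circ_bounded (Fk K) r (ltW r0) ltac:(move=> z hz; apply: hol_cont; apply: hF; lra).
  exists (B + 1) => z hz; have := hK K z (leqnn K) ltac:(lra); have := hB z hz.
  by have := cabs_subl (F z) (Fk K z); rewrite cabsB; lra.
have cau w : cabs w < r -> clim (fun n => circ n (fun z => F z * z / (z - w)) r) (F w).
  move=> wr e e0; have w0 := cabs_ge0 w.
  pose M := r / (r - cabs w); have M0 : 0 < M by rewrite divr_gt0 //; lra.
  have [K1 hK1] := lim (e / 4) ltac:(lra).
  have [K2 hK2] := lim (e / (4 * M)) ltac:(by rewrite divr_gt0 // mulr_gt0).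
  pose K := maxn K1 K2.
  have [N hN] := cauchy0 (hF K) rr wr (ltac:(lra) : 0 < e / 4).
  exists N => n /hN h1.
  have h2 := hK1 K w (leq_maxl _ _) ltac:(lra).
  have h3 : cabs (circ n (fun z => F z * z / (z - w)) r - circ n (fun z => Fk K z * z / (z - w)) r) <= e / 4.
    rewrite -circB; apply: circ_le; first lra.
    move=> z hz; have := hK2 K z (leq_maxr _ _) ltac:(lra); rewrite cabsB => h.
    have zw : z - w != 0 by rewrite subr_eq0; apply: cabs_neq; rewrite hz.
    rewrite -mulrBl -mulrBl -mulrA cabsM cabsM cabsV hz.
    have k := cabs_subl z w; rewrite hz in k.
    have -> : e / 4 = e / (4 * M) * M by field; rewrite gt_eqF.
    apply: ler_pM; rewrite ?cabs_ge0 //.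
      by apply: mulr_ge0; [exact: ltW | rewrite invr_ge0 cabs_ge0].
    rewrite /M; apply: ler_wpM2l; first lra.
    by rewrite lef_pV2 ?posrE //; lra.
  have := cabsBD (circ n (fun z => Fk K z * z / (z - w)) r) (circ n (fun z => F z * z / (z - w)) r) (F w).
  have := cabsBD (Fk K w) (circ n (fun z => Fk K z * z / (z - w)) r) (F w).
  lra.
rewrite -[c]addr0; apply/hol_shift; rewrite -/F.
have -> : F = fun w => if w == 0 then F 0 else F w by apply/funext => w; case: eqP => [->|].
apply: (@circ_hol (fun z => F z * z) F (F 0) r (B * r) r0).
- by move=> z hz; rewrite cabsM hz; apply: ler_wpM2r; [lra | exact: hB].
- by move=> w /andP[_]; exact: cau.
by have := cau 0; rewrite cabs0 => /(_ r0) /clim_ext; apply => n; apply: eq_mean => t _; rewrite subr0.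
Qed.

(** If every power of [z - c] divides [f], the Cauchy bound for the cofactor on a circle of radius r
    gives |f(w)| <= M (|w - c| / r)^s for every s, hence f(w) = 0 whenever |w - c| < r. *)
Lemma zero_order f c (rho : R) : (forall z, cabs (z - c) < rho -> hol f z) -> 0 < rho ->
  (forall z, cabs (z - c) < rho -> f z = 0) \/
  exists s g, [/\ forall z, cabs (z - c) < rho -> hol g z, g c != 0 &
    forall z, f z = (z - c) ^+ s * g z].
Proof.
move=> hf rho0; have [|none] := pselect (exists s g, [/\ forall z, cabs (z - c) < rho -> hol g z, g c != 0 &
    forall z, f z = (z - c) ^+ s * g z]); [by right | left].
have all s : exists2 g, forall z, cabs (z - c) < rho -> hol g z & forall z, f z = (z - c) ^+ s * g z.
  elim: s => [|s [g hg fg]]; first by exists f => // z; rewrite expr0 mul1r.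
  have [gc|gc] := eqVneq (g c) 0; last by case: none; exists s, g.
  have [h hh gh] := division hg rho0; exists h => // z.
  by rewrite fg gh gc add0r mulrA exprSr.
move=> w hw; pose x := cabs (w - c); pose r := (x + rho) / 2.
have x0 : 0 <= x by apply: cabs_ge0.
have [xr rr] : x < r /\ r < rho by rewrite /r /x; split; lra.
have r0 : 0 < r by lra.
have [B B0 hB] : exists2 B, 0 <= B & forall z, cabs (z - c) = r -> cabs (f z) <= B.
  have [B B0 hB] := @circ_bounded (fun z => f (c + z)) r (ltW r0) ltac:(
    by move=> z hz; apply: hol_cont; apply/hol_shift; apply: hf; rewrite addrC addKr hz).
  by exists B => // z hz; have := hB (z - c) hz; rewrite addrC subrK.
have est s : cabs (f w) <= (x / r) ^+ s * (B * r / (r - x)).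
  have [g hg fg] := all s.
  have := @cauchy_bound g c rho r (B / r ^+ s) w hg rr xr _.
  rewrite -/x => h; rewrite fg cabsM cabsX -/x.
  rewrite expr_div_n -[x ^+ s / _ * _]mulrA; apply: ler_wpM2l; first exact: exprn_ge0.
  have -> : (r ^+ s)^-1 * (B * r / (r - x)) = B / r ^+ s * r / (r - x) by ring.
  apply: h => z hz; have := hB z hz; rewrite fg cabsM cabsX hz.
  by rewrite ler_pdivlMr ?exprn_gt0 // mulrC.
apply: cabs_small => e e0.
pose M := B * r / (r - x) + 1.
have Br : 0 <= B * r / (r - x) by apply: divr_ge0; [apply: mulr_ge0 => //; apply: ltW | lra].
have M0 : 0 < M by rewrite /M; lra.
have xr0 : 0 <= x / r by apply: divr_ge0 => //; apply: ltW.
have xr1 : `|x / r| < 1 by rewrite ger0_norm // ltr_pdivrMr // mul1r.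
have /cvgrPdist_lt := cvg_expr xr1 => /(_ (e / M)).
rewrite divr_gt0 // => /(_ isT)[N _ /(_ N (leqnn N))] /=.
rewrite sub0r normrN ger0_norm ?exprn_ge0 //.
rewrite ltr_pdivlMr // => hN.
apply: (le_trans (est N)); apply: ltW; apply: le_lt_trans hN.
apply: ler_wpM2l; first exact: exprn_ge0.
by rewrite /M; lra.
Qed.

Lemma zero_isolated f c (rho : R) : (forall z, cabs (z - c) < rho -> hol f z) -> 0 < rho ->
  (forall z, cabs (z - c) < rho -> f z = 0) \/
  exists2 r, 0 < r & forall z, 0 < cabs (z - c) < r -> f z != 0.
Proof.
move=> hf rho0; have [|[s [g [hg gc fg]]]] := zero_order hf rho0; [by left | right].
have hc := hol_cont (hg c ltac:(by rewrite subrr cabs0)).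
have [d d0 hd] := hc (cabs (g c)) ltac:(by rewrite cabs_gt0).
exists d => // z /andP[z0 zd]; rewrite fg mulf_neq0 //.
  by rewrite expf_neq0 // -cabs_gt0.
have := hd z zd; rewrite cabsB => h; rewrite -cabs_gt0.
by have := cabs_subl (g c) (g z); lra.
Qed.

(* the identity theorem, moving from a to the center along discs contained in the unit disc *)
Lemma disc_zero_isolated f a : (forall z, cabs z < 1 -> hol f z) -> cabs a < 1 ->
  (exists2 z, cabs z < 1 & f z != 0) ->
  exists2 r, 0 < r & forall z, 0 < cabs (z - a) < r -> f z != 0.
Proof.
move=> hf a1 [z1 hz1 fz1]; have a0 := cabs_ge0 a.
have hb b z : cabs (z - b) < 1 - cabs b -> hol f z.
  by move=> h; apply: hf; have := cabs_subl z b; lra.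
have [za|//] := zero_isolated (hb a) ltac:(lra).
(* Steps of length [cabs a / K] are then shorter than [1 - cabs a], so each centre [b k.+1] lies in
   the disc around [b k]; the disc around the last centre 0 is the whole unit disc. *)
have [K hK] : exists K : nat, cabs a / (1 - cabs a) < K%:R.
  by exists (Num.truncn (cabs a / (1 - cabs a))).+1; apply: truncnS_gt.
have K0 : 0 < (K%:R : R) by apply: le_lt_trans hK; rewrite divr_ge0 //; lra.
pose b (k : nat) : C := (1 - k%:R / K%:R)%:C * a.
have cb k : (k <= K)%N -> cabs (b k) = (1 - k%:R / K%:R) * cabs a.
  move=> kK; rewrite cabsM cabs_real ger0_norm // subr_ge0 ler_pdivrMr // mul1r ler_nat //.
have : forall k, (k <= K)%N -> forall z, cabs (z - b k) < 1 - cabs (b k) -> f z = 0.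
  elim=> [_ z|k IH kK z].
    by rewrite /b mul0r subr0 mul1r; apply: za.
  have kd : 0 <= (k%:R / K%:R : R) by rewrite divr_ge0 // ltW.
  have bk1 : cabs (b k) < 1 by rewrite cb 1?ltnW //; nra.
  have kd1 : 0 <= (k.+1%:R / K%:R : R) by rewrite divr_ge0 // ltW.
  have kd2 : (k.+1%:R / K%:R : R) <= 1 by rewrite ler_pdivrMr // mul1r ler_nat.
  have bk1' : cabs (b k.+1) < 1 by rewrite cb //; nra.
  have [|[r r0 hr]] := zero_isolated (hb (b k.+1)) ltac:(lra); first by apply.
  have dist : cabs (b k.+1 - b k) < 1 - cabs (b k).
    have -> : b k.+1 - b k = (- K%:R^-1)%:C * a.
      rewrite /b -mulrBl -rmorphB; congr (_%:C * _); rewrite -natr1; field; by rewrite gt_eqF.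
    rewrite cabsM cabs_real normrN ger0_norm ?invr_ge0 1?ltW // cb 1?ltnW //.
    apply: (@lt_le_trans _ _ (1 - cabs a)); last by nra.
    by move: hK; rewrite ltr_pdivrMr ?ltr_pdivrMl //; lra.
  pose s := Num.min r (1 - cabs (b k) - cabs (b k.+1 - b k)) / 2.
  have [s0 sr sd] : [/\ 0 < s, s < r & s < 1 - cabs (b k) - cabs (b k.+1 - b k)].
    have m0 : 0 < Num.min r (1 - cabs (b k) - cabs (b k.+1 - b k)) by rewrite lt_min r0; lra.
    have m1 : Num.min r (1 - cabs (b k) - cabs (b k.+1 - b k)) <= r by rewrite ge_min lexx.
    have m2 : Num.min r (1 - cabs (b k) - cabs (b k.+1 - b k)) <= 1 - cabs (b k) - cabs (b k.+1 - b k).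
      by rewrite ge_min lexx orbT.
    by rewrite /s; split; lra.
  have := hr (b k.+1 + s%:C); rewrite addrC addKr cabs_real gtr0_norm // s0 sr => /(_ isT).
  rewrite (IH (ltnW kK)) ?eqxx //.
  have -> : b k.+1 + s%:C - b k = s%:C + (b k.+1 - b k) by ring.
  by apply: (le_lt_trans (cabsD _ _)); rewrite cabs_real gtr0_norm //; lra.
move=> /(_ K (leqnn K) z1); rewrite /b divff ?gt_eqF // subrr mul0r subr0 cabs0 subr0 => /(_ hz1) z10.
by rewrite z10 eqxx in fz1.
Qed.

(** On the circle of radius 3/4 the factor of [cauchy_diff0] is at most (1/4) / (1/2). A contraction
    by one half is all that the iteration in [modular_const] asks for. *)
Lemma schwarz_weak f (B : R) z : (forall z, cabs z < 1 -> hol f z) -> f 0 = 0 ->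
  (forall z, cabs z < 1 -> cabs (f z) <= B) -> cabs z <= 1 / 4 -> cabs (f z) <= B / 2.
Proof.
move=> hf f0 hB hz; have B0 : 0 <= B.
  by apply: le_trans (hB 0 ltac:(by rewrite cabs0)); apply: cabs_ge0.
have z0 := cabs_ge0 z.
have := @cauchy_diff0 f 1 (3 / 4) B z hf ltac:(lra) ltac:(lra) ltac:(by move=> w hw; apply: hB; lra).
rewrite f0 subr0 => h; apply: (le_trans h).
rewrite ler_pdivrMr; last lra.
nra.
Qed.

End CauchyConsequences.

(** * Theta functions and the discriminant *)

Section QProduct.
Variable R : realType.
Local Notation C := R[i].
Implicit Types (q w z : C).

(** A partial product of the q-Pochhammer symbol (q w; q) of infinite length. The index starts at 1,
    so the factor 1 - w is absent. *)
Definition qprod_part q w (M : nat) : C := \prod_(1 <= m < M.+1) (1 - q ^+ m * w).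

Definition qprod q w : C := limn (qprod_part q w : nat -> C^o).

Lemma clim_lim (u : nat -> C) l : clim u l -> limn (u : nat -> C^o) = l.
Proof. by move=> /climP h; apply/cvg_lim. Qed.

Lemma qprod_partS q w M : qprod_part q w M.+1 = qprod_part q w M * (1 - q ^+ M.+1 * w).
Proof. by rewrite /qprod_part big_nat_recr. Qed.

(** From [1 + x <= expR x]; the exponent is r (rho + ... + rho^M). The bounds [rho] and [r] replace
    the moduli so that convergence is uniform in [q] and in [w]. *)
Lemma qprod_part_le q w (rho r : R) M : 0 <= rho < 1 -> cabs q <= rho -> cabs w <= r ->
  cabs (qprod_part q w M) <= expR (r * (rho - rho ^+ M.+1) / (1 - rho)).
Proof.
move=> hrho hq hw; have r0 : 0 <= r := le_trans (cabs_ge0 w) hw.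
elim: M => [|M IH].
  by rewrite /qprod_part big_geq // expr1 subrr mulr0 mul0r expR0 cabs1.
rewrite qprod_partS cabsM.
have -> : r * (rho - rho ^+ M.+2) / (1 - rho) = r * (rho - rho ^+ M.+1) / (1 - rho) + r * rho ^+ M.+1.
  by rewrite [rho ^+ M.+2]exprS; field; rewrite subr_eq0 eq_sym lt_eqF //; lra.
rewrite expRD; apply: ler_pM => //; rewrite ?cabs_ge0 //.
apply: le_trans (expR_ge1Dx _); apply: (le_trans (cabsD _ _)).
rewrite cabs1 cabsN cabsM cabsX lerD2l mulrC; apply: ler_pM; rewrite ?cabs_ge0 ?exprn_ge0 //.
  exact: cabs_ge0.
by rewrite lerXn2r ?nnegrE ?cabs_ge0 //; lra.
Qed.

Lemma qprod_part_cauchy q w (rho r : R) M n : 0 <= rho < 1 -> cabs q <= rho -> cabs w <= r ->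
  cabs (qprod_part q w (M + n) - qprod_part q w M) <=
    expR (r / (1 - rho)) * r / (1 - rho) * (rho ^+ M.+1 - rho ^+ (M + n).+1).
Proof.
move=> hrho hq hw; have r0 : 0 <= r := le_trans (cabs_ge0 w) hw.
elim: n => [|n IH]; first by rewrite addn0 !subrr cabs0 mulr0.
rewrite addnS; apply: (le_trans (cabsBD (qprod_part q w (M + n)) _ _)).
have k : cabs (qprod_part q w (M + n)) <= expR (r / (1 - rho)).
  apply: (le_trans (qprod_part_le _ hrho hq hw)); rewrite ler_expR.
  apply: ler_wpM2r; first by rewrite invr_ge0; lra.
  have : 0 <= rho ^+ (M + n).+1 by rewrite exprn_ge0 //; lra.
  by move=> ?; rewrite -[X in _ <= X]mulr1; apply: ler_wpM2l => //; lra.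
rewrite qprod_partS -[X in _ - X]mulr1 -mulrBr cabsM.
have -> : 1 - q ^+ (M + n).+1 * w - 1 = - (q ^+ (M + n).+1 * w) by ring.
rewrite cabsN cabsM cabsX.
have -> : expR (r / (1 - rho)) * r / (1 - rho) * (rho ^+ M.+1 - rho ^+ (M + n).+2) =
   expR (r / (1 - rho)) * (rho ^+ (M + n).+1 * r) +
   expR (r / (1 - rho)) * r / (1 - rho) * (rho ^+ M.+1 - rho ^+ (M + n).+1).
  rewrite [rho ^+ (M + n).+2]exprS; generalize (expR (r / (1 - rho))) => X.
  by field; rewrite subr_eq0 eq_sym lt_eqF //; lra.
apply: lerD IH; apply: ler_pM; rewrite ?cabs_ge0 ?mulr_ge0 ?exprn_ge0 ?cabs_ge0 //.
apply: ler_pM; rewrite ?cabs_ge0 ?exprn_ge0 ?cabs_ge0 //.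
by rewrite lerXn2r ?nnegrE ?cabs_ge0 //; lra.
Qed.

Definition qprod_rate (rho r : R) : R := expR (r / (1 - rho)) * r / (1 - rho).

Lemma qprod_rate_ge0 (rho r : R) : 0 <= rho < 1 -> 0 <= r -> 0 <= qprod_rate rho r.
Proof.
by move=> h r0; rewrite /qprod_rate !mulr_ge0 ?expR_ge0 ?invr_ge0 //; lra.
Qed.

Lemma geometric_small (rho K e : R) : 0 <= rho < 1 -> 0 <= K -> 0 < e ->
  exists N, forall n, (N <= n)%N -> K * rho ^+ n.+1 < e.
Proof.
move=> hrho K0 e0.
have h1 : `|rho| < 1 by rewrite ger0_norm //; lra.
have /cvgrPdist_lt := cvg_expr h1 => /(_ (e / (K + 1))).
rewrite divr_gt0 //; last lra.
move=> /(_ isT)[N _ hN]; exists N => n hn.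
have := hN n.+1 (leq_trans hn (leqnSn n)) => /=; rewrite sub0r normrN ger0_norm ?exprn_ge0 //; last lra.
rewrite ltr_pdivlMr; last lra.
have : 0 <= rho ^+ n.+1 by rewrite exprn_ge0 //; lra.
nra.
Qed.

Lemma qprod_clim q w : cabs q < 1 -> clim (qprod_part q w) (qprod q w).
Proof.
move=> q1; have q0 := cabs_ge0 q; have w0 := cabs_ge0 w.
have hrho : 0 <= cabs q < 1 by rewrite q0.
have [l hl] : exists l, clim (qprod_part q w) l.
  apply: ccomplete => e e0.
  have [N hN] := geometric_small hrho (qprod_rate_ge0 hrho w0) e0.
  exists N => n Nn; rewrite -(subnKC Nn).
  apply: (le_lt_trans (qprod_part_cauchy _ _ hrho (lexx _) (lexx _))).
  apply: le_lt_trans (hN N (leqnn N)); rewrite -/(qprod_rate _ _).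
  by apply: ler_wpM2l; [exact: qprod_rate_ge0 | rewrite lerBlDr lerDl exprn_ge0].
by rewrite /qprod (clim_lim hl).
Qed.

Lemma qprod_approx q w (rho r : R) M : 0 <= rho < 1 -> cabs q <= rho -> cabs w <= r ->
  cabs (qprod q w - qprod_part q w M) <= qprod_rate rho r * rho ^+ M.+1.
Proof.
move=> hrho hq hw; have r0 : 0 <= r := le_trans (cabs_ge0 w) hw.
have q1 : cabs q < 1 by apply: (le_lt_trans hq); case/andP: hrho.
have h := climB (qprod_clim w q1) (clim_cst (qprod_part q w M)).
apply: (clim_le h); exists M => n Mn; rewrite -(subnKC Mn).
apply: (le_trans (qprod_part_cauchy _ _ hrho hq hw)); rewrite -/(qprod_rate _ _).
by apply: ler_wpM2l; [exact: qprod_rate_ge0 | rewrite lerBlDr lerDl exprn_ge0 //; lra].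
Qed.

Lemma hol_qprod_part_w q M w : hol (fun w => qprod_part q w M) w.
Proof.
apply: hol_prod => m; apply: holB; first exact: hol_cst.
by apply: holM; [exact: hol_cst | exact: hol_id].
Qed.

Lemma hol_qprod_part_q w M q : hol (fun q => qprod_part q w M) q.
Proof.
apply: hol_prod => m; apply: holB; first exact: hol_cst.
by apply: holM; [apply: holX; exact: hol_id | exact: hol_cst].
Qed.

Lemma hol_qprod_w q w : cabs q < 1 -> hol (qprod q) w.
Proof.
move=> q1; apply: (@hol_limit _ (fun M w => qprod_part q w M) _ _ 1 ltr01).
  by move=> M z _; exact: hol_qprod_part_w.
move=> e e0; have hrho : 0 <= cabs q < 1 by rewrite cabs_ge0.
have r0 : 0 <= cabs w + 1 by have := cabs_ge0 w; lra.
have [N hN] := geometric_small hrho (qprod_rate_ge0 hrho r0) e0.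
exists N => n z Nn hz; rewrite cabsB.
apply: le_trans (ltW (hN n Nn)); apply: qprod_approx => //.
by have := cabs_subl z w; lra.
Qed.

Lemma hol_qprod_q w q : cabs q < 1 -> hol (fun q => qprod q w) q.
Proof.
move=> q1; have q0 := cabs_ge0 q.
apply: (@hol_limit _ (fun M q => qprod_part q w M) _ _ ((1 - cabs q) / 2)); first lra.
  by move=> M z _; exact: hol_qprod_part_q.
move=> e e0; have hrho : 0 <= (cabs q + 1) / 2 < 1 by apply/andP; split; lra.
have [N hN] := geometric_small hrho (qprod_rate_ge0 hrho (cabs_ge0 w)) e0.
exists N => n z Nn hz; rewrite cabsB.
apply: le_trans (ltW (hN n Nn)); apply: qprod_approx => //.
by have := cabs_subl z q; lra.
Qed.

Lemma qprod_w0 q : cabs q < 1 -> qprod q 0 = 1.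
Proof.
move=> q1; apply: clim_unique (qprod_clim _ q1) _.
apply: clim_ext (clim_cst 1) _ => M; rewrite /qprod_part big1 // => m _.
by rewrite mulr0 subr0.
Qed.

Lemma qprod_shift q w : cabs q < 1 -> qprod q w = (1 - q * w) * qprod q (q * w).
Proof.
move=> q1; have h := climMl (1 - q * w) (qprod_clim (q * w) q1).
apply: clim_unique (clim_shift 1 (qprod_clim w q1)) _; apply: clim_ext h _ => M.
rewrite addn1 /qprod_part [RHS]big_nat_recl // expr1; congr (_ * _).
by apply: eq_bigr => m _; rewrite mulrA -exprSr.
Qed.

Lemma qprod_shiftn q w M : cabs q < 1 -> qprod q w = qprod_part q w M * qprod q (q ^+ M * w).
Proof.
move=> q1; elim: M => [|M IH]; first by rewrite /qprod_part big_geq // mul1r expr0 mul1r.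
by rewrite IH qprod_partS (qprod_shift (q ^+ M * w) q1) !mulrA -exprS.
Qed.

(** After enough shifts the argument is so close to 0 that the remaining product is close to 1; the
    zero therefore sits in one of the finitely many factors split off. *)
Lemma qprod_eq0 q w : cabs q < 1 -> qprod q w = 0 -> exists2 m, (0 < m)%N & q ^+ m * w = 1.
Proof.
move=> q1 hE; have hrho : 0 <= cabs q < 1 by rewrite cabs_ge0.
have hc := hol_cont (hol_qprod_w 0 q1).
have [d d0 hd] := hc 1 ltr01.
have [N hN] := geometric_small hrho (cabs_ge0 w) d0.
have nz : qprod q (q ^+ N.+1 * w) != 0.
  have := hd (q ^+ N.+1 * w); rewrite subr0 cabsM cabsX mulrC => /(_ (hN N (leqnn N))).
  by apply: contraTneq => ->; rewrite qprod_w0 // sub0r cabsN cabs1 ltxx.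
move: hE; rewrite (qprod_shiftn w N.+1 q1) => /eqP; rewrite mulf_eq0 (negbTE nz) orbF.
rewrite /qprod_part prodf_seq_eq0 => /hasP[m]; rewrite mem_index_iota => /andP[m0 _] /= /eqP h.
by exists m => //; apply/esym/eqP; rewrite -subr_eq0 h.
Qed.

Lemma qprod_dup q w : cabs q < 1 -> qprod q w * qprod q (- w) = qprod (q ^+ 2) (w ^+ 2).
Proof.
move=> q1; have q21 : cabs (q ^+ 2) < 1.
  by rewrite cabsX exprn_ilt1 // cabs_ge0.
apply: clim_unique (climM (qprod_clim w q1) (qprod_clim (- w) q1)) _.
apply: clim_ext (qprod_clim _ q21) _ => M; rewrite /qprod_part -big_split /=.
by apply: eq_bigr => m _; rewrite -exprM mulnC exprM; ring.
Qed.

(** The factor of [w / q] with index m is the one of exponent 2 m - 1, since q^(2m) (w / q) =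
    q^(2m-1) w. *)
Lemma qprod_even_odd q w : cabs q < 1 -> q != 0 ->
  qprod q w = qprod (q ^+ 2) w * qprod (q ^+ 2) (w / q).
Proof.
move=> q1 q0; have q21 : cabs (q ^+ 2) < 1.
  by rewrite cabsX exprn_ilt1 // cabs_ge0.
have h : clim (fun M => qprod_part q w (M + M)%N) (qprod q w).
  move=> e e0; have [N hN] := qprod_clim w q1 e0; exists N => n Nn; apply: hN.
  by rewrite (leq_trans Nn) // leq_addr.
apply: clim_unique h _; apply: clim_ext (climM (qprod_clim _ q21) (qprod_clim _ q21)) _ => M.
elim: M => [|M IH]; first by rewrite /qprod_part !big_geq // mulr1.
rewrite addnS addSn !qprod_partS -IH -!exprM.
have -> : q ^+ (2 * M.+1) * (w / q) = q ^+ (M + M).+1 * w.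
  have -> : (2 * M.+1 = (M + M).+1.+1)%N by lia.
  by rewrite exprSr; field.
have -> : (2 * M.+1 = (M + M).+2)%N by lia.
ring.
Qed.

Lemma qprod1_neq0 q : cabs q < 1 -> qprod q 1 != 0.
Proof.
move=> q1; apply/eqP => /(qprod_eq0 q1)[m m0]; rewrite mulr1 => /(congr1 (@cabs R)).
rewrite cabsX cabs1 => h; have : cabs q ^+ m < 1 by rewrite exprn_ilt1 ?cabs_ge0 // -lt0n.
by rewrite h ltxx.
Qed.

(* Euler: the partitions into odd parts and into distinct parts are equinumerous *)
Lemma qprod_euler q p : cabs q < 1 -> q != 0 -> q = p ^+ 2 ->
  qprod q (- 1) * qprod q p^-1 * qprod q (- p^-1) = 1.
Proof.
move=> q1 q0 qp; apply: (mulfI (qprod1_neq0 q1)).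
rewrite -mulrA qprod_dup // mulrA qprod_dup // mulr1 (qprod_even_odd 1 q1 q0) expr1n.
by rewrite exprVn -qp div1r.
Qed.

End QProduct.

(** * Zeros and quasi-periods of the theta product, division by theta *)

Section ThetaProduct.
Variable R : realType.
Local Notation C := R[i].
Implicit Types (tau z w x : C) (f g : C -> C).

(* The product side of Jacobi's triple product: theta11 up to a factor depending only on tau. *)
Definition thetaP tau z : C :=
  (ce (z / 2) - ce (- (z / 2))) * qprod (ce tau) (ce z) * qprod (ce tau) (ce (- z)).

Lemma hol_ce_lin (a b : C) z : hol (fun w => ce (a * w + b)) z.
Proof.
apply: (@hol_comp _ (fun w => a * w + b) (@ce R)); last exact: hol_ce.
by apply: holD; [apply: holM; [exact: hol_cst | exact: hol_id] | exact: hol_cst].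
Qed.

Lemma upper_lt1 tau : upper_half_plane tau -> cabs (ce tau) < 1.
Proof. by rewrite cabs_ce_lt1. Qed.

Lemma hol_thetaP tau z : upper_half_plane tau -> hol (thetaP tau) z.
Proof.
move=> /upper_lt1 q1; apply: holM; first apply: holM.
- apply: holB.
    by under eq_fun do rewrite mulrC; exact: hol_ceM.
  by under eq_fun do rewrite mulrC -mulNr; exact: hol_ceM.
- by apply: (@hol_comp _ (@ce R)); [exact: hol_ce | exact: hol_qprod_w].
apply: (@hol_comp _ (fun w => ce (- w))); last exact: hol_qprod_w.
by under eq_fun do rewrite -mulN1r; exact: hol_ceM.
Qed.

Lemma thetaPN tau z : thetaP tau (- z) = - thetaP tau z.
Proof. by rewrite /thetaP mulNr !opprK; ring. Qed.

Lemma thetaP0 tau : thetaP tau 0 = 0.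
Proof. by rewrite /thetaP mul0r oppr0 subrr !mul0r. Qed.

Lemma thetaPD1 tau z : thetaP tau (z + 1) = - thetaP tau z.
Proof.
have e1 : ce (z + 1) = ce z by rewrite ceD ce1 mulr1.
have e2 : ce (- (z + 1)) = ce (- z) by rewrite ceN e1 -ceN.
have e3 : ce ((z + 1) / 2) = - ce (z / 2) by rewrite mulrDl ceD ce_half mulrN1.
have e4 : ce (- ((z + 1) / 2)) = - ce (- (z / 2)) by rewrite ceN e3 invrN -ceN.
by rewrite /thetaP e1 e2 e3 e4; ring.
Qed.

Lemma thetaPDtau tau z : upper_half_plane tau ->
  thetaP tau (z + tau) = - (ce (- (tau / 2) - z) * thetaP tau z).
Proof.
move=> /upper_lt1 q1; have z0 := ce_neq0 z; have t0 := ce_neq0 tau.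
have h2 : 2 != 0 :> C by rewrite pnatr_eq0.
have e1 : ce (z + tau) = ce tau * ce z by rewrite ceD mulrC.
have e2 : ce (- (z + tau)) = (ce tau * ce z)^-1 by rewrite ceN e1.
have k1 : qprod (ce tau) (ce z) = (1 - ce tau * ce z) * qprod (ce tau) (ce tau * ce z).
  exact: qprod_shift.
have k2 : qprod (ce tau) ((ce tau * ce z)^-1) = (1 - (ce z)^-1) * qprod (ce tau) ((ce z)^-1).
  by rewrite qprod_shift // invfM mulrA divff // mul1r.
have f1 : ce ((z + tau) / 2) - ce (- ((z + tau) / 2)) = ce (- ((z + tau) / 2)) * (ce tau * ce z - 1).
  rewrite mulrBr mulr1 -ceD -ceD; congr (ce _ - _); by field.
have f2 : ce (z / 2) - ce (- (z / 2)) = ce (z / 2) * (1 - (ce z)^-1).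
  rewrite mulrBr mulr1 -ceN -ceD; congr (_ - ce _); by field.
rewrite /thetaP f1 f2 e1 e2 k2 k1 ceN.
have -> : ce (- ((z + tau) / 2)) = ce (- (tau / 2) - z) * ce (z / 2).
  by rewrite -ceD; congr ce; field.
rewrite -ceN; ring.
Qed.

Lemma lattice_int tau (a b : int) : lattice tau (a%:~R * tau + b%:~R).
Proof. by exists a, b. Qed.

Lemma lattice0 tau : lattice tau 0.
Proof. by exists 0, 0; rewrite !mulr0z mul0r addr0. Qed.

Lemma latticeN tau z : lattice tau z -> lattice tau (- z).
Proof. by move=> [a [b ->]]; exists (- a), (- b); rewrite !mulrNz; ring. Qed.

Lemma latticeD tau z w : lattice tau z -> lattice tau w -> lattice tau (z + w).
Proof.
by move=> [a [b ->]] [c [d ->]]; exists (a + c), (b + d); rewrite !intrD; ring.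
Qed.

Lemma latticeB tau z w : lattice tau z -> lattice tau w -> lattice tau (z - w).
Proof. by move=> hz /latticeN; apply: latticeD. Qed.

Lemma latticeMn tau z k : lattice tau z -> lattice tau (z *+ k).
Proof.
move=> h; elim: k => [|k IH]; first by rewrite mulr0n; exact: lattice0.
by rewrite mulrS; apply: latticeD.
Qed.

Lemma thetaP_eq0 tau z : upper_half_plane tau -> thetaP tau z = 0 -> lattice tau z.
Proof.
move=> /upper_lt1 q1; rewrite /thetaP => /eqP; rewrite !mulf_eq0 => /orP[/orP[|]|].
- rewrite subr_eq0 => /eqP h.
  have /ce_eq1[k hk] : ce z = 1.
    have -> : z = z / 2 + z / 2 by field.
    by rewrite ceD {1}h -ceD addNr ce0.
  by exists 0, k; rewrite mulr0z mul0r add0r.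
- move=> /eqP /(qprod_eq0 q1)[m _]; rewrite ceX -ceD => /ce_eq1[k hk].
  exists (- m%:Z), k; rewrite mulrNz -hk; have -> : (m%:Z)%:~R = m%:R :> C by [].
  by ring.
move=> /eqP /(qprod_eq0 q1)[m _]; rewrite ceX -ceD => /ce_eq1[k hk].
exists m%:Z, (- k); rewrite mulrNz -hk; have -> : (m%:Z)%:~R = m%:R :> C by [].
by ring.
Qed.

(** An entire multiplier without zeros: what is required to transport the local behaviour of
    [thetaP] at 0 to every lattice point. *)
Definition quasi_factor tau (l : C) := exists2 u : C -> C,
  (forall z, hol u z) /\ (forall z, u z != 0) & forall z, thetaP tau (z + l) = u z * thetaP tau z.

Lemma quasi_factorD tau l m : quasi_factor tau l -> quasi_factor tau m -> quasi_factor tau (l + m).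
Proof.
move=> [u [hu u0] uE] [v [hv v0] vE]; exists (fun z => v (z + l) * u z).
  split=> z; last by rewrite mulf_neq0.
  apply: holM => //; apply: (@hol_comp _ (fun z => z + l)) => //.
  by apply: holD; [exact: hol_id | exact: hol_cst].
by move=> z; rewrite addrA vE uE mulrA.
Qed.

Lemma quasi_factorN tau l : quasi_factor tau l -> quasi_factor tau (- l).
Proof.
move=> [u [hu u0] uE]; exists (fun z => (u (z - l))^-1).
  split=> z; last by rewrite invr_neq0.
  apply: holV => //; apply: (@hol_comp _ (fun z => z - l)) => //.
  by apply: holB; [exact: hol_id | exact: hol_cst].
by move=> z; have := uE (z - l); rewrite subrK => ->; rewrite mulKf.
Qed.

Lemma quasi_factorMz tau l (a : int) : quasi_factor tau l -> quasi_factor tau (a%:~R * l).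
Proof.
move=> h; have nat (k : nat) : quasi_factor tau (k%:R * l).
  elim: k => [|k IH].
    exists (fun _ => 1); last by move=> z; rewrite mul0r addr0 mul1r.
    by split=> z; [exact: hol_cst | exact: oner_neq0].
  by rewrite -natr1 mulrDl mul1r; apply: quasi_factorD.
case: a => k; first exact: nat.
by rewrite NegzE mulrNz mulNr; apply: quasi_factorN; exact: nat.
Qed.

Lemma thetaP_lattice tau l : upper_half_plane tau -> lattice tau l -> quasi_factor tau l.
Proof.
move=> ht [a [b ->]].
have qtau : quasi_factor tau tau.
  exists (fun z => - (ce (- (tau / 2) - z))); last by move=> z; rewrite thetaPDtau // mulNr.
  split=> z; last by rewrite oppr_eq0 ce_neq0.
  apply: holN; have -> : (fun w => ce (- (tau / 2) - w)) = (fun w => ce (- 1 * w + - (tau / 2))).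
    by apply/funext => w; congr ce; ring.
  exact: hol_ce_lin.
have q1 : quasi_factor tau 1.
  exists (fun _ => -1); last by move=> z; rewrite thetaPD1 mulN1r.
  by split=> z; [exact: hol_cst | rewrite oppr_eq0 oner_neq0].
apply: quasi_factorD; first exact: quasi_factorMz.
by have := quasi_factorMz b q1; rewrite mulr1.
Qed.

Lemma thetaP_lattice0 tau l : upper_half_plane tau -> lattice tau l -> thetaP tau l = 0.
Proof. by move=> ht /(thetaP_lattice ht)[u _ h]; rewrite -[l]add0r h thetaP0 mulr0. Qed.

Lemma front_factor : exists2 s : C -> C, (forall z, hol s z) /\ s 0 != 0 &
  forall z, ce (z / 2) - ce (- (z / 2)) = z * s z.
Proof.
have hf z : hol (fun z => ce (z / 2) - ce (- (z / 2)) : C) z.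
  apply: holB; first by under eq_fun do rewrite mulrC; exact: hol_ceM.
  by under eq_fun do rewrite mulrC -mulNr; exact: hol_ceM.
have [s hs sE] := division (c := 0) (rho := 1) (fun z _ => hf z) ltr01.
have {}sE z : ce (z / 2) - ce (- (z / 2)) = z * s z.
  by have := sE z; rewrite /= mul0r oppr0 subrr add0r addr0.
exists s => //; split.
  move=> z; have [->|z0] := eqVneq z 0; first by apply: hs; rewrite subrr cabs0.
  apply: (@hol_near _ (fun w => (ce (w / 2) - ce (- (w / 2))) / w) _ _ (cabs z)).
  - by rewrite cabs_gt0.
  - move=> w hw; rewrite sE mulrC mulKf //; apply: contraTneq hw => ->.
    by rewrite sub0r cabsN ltxx.
  by apply: holM => //; apply: holV => //; exact: hol_id.
(* If [s 0 = 0], then |s(t)| < 1 for small real t > 0. But the slope of the exponential gives |e(t)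
   - 1| >= (3/2) pi t, and |e(-t/2)| >= 7/8, so |s(t)| >= (7/8) 3 > 1. *)
apply/eqP => s0; have p0 := @pi_gt0 R.
have hc := hol_cont (hs 0 ltac:(by rewrite subrr cabs0)).
have [d d0 hd] := hc 1 ltr01.
have [d' d'0 hd'] := @cexp_slope0 R (1 / 4) ltac:(lra).
have hcc := hol_cont (hol_ce (0 : C)).
have [d'' d''0 hd''] := hcc (1 / 8) ltac:(lra).
pose m := Num.min (Num.min d (d' / (2 * pi))) d''.
have [m0 md md' md''] : [/\ 0 < m, m <= d, m * (2 * pi) <= d' & m <= d''].
  rewrite /m; split; rewrite ?lt_min ?ge_min ?lexx ?orbT ?d0 ?d''0 //=.
    by rewrite divr_gt0 // mulr_gt0.
  rewrite -ler_pdivlMr; last by rewrite mulr_gt0.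
  by rewrite ge_min [X in X || _]ge_min lexx orbT.
pose t := m / 2; have t0 : 0 < t by rewrite /t; lra.
have ct : cabs (t%:C : C) = t by rewrite cabs_real gtr0_norm.
have h1 := hd t%:C ltac:(rewrite subr0 ct /t; lra); rewrite s0 subr0 in h1.
have c2pi : cabs (0 +i* (2 * pi) : C) = 2 * pi.
  by rewrite /cabs /= expr0n add0r sqrtr_sqr gtr0_norm // mulr_gt0.
have h2 := hd' ((0 +i* (2 * pi)) * t%:C).
rewrite cabsM c2pi ct -/(ce t%:C) in h2.
have {h2} h2 := h2 ltac:(rewrite /t; lra).
have h3 := hd'' (- (t%:C / 2)).
rewrite subr0 cabsN -realC2 cabs_real gtr0_norm in h3; last lra.
have {h3} h3 := h3 ltac:(rewrite /t; lra); rewrite ce0 in h3.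
have k3 : 7 / 8 <= cabs (ce (- (t%:C / 2))).
  rewrite -realC2; have := cabs_subl 1 (ce (- (t / 2)%:C)); rewrite cabs1 cabsB; lra.
have e1 : t%:C * s t%:C = ce (- (t%:C / 2)) * (ce t%:C - 1).
  rewrite -sE mulrBr mulr1 -ceD; congr (ce _ - _); by field.
have := congr1 (@cabs R) e1; rewrite (cabsM t%:C) (cabsM (ce _)) ct => e2.
have k4 : 3 / 2 * pi * t <= cabs (ce t%:C - 1).
  have := cabs_subl ((0 +i* (2 * pi)) * t%:C) (- (ce t%:C - 1 - (0 +i* (2 * pi)) * t%:C)).
  rewrite cabsN (_ : _ - - _ = ce t%:C - 1); last by ring.
  rewrite cabsM c2pi ct; lra.
have p2 := @pi_ge2 R.
have k5 : 7 / 8 * (3 * t) <= cabs (ce (- (t%:C / 2))) * cabs (ce t%:C - 1).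
  apply: ler_pM => //; first lra.
  by apply: le_trans k4; nra.
have : t * cabs (s t%:C) <= t * 1 by apply: ler_wpM2l; lra.
lra.
Qed.

(** Off the lattice this is continuity. A lattice point is moved to 0 by [thetaP_lattice], and
    vanishing near 0 would make the non-zero cofactor of z in [thetaP] vanish at 0. *)
Lemma thetaP_isolated tau x : upper_half_plane tau ->
  exists2 r : R, 0 < r & forall z, 0 < cabs (z - x) < r -> thetaP tau z != 0.
Proof.
move=> ht; have [s [hs s0] sE] := front_factor.
have [lx|nl] := pselect (lattice tau x); last first.
  have hc := hol_cont (hol_thetaP x ht).
  have px : thetaP tau x != 0 by apply/eqP => /(thetaP_eq0 ht).
  have [d d0 hd] := hc (cabs (thetaP tau x)) ltac:(by rewrite cabs_gt0).
  exists d => // z /andP[_ /hd]; apply: contraTneq => ->.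
  by rewrite sub0r cabsN ltxx.
have [u [_ u0] uE] := thetaP_lattice ht lx.
have [|[r r0 hr]] := zero_isolated (c := 0) (rho := 1) (fun z _ => hol_thetaP z ht) ltr01.
  move=> h; have : s 0 * qprod (ce tau) 1 * qprod (ce tau) 1 = 0.
    pose F w := s w * qprod (ce tau) (ce w) * qprod (ce tau) (ce (- w)).
    have -> : s 0 * qprod (ce tau) 1 * qprod (ce tau) 1 = F 0 by rewrite /F oppr0 !ce0.
    have q1 := upper_lt1 ht.
    apply: (cont_eq0 (r := 1) ltr01).
      apply: hol_cont; apply: holM; first apply: holM => //.
        by apply: (@hol_comp _ (@ce R)); [exact: hol_ce | exact: hol_qprod_w].
      apply: (@hol_comp _ (fun w => ce (- w))); last exact: hol_qprod_w.
      by under eq_fun do rewrite -mulN1r; exact: hol_ceM.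
    move=> w /andP[w0 w1]; rewrite subr0 in w0.
    have := h w w1; rewrite /thetaP sE -!mulrA => /eqP; rewrite mulf_eq0.
    by rewrite -cabs_eq0 gt_eqF //= mulrA => /eqP.
  by move/eqP; rewrite !mulf_eq0 (negbTE s0) !(negbTE (qprod1_neq0 (upper_lt1 ht))).
exists r => // z hz; have -> : z = (z - x) + x by rewrite subrK.
by rewrite uE mulf_neq0 //; apply: hr; rewrite subr0.
Qed.

(* zeros of thetaP are simple, so a function vanishing on x + lattice is a multiple of it *)
Lemma thetaP_division tau x f : upper_half_plane tau -> (forall z, hol f z) ->
  (forall l, lattice tau l -> f (x + l) = 0) ->
  exists2 g, (forall z, hol g z) & forall z, f z = g z * thetaP tau (z - x).
Proof.
move=> ht hf f0; have [s [hs s0] sE] := front_factor; have q1 := upper_lt1 ht.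
pose P z := thetaP tau (z - x).
have hP z : hol P z.
  apply: (@hol_comp _ (fun z => z - x)); last exact: hol_thetaP.
  by apply: holB; [exact: hol_id | exact: hol_cst].
have isoP z0 : exists2 r : R, 0 < r & forall z, 0 < cabs (z - z0) < r -> P z != 0.
  have [r r0 hr] := thetaP_isolated (z0 - x) ht; exists r => // z hz; apply: hr.
  by have -> : z - x - (z0 - x) = z - z0 by ring.
(* Local quotients: off the zeros of [P] directly, at a zero after cancelling the common factor
   [z - z0]. *)
have /choice[G hG] : forall z0, exists g, hol g z0 /\ exists2 d : R, 0 < d & forall z, cabs (z - z0) < d -> f z = g z * P z.
  move=> z0; have [lz|nl] := pselect (lattice tau (z0 - x)); last first.
    have Pz : P z0 != 0 by apply/eqP => /(thetaP_eq0 ht).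
    exists (fun z => f z / P z); split; first by apply: holM => //; apply: holV.
    have [r r0 hr] := isoP z0; exists r => // z hz; rewrite divfK //.
    have [->//|zz] := eqVneq z z0.
    by apply: hr; rewrite hz andbT cabs_gt0 subr_eq0.
  have [f1 hf1 f1E] := division (c := z0) (rho := 1) (fun z _ => hf z) ltr01.
  have [u [hu u0] uE] := thetaP_lattice ht lz.
  pose F w := s w * qprod (ce tau) (ce w) * qprod (ce tau) (ce (- w)).
  have hF w : hol F w.
    apply: holM; first apply: holM => //.
      by apply: (@hol_comp _ (@ce R)); [exact: hol_ce | exact: hol_qprod_w].
    apply: (@hol_comp _ (fun w => ce (- w))); last exact: hol_qprod_w.
    by under eq_fun do rewrite -mulN1r; exact: hol_ceM.
  have F0 : F 0 != 0 by rewrite /F oppr0 ce0 !mulf_neq0 ?qprod1_neq0.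
  pose P1 z := u (z - z0) * F (z - z0).
  have PE z : P z = (z - z0) * P1 z.
    by rewrite /P -[z - x](_ : (z - z0) + (z0 - x) = _) ?uE /P1 /F /thetaP ?sE; ring.
  have hz0 : hol (fun z => z - z0) z0 by apply: holB; [exact: hol_id | exact: hol_cst].
  have hP1 : hol P1 z0.
    by apply: holM; apply: (@hol_comp _ (fun z => z - z0)).
  have P10 : P1 z0 != 0 by rewrite /P1 subrr mulf_neq0.
  exists (fun z => f1 z / P1 z); split.
    by apply: holM; [apply: hf1; rewrite subrr cabs0 | apply: holV].
  have [r r0 hr] := isoP z0; exists r => // z hz.
  have fz0 : f z0 = 0 by rewrite -(f0 _ lz); congr f; ring.
  rewrite f1E fz0 add0r; have [->|zz] := eqVneq z z0.
    by rewrite PE subrr !mul0r mulr0.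
  have : P z != 0 by apply: hr; rewrite hz andbT cabs_gt0 subr_eq0.
  by rewrite PE mulf_eq0 negb_or => /andP[_ p1]; field.
(* The local quotients glue because they agree wherever [P] is non-zero, that is, on a punctured
   neighbourhood of each point. *)
exists (fun z => G z z); last by move=> z; have [_ [d d0]] := hG z; apply; rewrite subrr cabs0.
move=> z0; have [hg [d d0 gE]] := hG z0; have [r r0 hr] := isoP z0.
apply: (@hol_near _ (G z0) _ _ (Num.min d r)) => //; first by rewrite lt_min d0.
move=> z; rewrite lt_min => /andP[zd zr].
have [->//|zz] := eqVneq z z0.
have Pz : P z != 0 by apply: hr; rewrite zr andbT cabs_gt0 subr_eq0.
have [_ [d' d'0 /(_ z)]] := hG z; rewrite subrr cabs0 => /(_ d'0).
by rewrite gE // => /(mulIf Pz).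
Qed.

(** Cancellation of a theta factor, by isolation of its zeros and continuity of [f]. *)
Lemma mul_thetaP_eq0 tau x f : upper_half_plane tau -> (forall z, cont f z) ->
  (forall z, f z * thetaP tau (z - x) = 0) -> forall z, f z = 0.
Proof.
move=> ht hf h z; have [r r0 hr] := thetaP_isolated (z - x) ht.
apply: (cont_eq0 r0) => // w hw; have := h w; move/eqP; rewrite mulf_eq0.
suff /negbTE-> : thetaP tau (w - x) != 0 by rewrite orbF => /eqP.
by apply: hr; have -> : w - x - (z - x) = w - z by ring.
Qed.

(** Compactness again. Three parameters, because [phi_hol] varies both real coordinates of z and the
    real part of t2. *)
Lemma box_bounded (F : R -> R -> R -> C) :
  (forall (x y z : R), 0 <= x <= 1 -> 0 <= y <= 1 -> 0 <= z <= 1 ->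
    exists B, exists2 d : R, 0 < d & forall (x' y' z' : R), `|x' - x| < d -> `|y' - y| < d -> `|z' - z| < d ->
      cabs (F x' y' z') <= B) ->
  exists B, forall (x y z : R), 0 <= x <= 1 -> 0 <= y <= 1 -> 0 <= z <= 1 -> cabs (F x y z) <= B.
Proof.
move=> loc.
have [B hB] : exists B, forall (x y z : R), 0 <= x <= 0 + pow2 0 -> 0 <= y <= 0 + pow2 0 -> 0 <= z <= 0 + pow2 0 -> cabs (F x y z) <= B.
  apply: (@bisect3 _ (fun a b c k => exists B, forall (x y z : R), a <= x <= a + pow2 k ->
     b <= y <= b + pow2 k -> c <= z <= c + pow2 k -> cabs (F x y z) <= B)).
    move=> a b c k h.
    have /choice[B hB] : forall e : bool * bool * bool, exists B, forall (x y z : R),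
       a + e.1.1%:R * pow2 k.+1 <= x <= a + e.1.1%:R * pow2 k.+1 + pow2 k.+1 ->
       b + e.1.2%:R * pow2 k.+1 <= y <= b + e.1.2%:R * pow2 k.+1 + pow2 k.+1 ->
       c + e.2%:R * pow2 k.+1 <= z <= c + e.2%:R * pow2 k.+1 + pow2 k.+1 -> cabs (F x y z) <= B.
      by move=> [[e e'] e'']; exact: h.
    exists (\sum_(e : bool * bool * bool) `|B e|) => x y z hx hy hz.
    have half (u v : R) : u <= v <= u + pow2 k -> exists e : bool, u + e%:R * pow2 k.+1 <= v <= u + e%:R * pow2 k.+1 + pow2 k.+1.
      rewrite (pow2S R k) => huv; have [hv|hv] := leP v (u + pow2 k.+1).
        by exists false; rewrite mul0r addr0; lra.
      by exists true; rewrite mul1r; lra.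
    have [e he] := half _ _ hx; have [e' he'] := half _ _ hy; have [e'' he''] := half _ _ hz.
    apply: (le_trans (hB (e, e', e'') x y z he he' he'')); apply: (le_trans (ler_norm _)).
    by rewrite (bigD1 (e, e', e'')) //= lerDl sumr_ge0.
  move=> x y z hx hy hz; have [B [d d0 hd]] := loc x y z hx hy hz.
  have [K hK] := pow2_small d0; exists K => k a b c Kk ha hb hc; exists B => x' y' z' hx' hy' hz'.
  have := pow2_le R Kk => k1.
  by apply: hd; rewrite ltr_norml; lra.
exists B => x y z hx hy hz; apply: hB; by rewrite add0r /pow2 expr0.
Qed.

Lemma tau_decomp tau z : upper_half_plane tau ->
  exists (x y : R), z = x%:C + y%:C * tau.
Proof.
case: tau z => a b [c d]; rewrite /upper_half_plane /= => b0.
exists (c - d / b * a), (d / b); apply/eqP; rewrite eq_complex /=.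
by apply/andP; split; apply/eqP; field; rewrite gt_eqF.
Qed.

Lemma period_int f (l : C) : (forall z, f (z + l) = f z) -> forall (a : int) z, f (z + a%:~R * l) = f z.
Proof.
move=> h; have nat (k : nat) z : f (z + k%:R * l) = f z.
  by elim: k => [|k IH]; rewrite ?mul0r ?addr0 // -natr1 mulrDl mul1r addrA h.
case=> k z; first exact: nat.
by rewrite NegzE mulrNz mulNr -(nat k.+1) subrK.
Qed.

(** Every value is taken on the period parallelogram, where [f] is bounded, so Liouville's theorem
    applies. *)
Lemma elliptic_const tau f : upper_half_plane tau -> (forall z, hol f z) ->
  (forall z, f (z + 1) = f z) -> (forall z, f (z + tau) = f z) -> forall z, f z = f 0.
Proof.
move=> ht hf h1 htau.
have [|B hB] := @box_bounded (fun (x y _ : R) => f (x%:C + y%:C * tau)).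
  move=> x y z _ _ _.
  pose z0 : C := x%:C + y%:C * tau; have hc := hol_cont (hf z0).
  have [d d0 hd] := hc 1 ltr01.
  exists (cabs (f z0) + 1); exists (d / (2 * (cabs tau + 1))).
    by rewrite divr_gt0 // mulr_gt0 //; have := cabs_ge0 tau; lra.
  move=> x' y' z' hx hy _; have := hd (x'%:C + y'%:C * tau).
  have t0 := cabs_ge0 tau.
  have -> : x'%:C + y'%:C * tau - z0 = (x' - x)%:C + (y' - y)%:C * tau.
    by rewrite /z0 !rmorphB; ring.
  have k1 : cabs ((x' - x)%:C + (y' - y)%:C * tau) < d.
    apply: (le_lt_trans (cabsD _ _)); rewrite cabsM !cabs_real.
    move: hx hy; rewrite !ltr_pdivlMr; try (rewrite mulr_gt0 //; lra).
    have := normr_ge0 (x' - x); have := normr_ge0 (y' - y); nra.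
  move=> /(_ k1); have := cabs_subl (f (x'%:C + y'%:C * tau)) (f z0); lra.
apply: (@liouville _ f B hf) => z; have [x [y ->]] := tau_decomp z ht.
pose a := Num.floor x; pose b := Num.floor y.
have -> : x%:C + y%:C * tau = (x - a%:~R)%:C + (y - b%:~R)%:C * tau + b%:~R * tau + a%:~R * 1.
  by rewrite !rmorphB !rmorph_int /=; ring.
rewrite (period_int h1) (period_int htau).
have fl (t : R) : 0 <= t - (Num.floor t)%:~R <= 1.
  by have := floor_itv t; rewrite intrD => /andP[? ?]; apply/andP; split; lra.
by apply: (hB _ _ 0) => //; rewrite ?fl // lexx ler01.
Qed.

Lemma thetaP_div_lattice tau x y z : upper_half_plane tau -> ~ lattice tau (y - x) ->
  lattice tau z -> thetaP tau (y + z - x) != 0.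
Proof.
move=> ht nl lz; apply/eqP => /(thetaP_eq0 ht) h; apply: nl.
have -> : y - x = (y + z - x) - z by ring.
exact: latticeB.
Qed.

End ThetaProduct.

(** * Inversion formulas of theta and of the discriminant *)

Section ModularTransformation.
Variable R : realType.
Local Notation C := R[i].
Implicit Types (tau z w x : C) (f g : C -> C).

Lemma upper_inv tau : upper_half_plane tau -> upper_half_plane (- tau^-1).
Proof.
case: tau => a b; rewrite /upper_half_plane /= => b0.
by rewrite -[X in 0 < - X]mulNr ?mulNr opprK divr_gt0 // ltr_wpDl ?sqr_ge0 // exprn_gt0.
Qed.

Lemma upper_neq0 tau : upper_half_plane tau -> tau != 0.
Proof. by apply: contraTneq => ->; rewrite /upper_half_plane /= ltxx. Qed.

Lemma two_neq0 : 2 != 0 :> C. Proof. by rewrite pnatr_eq0. Qed.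

Lemma hol_gauss tau z : tau != 0 -> hol (fun w => ce (- (w ^+ 2 / (2 * tau)))) z.
Proof.
move=> t0; apply: (@hol_comp _ (fun w => - (w ^+ 2 / (2 * tau))) (@ce R)); last exact: hol_ce.
apply: holN; apply: holM; last exact: hol_cst.
by apply: holX; exact: hol_id.
Qed.

(** The inverted theta function times the Gaussian vanishes on the lattice of [tau] and has the
    multipliers of [thetaP tau] under both periods, so the quotient is entire and elliptic. *)
Lemma thetaP_inversion tau : upper_half_plane tau -> exists kappa : C,
  forall z, thetaP (- tau^-1) (z / tau) = kappa * ce (z ^+ 2 / (2 * tau)) * thetaP tau z.
Proof.
move=> ht; have ht' := upper_inv ht; have t0 := upper_neq0 ht; set tau' := - tau^-1 in ht' *; have tE : tau' = - tau^-1 by []; clearbody tau'.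
pose A z := thetaP tau' (z / tau) * ce (- (z ^+ 2 / (2 * tau))).
have hA z : hol A z.
  apply: holM; last exact: hol_gauss.
  apply: (@hol_comp _ (fun z => z / tau)); last exact: hol_thetaP.
  by apply: holM; [exact: hol_id | exact: hol_cst].
have A0 l : lattice tau l -> A (0 + l) = 0.
  move=> [a [b ->]]; rewrite add0r /A (thetaP_lattice0 ht') ?mul0r //.
  exists (- b), a; rewrite mulrNz tE; by field.
have [g hg gE] := thetaP_division ht hA A0.
have h2 := two_neq0.
have A1 z : A (z + 1) = - A z.
  rewrite /A.
  have -> : (z + 1) / tau = z / tau - tau' by rewrite tE; field.
  have := thetaPDtau (z / tau - tau') ht'; rewrite subrK => e.
  have {e} e : thetaP tau' (z / tau - tau') = - (ce (z / tau - tau' / 2) * thetaP tau' (z / tau)).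
    rewrite e mulrN opprK mulrA -ceD.
    have -> : z / tau - tau' / 2 + (- (tau' / 2) - (z / tau - tau')) = 0 by field.
    by rewrite ce0 mul1r.
  rewrite e mulNr mulrAC -ceD mulrC; congr (- (_ * ce _)).
  by rewrite tE; field.
have At z : A (z + tau) = - (ce (- (tau / 2) - z) * A z).
  rewrite /A.
  have -> : (z + tau) / tau = z / tau + 1 by field.
  rewrite thetaPD1 mulNr [ce _ * (_ * _)]mulrCA -ceD; congr (- (_ * ce _)).
  by field.
have g1 z : g (z + 1) = g z.
  apply/eqP; rewrite -subr_eq0; apply/eqP.
  apply: (@mul_thetaP_eq0 _ tau 0 (fun z => g (z + 1) - g z) ht).
    move=> w; apply: contB; last exact: hol_cont.
    apply: hol_cont; apply: (@hol_comp _ (fun z => z + 1)) => //.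
    by apply: holD; [exact: hol_id | exact: hol_cst].
  move=> w; have := A1 w; rewrite !gE !subr0 thetaPD1 mulrN => /oppr_inj.
  by rewrite mulrBl => ->; rewrite subrr.
have gt z : g (z + tau) = g z.
  apply/eqP; rewrite -subr_eq0; apply/eqP.
  apply: (@mul_thetaP_eq0 _ tau 0 (fun z => g (z + tau) - g z) ht).
    move=> w; apply: contB; last exact: hol_cont.
    apply: hol_cont; apply: (@hol_comp _ (fun z => z + tau)) => //.
    by apply: holD; [exact: hol_id | exact: hol_cst].
  move=> w; have := At w; rewrite !gE !subr0 thetaPDtau // mulrN => /oppr_inj.
  rewrite mulrCA => /(mulfI (ce_neq0 _)).
  by rewrite mulrBl => ->; rewrite subrr.
exists (g 0) => z; rewrite -(elliptic_const ht hg g1 gt z).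
rewrite mulrAC -[z in thetaP tau z]subr0 -gE /A -mulrA -ceD.
by rewrite addNr ce0 mulr1.
Qed.

(** Comparison of the linear terms at z = 0. Writing [thetaP t w = w * F t w], the value [F t 0] is
    [s 0] times the square of [qprod], and the constant [s 0] cancels. *)
Lemma thetaP_inversion_qprod tau kappa : upper_half_plane tau ->
  (forall z, thetaP (- tau^-1) (z / tau) = kappa * ce (z ^+ 2 / (2 * tau)) * thetaP tau z) ->
  qprod (ce (- tau^-1)) 1 ^+ 2 = kappa * tau * qprod (ce tau) 1 ^+ 2.
Proof.
move=> ht hk; have ht' := upper_inv ht; have t0 := upper_neq0 ht; set tau' := - tau^-1 in ht' hk *; have tE : tau' = - tau^-1 by []; clearbody tau'.
have [s [hs s0] sE] := front_factor R.
pose F t w := s w * qprod (ce t) (ce w) * qprod (ce t) (ce (- w)).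
have hF t w : upper_half_plane t -> hol (F t) w.
  move=> h; have q1 := upper_lt1 h.
  apply: holM; first apply: holM => //.
    by apply: (@hol_comp _ (@ce R)); [exact: hol_ce | exact: hol_qprod_w].
  apply: (@hol_comp _ (fun w => ce (- w))); last exact: hol_qprod_w.
  by under eq_fun do rewrite -mulN1r; exact: hol_ceM.
have FE t w : thetaP t w = w * F t w by rewrite /thetaP sE /F !mulrA.
have F0 t : F t 0 = s 0 * qprod (ce t) 1 ^+ 2 by rewrite /F oppr0 !ce0 -mulrA -expr2.
pose h z := F tau' (z / tau) / tau - kappa * ce (z ^+ 2 / (2 * tau)) * F tau z.
have : h 0 = 0.
  apply: (cont_eq0 (r := 1) ltr01).
    apply: hol_cont; apply: holB.
      apply: holM; last exact: hol_cst.
      apply: (@hol_comp _ (fun z => z / tau)); last exact: hF.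
      by apply: holM; [exact: hol_id | exact: hol_cst].
    apply: holM; last exact: hF.
    apply: holM; first exact: hol_cst.
    apply: (@hol_comp _ (fun w => w ^+ 2 / (2 * tau)) (@ce R)); last exact: hol_ce.
    by apply: holM; last exact: hol_cst; apply: holX; exact: hol_id.
  move=> w /andP[w0 _]; rewrite subr0 cabs_gt0 in w0; apply: (mulfI w0).
  have := hk w; rewrite !FE /h => e.
  have -> : w * (F tau' (w / tau) / tau - kappa * ce (w ^+ 2 / (2 * tau)) * F tau w) =
    w / tau * F tau' (w / tau) - kappa * ce (w ^+ 2 / (2 * tau)) * (w * F tau w) by ring.
  by rewrite e subrr mulr0.
rewrite /h mul0r !F0 expr0n /= mul0r ce0 mulr1 => /eqP; rewrite subr_eq0 => /eqP e.
apply: (mulfI s0); move/(congr1 (fun u => u * tau)): e; rewrite divfK // => ->; ring.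
Qed.

(** At the half periods the three infinite products are those of [qprod_euler], whose product is 1.
    This makes the product of the theta values elementary and the constant of the inversion formula
    computable. *)
Lemma thetaP_half_product tau : upper_half_plane tau ->
  thetaP tau (1 / 2) * thetaP tau (tau / 2) * thetaP tau ((1 + tau) / 2) = 2 * ce (- (tau / 2)).
Proof.
move=> ht; have q1 := upper_lt1 ht; set q := ce tau in q1; pose p := ce (tau / 2).
have h2 := two_neq0.
have qp : q = p ^+ 2 by rewrite /p ceX; congr ce; field.
have p0 : p != 0 := ce_neq0 _; have q0 : q != 0 := ce_neq0 _.
(* All exponentials become monomials in [p], [r] and ['i], which fixes the branches of the square
   and fourth roots of q consistently. *)
pose r := ce (- (tau / 4)).
have r2 : r ^+ 2 * p = 1.
  by rewrite /r /p ceX -ceD -[RHS]ce0; congr ce; field.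
have rr : r * ce (tau / 4) = 1 by rewrite /r -ceD addNr ce0.
have hh : ce (1 / 2 / 2) = 'i%C :> C by rewrite -ce_quarter; congr ce; field.
have hhN : ce (- (1 / 2 / 2)) = - 'i%C :> C.
  rewrite ceN hh; apply/eqP; rewrite -(inj_eq (mulfI (_ : 'i%C != 0))); last first.
    by apply/eqP => /eqP; rewrite eq_complex /= oner_eq0 andbF.
  rewrite divff; last by apply/eqP => /eqP; rewrite eq_complex /= oner_eq0 andbF.
  by rewrite mulrN -expr2 sqr_i opprK.
have T1 : thetaP tau (1 / 2) = 2 * 'i%C * qprod q (- 1) ^+ 2.
  rewrite /thetaP -/q hh hhN.
  have -> : ce (1 / 2 : C) = -1 by exact: ce_half.
  have -> : ce (- (1 / 2) : C) = -1 by rewrite ceN ce_half invrN invr1.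
  by ring.
have qs w : qprod q (w / p) = (1 - p * w) * qprod q (p * w).
  rewrite qprod_shift // qp.
  have -> : p ^+ 2 * (w / p) = p * w by field.
  by [].
have rp : ce (tau / 4) = r * p.
  by rewrite /r /p -ceD; congr ce; field.
have T2 : thetaP tau (tau / 2) = - r * qprod q p^-1 ^+ 2.
  rewrite /thetaP -/q -/p ceN -/p.
  have -> : tau / 2 / 2 = tau / 4 by field.
  rewrite rp -/r.
  have := qs 1; rewrite div1r mulr1 => ->.
  by ring.
have T3 : thetaP tau ((1 + tau) / 2) = 'i%C * r * qprod q (- p^-1) ^+ 2.
  rewrite /thetaP -/q.
  have -> : ce ((1 + tau) / 2) = - p by rewrite mulrDl ceD ce_half mulN1r.
  have -> : ce (- ((1 + tau) / 2)) = - p^-1 by rewrite ceN mulrDl ceD ce_half mulN1r invrN.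
  have -> : ce ((1 + tau) / 2 / 2) = 'i%C * (r * p).
    by rewrite -hh -rp -ceD; congr ce; field.
  have -> : ce (- ((1 + tau) / 2 / 2)) = - 'i%C * r.
    by rewrite -hhN /r -ceD; congr ce; field.
  have := qs (- 1); rewrite mulrN1 mulNr div1r => ->.
  by ring.
rewrite T1 T2 T3.
have -> : ce (- (tau / 2)) = r ^+ 2 by rewrite /r ceX; congr ce; field.
have e := qprod_euler q1 q0 qp.
have -> : 2 * 'i%C * qprod q (-1) ^+ 2 * (- r * qprod q p^-1 ^+ 2) * ('i%C * r * qprod q (- p^-1) ^+ 2) =
  - (2 * 'i%C ^+ 2 * r ^+ 2 * (qprod q (-1) * qprod q p^-1 * qprod q (- p^-1)) ^+ 2) by ring.
by rewrite e sqr_i; ring.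
Qed.

Lemma DeltaE tau : upper_half_plane tau -> Delta tau = ce tau * qprod (ce tau) 1 ^+ 24.
Proof.
move=> /upper_lt1 q1; rewrite /Delta; apply: clim_lim.
apply: clim_ext (climMl (ce tau) (climX 24 (qprod_clim 1 q1))) _ => M.
rewrite /qprod_part -prodrXl; congr (_ * _); apply: eq_bigr => m _; by rewrite mulr1.
Qed.

(** Inversion permutes the half periods up to sign and lattice vectors, so the three values together
    determine kappa^3. As Delta contains the twelfth power of the square in
    [thetaP_inversion_qprod], kappa^12 is the quantity to compute. *)
Lemma Delta_inversion tau : upper_half_plane tau -> Delta (- tau^-1) = tau ^+ 12 * Delta tau.
Proof.
move=> ht; have ht' := upper_inv ht; have t0 := upper_neq0 ht.
have [kappa hk] := thetaP_inversion ht; have e := thetaP_inversion_qprod ht hk.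
have p1 := thetaP_half_product ht; have p2 := thetaP_half_product ht'.
have h2 := two_neq0.
set tau' := - tau^-1 in ht' hk e p2 *; have tE : tau' = - tau^-1 by []; clearbody tau'.
have k1 := hk (1 / 2); have k2 := hk (tau / 2); have k3 := hk ((1 + tau) / 2).
have e1 : thetaP tau' (1 / 2 / tau) = - thetaP tau' (tau' / 2).
  by rewrite -thetaPN; congr thetaP; rewrite tE; field.
have e2 : thetaP tau' (tau / 2 / tau) = thetaP tau' (1 / 2) by congr thetaP; field.
have e3 : thetaP tau' ((1 + tau) / 2 / tau) = thetaP tau' ((1 + tau') / 2).
  have -> : (1 + tau') / 2 = - ((1 - tau') / 2) + 1 by field.
  by rewrite thetaPD1 thetaPN opprK; congr thetaP; rewrite tE; field.
rewrite e1 in k1; rewrite e2 in k2; rewrite e3 in k3.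
have prod : - (2 * ce (- (tau' / 2))) = kappa ^+ 3 *
    ce ((1 / 2) ^+ 2 / (2 * tau)) * ce ((tau / 2) ^+ 2 / (2 * tau)) * ce (((1 + tau) / 2) ^+ 2 / (2 * tau))
    * (2 * ce (- (tau / 2))).
  rewrite -p1 -p2 k2 k3.
  rewrite -[thetaP tau' (tau' / 2)]opprK k1; ring.
(* The formula for kappa^3 carries a sign, which the fourth power removes. *)
have k12 : kappa ^+ 12 = ce (tau^-1 + tau).
  have prod' : kappa ^+ 3 * ce (tau^-1 / 4 + tau / 4 + 4^-1 - tau / 2) = - ce (tau^-1 / 2).
    apply: (mulfI h2); rewrite mulrN.
    have -> : ce (tau^-1 / 2) = ce (- (tau' / 2)) by rewrite tE; congr ce; field.
    rewrite prod.
    have -> : tau^-1 / 4 + tau / 4 + 4^-1 - tau / 2 = (1 / 2) ^+ 2 / (2 * tau) + (tau / 2) ^+ 2 / (2 * tau)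
      + ((1 + tau) / 2) ^+ 2 / (2 * tau) + - (tau / 2) by field.
    by rewrite !ceD; ring.
  have := congr1 (fun u => u ^+ 4) prod'.
  rewrite exprMn -(exprM kappa) [(- _) ^+ 4]exprNn !ceX -signr_odd expr0 mul1r => e4.
  apply: (mulIf (ce_neq0 (4%:R * (tau^-1 / 4 + tau / 4 + 4^-1 - tau / 2)))).
  rewrite e4 -ceD -[LHS]mulr1 -[X in _ * X](ce1 R) -ceD; congr ce; by field.
rewrite !DeltaE //; move: (qprod (ce tau') 1) (qprod (ce tau) 1) e => Q' Q e.
have E24 (x : C) : x ^+ 24 = (x ^+ 2) ^+ 12 by rewrite -[24%N]/(2 * 12)%N exprM.
apply: etrans (congr1 (fun u => ce tau' * u) (E24 _)) _.
apply: etrans _ (congr1 (fun u => tau ^+ 12 * (ce tau * u)) (esym (E24 _))).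
have -> : (Q' ^+ 2) ^+ 12 = kappa ^+ 12 * tau ^+ 12 * (Q ^+ 2) ^+ 12.
  by rewrite e !exprMn.
rewrite k12; move: (tau ^+ 12) ((_ ^+ 2) ^+ 12) => X Y.
have -> : ce tau' * (ce (tau^-1 + tau) * X * Y) = X * ((ce tau' * ce (tau^-1 + tau)) * Y) by ring.
by rewrite -ceD; congr (_ * (ce _ * _)); rewrite tE; ring.
Qed.

End ModularTransformation.

#[local] Opaque ce qprod.

(** * The theta series and its proportionality to the theta product *)

Section ThetaSeries.
Variable R : realType.
Local Notation C := R[i].
Implicit Types (tau z w x : C) (f g : C -> C).

Lemma geometric_series_ratio (u : nat -> C) (K s : R) : 0 <= s < 1 ->
  (forall i, cabs (u i) <= K * s ^+ i) ->
  exists2 l, clim (series u) l & forall n, cabs (l - series u n) <= K / (1 - s) * s ^+ n.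
Proof.
move=> hs hu; have K0 : 0 <= K.
  by have := le_trans (cabs_ge0 _) (hu 0%N); rewrite expr0 mulr1.
have s0 n : 0 <= s ^+ n by rewrite exprn_ge0 //; case/andP: hs.
have K1 : 0 <= K / (1 - s) by rewrite divr_ge0 //; lra.
have tail n k : cabs (series u (n + k)%N - series u n) <= K / (1 - s) * (s ^+ n - s ^+ (n + k)).
  elim: k => [|k IH]; first by rewrite addn0 !subrr cabs0 mulr0.
  rewrite addnS seriesSr.
  have -> : series u (n + k)%N + u (n + k)%N - series u n = (series u (n + k)%N - series u n) + u (n + k)%N by ring.
  apply: (le_trans (cabsD _ _)).
  have -> : K / (1 - s) * (s ^+ n - s ^+ (n + k).+1) = K / (1 - s) * (s ^+ n - s ^+ (n + k)) + K * s ^+ (n + k).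
    by rewrite exprS; field; rewrite subr_eq0 eq_sym lt_eqF //; case/andP: hs.
  by apply: lerD.
have [l hl] : exists l, clim (series u) l.
  apply: ccomplete => e e0; have [N hN] := geometric_small hs K1 e0.
  exists N.+1 => n Nn; rewrite -(subnKC Nn); apply: (le_lt_trans (tail _ _)).
  apply: le_lt_trans (hN N (leqnn N)); apply: ler_wpM2l => //.
  by have := s0 (N.+1 + (n - N.+1))%N; lra.
exists l => // n.
apply: (clim_le (climB hl (clim_cst (series u n)))); exists n => m nm.
rewrite -(subnKC nm); apply: (le_trans (tail _ _)); apply: ler_wpM2l => //.
by have := s0 (n + (m - n))%N; lra.
Qed.

Lemma geometric_series (u : nat -> C) (K : R) : (forall i, cabs (u i) <= K * pow2 i) ->
  exists2 l, clim (series u) l & forall n, cabs (l - series u n) <= 2 * K * pow2 n.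
Proof.
move=> hu; have h2 : 0 <= (2^-1 : R) < 1 by apply/andP; split; lra.
have [l hl hln] := geometric_series_ratio h2 hu; exists l => // n.
have -> : 2 * K = K / (1 - 2^-1) by field.
exact: hln.
Qed.

Lemma gauss_bound (a b : R) : 0 < a -> exists2 K : R, 0 <= K &
  forall i : nat, expR (- (a * (2 * i%:R + 1) ^+ 2) + b * (2 * i%:R + 1)) <= K * pow2 i.
Proof.
(* Completing the square for b + 1 in place of b leaves the spare factor exp (-(2 i + 1)), which is
   below 2^(-i). *)
move=> a0; exists (expR ((b + 1) ^+ 2 / (4 * a))); first exact: expR_ge0.
move=> i; have -> : pow2 i = (2^-1 : R) ^+ i by [].
have e1 : expR (- 1) <= 2^-1 :> R.
  rewrite expRN lef_pV2 ?posrE ?expR_gt0 //; apply: le_trans (expR_ge1Dx 1); lra.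
have e2 : expR (- i%:R) <= (2^-1 : R) ^+ i.
  rewrite -[X in expR X]mulr1 mulNr -mulrN expRM_natl.
  by apply: lerXn2r e1; rewrite nnegrE ?expR_ge0.
apply: le_trans (ler_wpM2l (expR_ge0 _) e2); rewrite -expRD ler_expR.
have i0 : 0 <= (i%:R : R) by [].
move: (i%:R : R) i0 => x x0.
have : 0 <= (a * (2 * x + 1) - (b + 1) / 2) ^+ 2 / a by rewrite divr_ge0 ?sqr_ge0 // ltW.
have -> : (a * (2 * x + 1) - (b + 1) / 2) ^+ 2 / a = a * (2 * x + 1) ^+ 2 - (b + 1) * (2 * x + 1) + (b + 1) ^+ 2 / (4 * a).
  by field; rewrite gt_eqF.
lra.
Qed.

Definition theta_term tau z (i : int) : C :=
  (-1) ^ i * ce (((2 * i + 1) ^ 2)%:~R / 8 * tau) * ce ((2 * i + 1)%:~R / 2 * z).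

Lemma theta11E tau z : theta11 tau z = bilateral_sum (theta_term tau z). Proof. by []. Qed.

Lemma cabs_ce_real (r : R) z : cabs (ce (r%:C * z)) = expR (- (2 * pi * (r * complex.Im z))).
Proof. by case: z => a b; rewrite cabs_ce /= mul0r addr0. Qed.

Lemma cabs_sign (i : int) : cabs ((-1) ^ i : C) = 1.
Proof.
case: i => k; first by rewrite -exprnP cabsX cabsN cabs1 expr1n.
by rewrite -[_ ^ _]/(((-1) ^+ k.+1)^-1) cabsV cabsX cabsN cabs1 expr1n invr1.
Qed.

Lemma intC (m : int) : (m%:~R : C) = (m%:~R : R)%:C. Proof. by rewrite rmorph_int. Qed.

Lemma realC_div (a : R) (n : nat) : (a / n%:R)%:C = a%:C / n%:R.
Proof. by rewrite rmorphM fmorphV rmorph_nat. Qed.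

Lemma theta_term_abs tau z (i : int) : cabs (theta_term tau z i) =
  expR (- (pi / 4 * complex.Im tau * (2 * i%:~R + 1) ^+ 2) - pi * complex.Im z * (2 * i%:~R + 1)).
Proof.
rewrite /theta_term cabsM cabsM cabs_sign mul1r !intC.
have -> : ((((2 * i + 1) ^ 2)%:~R : R)%:C / 8 : C) = (((2 * i%:~R + 1) ^+ 2 / 8 : R))%:C.
  by rewrite (realC_div _ 8) -exprnP rmorphXn /= intrD intrM.
have -> : ((((2 * i + 1)%:~R : R))%:C / 2 : C) = (((2 * i%:~R + 1) / 2 : R))%:C.
  by rewrite intrD intrM realC2.
by rewrite !cabs_ce_real -expRD; congr expR; move: (pi : R) => p; field.
Qed.

Lemma theta_term_bound tau (Y : R) : upper_half_plane tau -> exists2 K : R, 0 <= K &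
  forall z, `|complex.Im z| <= Y -> forall i : nat,
    cabs (theta_term tau z (Posz i)) <= K * pow2 i /\ cabs (theta_term tau z (Negz i)) <= K * pow2 i.
Proof.
rewrite /upper_half_plane => ht; have p0 := @pi_gt0 R.
have [K K0 hK] := gauss_bound (pi * Y) (ltac:(by rewrite mulr_gt0 // divr_gt0) : 0 < pi / 4 * complex.Im tau).
exists K => // z hz i; rewrite !theta_term_abs.
have i0 : 0 <= (i%:R : R) by [].
have hyp (s : R) : s <= Y -> pi * s * (2 * i%:R + 1) <= pi * Y * (2 * i%:R + 1).
  by move=> sY; apply: ler_wpM2r; [lra | rewrite ler_pM2l].
have := hyp (complex.Im z) ltac:(by apply: le_trans hz; apply: ler_norm).
have := hyp (- complex.Im z) ltac:(by apply: le_trans hz; rewrite -normrN; apply: ler_norm).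
move=> h1 h2; split; apply: le_trans (hK i); rewrite ler_expR.
  have -> : ((Posz i)%:~R : R) = i%:R by [].
  by rewrite lerD2l; lra.
have -> : ((Negz i)%:~R : R) = - (i%:R + 1) by rewrite NegzE mulrNz natr1.
have -> : 2 * - (i%:R + 1) + 1 = - (2 * i%:R + 1) :> R by ring.
by rewrite sqrrN lerD2l; lra.
Qed.

Lemma theta_clim tau z : upper_half_plane tau -> exists p m : C,
  [/\ clim (series (fun i => theta_term tau z (Posz i))) p,
      clim (series (fun i => theta_term tau z (Negz i))) m & theta11 tau z = p + m].
Proof.
move=> ht; have [K K0 hK] := theta_term_bound `|complex.Im z| ht.
have [p hp _] := geometric_series (fun i => (hK z (lexx _) i).1).
have [m hm _] := geometric_series (fun i => (hK z (lexx _) i).2).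
by exists p, m; split => //; rewrite theta11E /bilateral_sum (clim_lim hp) (clim_lim hm).
Qed.

Lemma theta_approx tau (Y : R) : upper_half_plane tau -> exists2 K : R, 0 <= K &
  forall z, `|complex.Im z| <= Y -> forall n, cabs (series (fun i => theta_term tau z (Posz i)) n +
    series (fun i => theta_term tau z (Negz i)) n - theta11 tau z) <= K * pow2 n.
Proof.
move=> ht; have [K K0 hK] := theta_term_bound Y ht; exists (2 * K + 2 * K); first lra.
move=> z hz n.
have [p hp hpn] := geometric_series (fun i => (hK z hz i).1).
have [m hm hmn] := geometric_series (fun i => (hK z hz i).2).
rewrite theta11E /bilateral_sum (clim_lim hp) (clim_lim hm).
move: (hpn n) (hmn n); rewrite (cabsB p) (cabsB m).
set a := series _ n; set b := series _ n => h1 h2.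
have -> : a + b - (p + m) = (a - p) + (b - m) by ring.
by have := cabsD (a - p) (b - m); lra.
Qed.

Lemma hol_theta_term tau i z : hol (fun z => theta_term tau z i) z.
Proof. by apply: holM; [exact: hol_cst | exact: hol_ceM]. Qed.

Lemma hol_theta11 tau z : upper_half_plane tau -> hol (theta11 tau) z.
Proof.
move=> ht; have [K K0 hK] := theta_approx (`|complex.Im z| + 1) ht.
apply: (@hol_limit _ (fun n z => series (fun i => theta_term tau z (Posz i)) n +
    series (fun i => theta_term tau z (Negz i)) n) _ _ 1 ltr01).
  by move=> n w _; apply: holD; apply: hol_sum => i; exact: hol_theta_term.
move=> e e0; have [N hN] := pow2_small (ltac:(rewrite divr_gt0 //; lra) : 0 < e / (K + 1)).
exists N => n w Nn hw; have Yw : `|complex.Im w| <= `|complex.Im z| + 1.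
  have := cabs_Im (w - z); rewrite raddfB /= => k.
  by have := ler_normD (complex.Im w - complex.Im z) (complex.Im z); rewrite subrK; lra.
apply: (le_trans (hK w Yw n)); move: hN; rewrite ltr_pdivlMr; last lra.
have := pow2_le R Nn; have := pow2_gt0 R n; nra.
Qed.

Lemma theta_termD1 tau z (i : int) : theta_term tau (z + 1) i = - theta_term tau z i.
Proof.
rewrite /theta_term mulrDr mulr1 ceD.
have -> : (2 * i + 1)%:~R / 2 = 1 / 2 + i%:~R :> C.
  by rewrite intrD intrM; field.
by rewrite ceDint ce_half !mulrN mulr1.
Qed.

Lemma theta_termDtau tau z (i : int) :
  theta_term tau (z + tau) i = - (ce (- (tau / 2) - z) * theta_term tau z (i + 1)).
Proof.
rewrite /theta_term; have -> : (-1) ^ (i + 1) = - (-1) ^ i :> C.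
  by rewrite exprzDr ?unitrN1 // expr1z mulrN1.
have K (s a b c d e : C) : a * b = c * (d * e) -> s * a * b = - (c * (- s * d * e)).
  by move=> h; rewrite -mulrA h; ring.
apply: K; rewrite -!ceD; congr ce.
by rewrite -!exprnP !rmorphXn /= !(intrD, intrM); field.
Qed.

(** [Negz i] is -(i + 1), and 2 i + 1 becomes -(2 i + 1) there, so the symmetry exchanges the two
    halves of the bilateral sum term by term. *)
Lemma theta_termN tau z (i : nat) : theta_term tau (- z) (Negz i) = - theta_term tau z (Posz i).
Proof.
rewrite /theta_term.
have -> : 2 * Negz i + 1 = - (2 * Posz i + 1) :> int by rewrite NegzE; lia.
have -> : (-1) ^ Negz i = - (-1) ^ Posz i :> C.
  by rewrite NegzE -exprnN -exprnP -exprVn invrN invr1 exprS mulN1r.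
have -> (x : int) : (- x) ^ 2 = x ^ 2 by rewrite -!exprnP sqrrN.
by rewrite mulrNz !mulNr mulrN opprK.
Qed.

Lemma theta_termN' tau z (i : nat) : theta_term tau (- z) (Posz i) = - theta_term tau z (Negz i).
Proof. by rewrite -[z in RHS]opprK theta_termN opprK. Qed.

Lemma climN_series (u v : nat -> C) l : clim (series u) l -> (forall i, v i = - u i) -> clim (series v) (- l).
Proof.
move=> /climN h uv; apply: clim_ext h _ => n; rewrite /series /= -sumrN.
by apply: eq_bigr => i _; rewrite uv.
Qed.

Lemma climMl_series (u v : nat -> C) l a : clim (series u) l -> (forall i, v i = a * u i) -> clim (series v) (a * l).
Proof.
move=> /(climMl a) h uv; apply: clim_ext h _ => n; rewrite /series /= mulr_sumr.
by apply: eq_bigr => i _; rewrite uv.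
Qed.

Lemma theta11N tau z : upper_half_plane tau -> theta11 tau (- z) = - theta11 tau z.
Proof.
move=> ht; have [p [m [hp hm ->]]] := theta_clim z ht.
have [p' [m' [hp' hm' ->]]] := theta_clim (- z) ht.
rewrite (clim_unique hp' (climN_series hm (theta_termN' tau z))).
by rewrite (clim_unique hm' (climN_series hp (theta_termN tau z))) opprD addrC.
Qed.

Lemma theta11_0 tau : upper_half_plane tau -> theta11 tau 0 = 0.
Proof.
move=> /(theta11N 0); rewrite oppr0 => /eqP; rewrite -addr_eq0 -mulr2n -mulr_natr.
by rewrite mulf_eq0 pnatr_eq0 orbF => /eqP.
Qed.

Lemma theta11D1 tau z : upper_half_plane tau -> theta11 tau (z + 1) = - theta11 tau z.
Proof.
move=> ht; have [p [m [hp hm ->]]] := theta_clim z ht.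
have [p' [m' [hp' hm' ->]]] := theta_clim (z + 1) ht.
rewrite (clim_unique hp' (climN_series hp (fun i => theta_termD1 tau z (Posz i)))).
by rewrite (clim_unique hm' (climN_series hm (fun i => theta_termD1 tau z (Negz i)))) opprD.
Qed.

Lemma theta11Dtau tau z : upper_half_plane tau ->
  theta11 tau (z + tau) = - (ce (- (tau / 2) - z) * theta11 tau z).
Proof.
move=> ht; have [p [m [hp hm ->]]] := theta_clim z ht.
have [p' [m' [hp' hm' ->]]] := theta_clim (z + tau) ht.
set a := ce _; pose u i := theta_term tau z i.
(* Shifting the index moves the term of index 0 from the non-negative to the negative half of the
   sum. *)
have hp2 : clim (series (fun i => u (Posz i + 1))) (p - u 0).
  apply: clim_ext (climB (clim_shift 1 hp) (clim_cst (u 0))) _ => n.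
  rewrite addn1 /series /= big_nat_recl // addrC addKr.
  by apply: eq_bigr => i _; rewrite /u; congr theta_term; lia.
have hm2 : clim (series (fun i => u (Negz i + 1))) (m + u 0).
  apply: (@clim_unshift _ _ _ 1); apply: clim_ext (climD hm (clim_cst (u 0))) _ => n.
  rewrite addn1 /series /= big_nat_recl // addrC; congr (_ + _).
  by apply: eq_bigr => i _; rewrite /u; congr theta_term; rewrite !NegzE; lia.
have := climMl_series (a := - a) hp2 (v := fun i => theta_term tau (z + tau) (Posz i)).
move=> /(_ ltac:(by move=> i; rewrite theta_termDtau mulNr)) /(clim_unique hp') ->.
have := climMl_series (a := - a) hm2 (v := fun i => theta_term tau (z + tau) (Negz i)).
move=> /(_ ltac:(by move=> i; rewrite theta_termDtau mulNr)) /(clim_unique hm') ->.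
by ring.
Qed.

Lemma lattice_zero tau f : (forall z, f z = 0 <-> f (z + 1) = 0) -> (forall z, f z = 0 <-> f (z + tau) = 0) ->
  forall l, lattice tau l -> forall z, f z = 0 <-> f (z + l) = 0.
Proof.
move=> h1 ht.
pose V l := forall z, f z = 0 <-> f (z + l) = 0.
have VD l m : V l -> V m -> V (l + m).
  by move=> hl hm z; rewrite addrA; exact: iff_trans (hl z) (hm (z + l)).
have VN l : V l -> V (- l).
  by move=> hl z; have h := hl (z - l); rewrite subrK in h; exact: iff_sym h.
have VZ l (a : int) : V l -> V (a%:~R * l).
  move=> hl; have nat (k : nat) : V (k%:R * l).
    elim: k => [|k IH]; first by move=> z; rewrite mul0r addr0.
    by rewrite -natr1 mulrDl mul1r; apply: VD.
  case: a => k; first exact: nat.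
  by rewrite NegzE mulrNz mulNr; apply: VN; exact: nat.
move=> l [a [b ->]]; apply: VD; first exact: VZ.
by have := VZ 1 b h1; rewrite mulr1.
Qed.

(** Uniqueness of Laurent coefficients in w = e(z). If theta vanished identically, the part with
    non-negative powers, an entire function of w, would be minus the part with negative powers,
    which decays at infinity. It would then be 0, although its constant term is an exponential. *)
Lemma theta11_neq0 tau : upper_half_plane tau -> exists z, theta11 tau z != 0.
Proof.
move=> ht; apply: contrapT => none.
have th0 z : theta11 tau z = 0 by apply/eqP/negPn/negP => h; apply: none; exists z.
have p0 := @pi_gt0 R.
pose c (i : int) : C := (-1) ^ i * ce (((2 * i + 1) ^ 2)%:~R / 8 * tau).
have cabs_c (i : int) : cabs (c i) = cabs (theta_term tau 0 i).
  by rewrite /theta_term mulr0 ce0 mulr1.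
(* The non-negative half of the theta series with the common factor e(z / 2) removed, so that the
   exponents of w are integers. *)
pose F w := limn (series (fun i : nat => c (Posz i) * w ^+ i) : nat -> C^o).
have bound (Y : R) : exists2 K : R, 0 <= K & forall w, cabs w <= expR Y -> forall i : nat,
    cabs (c (Posz i) * w ^+ i) <= K * pow2 i.
  have [K K0 hK] := theta_term_bound (`|Y| / pi) ht; exists K => // w hw i.
  pose z := 0 +i* (- (`|Y| / pi)) : C.
  have hz : `|complex.Im z| <= `|Y| / pi.
    by rewrite /= normrN ger0_norm // divr_ge0 // ltW.
  apply: le_trans (hK z hz i).1; rewrite cabsM cabs_c !theta_term_abs /= mulr0 mul0r subr0 cabsX.
  rewrite expRD; apply: ler_wpM2l; first exact: expR_ge0.
  have -> : - (pi * - (`|Y| / pi) * (2 * i%:R + 1)) = `|Y| * (2 * i%:R + 1).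
    by move: (pi : R) p0 => p p0; field; rewrite gt_eqF.
  apply: (@le_trans _ _ (expR `|Y| ^+ i)).
    apply: lerXn2r; rewrite ?nnegrE ?cabs_ge0 ?expR_ge0 //.
    by apply: (le_trans hw); rewrite ler_expR ler_norm.
  rewrite -expRM_natr ler_expR; apply: ler_wpM2l => //.
  by have : 0 <= (i%:R : R) by []; lra.
have hF w : hol F w.
  have [Y hY] : exists Y : R, cabs w + 1 <= expR Y.
    have [Y hY] := expR_total (ltac:(have := cabs_ge0 w; lra) : 0 < cabs w + 1).
    by exists Y; rewrite hY.
  have [K K0 hK] := bound Y.
  apply: (@hol_limit _ (fun n w => series (fun i : nat => c (Posz i) * w ^+ i) n) _ _ 1 ltr01).
    move=> n v _; apply: hol_sum => i; apply: holM; first exact: hol_cst.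
    by apply: holX; exact: hol_id.
  move=> e e0; have [N hN] := pow2_small (ltac:(rewrite divr_gt0 //; lra) : 0 < e / (2 * K + 1)).
  exists N => n v Nn hv; have Yv : cabs v <= expR Y.
    by have := cabs_subl v w; lra.
  have [l hl hln] := geometric_series (hK v Yv).
  rewrite /F (clim_lim hl) cabsB; apply: (le_trans (hln n)); move: hN; rewrite ltr_pdivlMr; last lra.
  have := pow2_le R Nn; have := pow2_gt0 R n; nra.
have F0 : F 0 = c 0.
  apply: clim_lim; apply: (@clim_unshift _ _ _ 1); apply: clim_ext (clim_cst (c 0)) _ => n.
  rewrite addn1 /series /= big_nat_recl // expr0 mulr1 big1 ?addr0 // => i _.
  by rewrite expr0n /= mulr0.
have [K K0 hK] := theta_term_bound 0 ht.
have decay w : 1 <= cabs w -> cabs (F w) <= 2 * K / cabs w.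
  move=> w1; have w0 : w != 0 by rewrite -cabs_gt0; lra.
  have [z hz] := ce_surj w0.
  have [p [m [hp hm e]]] := theta_clim z ht.
  have hFp : F w = ce (- (z / 2)) * p.
    apply: clim_lim; apply: climMl_series hp _ => i; rewrite /c /theta_term.
    have K0' (x y u v : C) : x = u * y -> v * x = u * (v * y) by move=> ->; ring.
    rewrite -hz ceX; apply: K0'; rewrite -ceD; congr ce.
    by rewrite intrD intrM; have -> : (Posz i)%:~R = i%:R :> C by []; field.
  have pm : p = - m by apply/eqP; rewrite -addr_eq0 -e th0.
  have [l hl hln] : exists2 l, clim (series (fun i : nat => ce (- (z / 2)) * theta_term tau z (Negz i))) l
     & forall n, cabs (l - series (fun i : nat => ce (- (z / 2)) * theta_term tau z (Negz i)) n) <= 2 * (K / cabs w) * pow2 n.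
    apply: geometric_series => i.
    have -> : ce (- (z / 2)) * theta_term tau z (Negz i) = c (Negz i) * (w^-1) ^+ i.+1.
      rewrite -hz -ceN ceX /theta_term mulrCA; congr (_ * _); rewrite -ceD; congr ce.
      rewrite NegzE intrD intrM mulrNz.
      have -> : (Posz i.+1)%:~R = i.+1%:R :> C by [].
      by field.
    rewrite cabsM cabs_c cabsX cabsV.
    have := (hK 0 ltac:(by rewrite normr0) i).2 => k1.
    have k2 : (cabs w)^-1 ^+ i.+1 <= (cabs w)^-1.
      rewrite exprS -[X in _ <= X]mulr1; apply: ler_wpM2l; first by rewrite invr_ge0; lra.
      by rewrite exprn_ile1 ?invr_ge0 ?invf_le1 //; lra.
    have -> : K / cabs w * pow2 i = (K * pow2 i) * (cabs w)^-1 by ring.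
    by apply: ler_pM => //; rewrite ?cabs_ge0 ?exprn_ge0 ?invr_ge0 //; lra.
  have -> : F w = - l.
    rewrite hFp pm mulrN; congr (- _); apply: clim_unique hl; exact: climMl_series hm _.
  rewrite cabsN; have := hln 0%N; rewrite /series /= big_geq // subr0 /pow2 expr0 mulr1; lra.
have c0 : c 0 = 0.
  rewrite -F0; apply: cabs_small => e e0; pose r := 2 * K / e + 1.
  have r1 : 1 <= r by rewrite /r lerDr divr_ge0 ?mulr_ge0 // ltW.
  have := @cauchy_bound0 _ F (r + 1) r (2 * K / r) 0 (fun z _ => hF z).
  rewrite cabs0 => /(_ ltac:(lra) ltac:(lra)) h.
  have {h} h := h ltac:(by move=> z hz; have := decay z; rewrite hz; apply).
  apply: (le_trans h); rewrite subr0 -mulrA divff ?gt_eqF //; last lra.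
  rewrite mulr1 ler_pdivrMr; last lra.
  rewrite /r mulrDr mulr1 [e * _]mulrC divfK ?gt_eqF //; lra.
by move/eqP: c0; rewrite /c expr0z mul1r (negbTE (ce_neq0 _)).
Qed.

(** Both functions have the same multipliers and [theta11] vanishes on the lattice, so the quotient
    is elliptic; [theta11_neq0] excludes the constant 0. *)
Lemma theta11_thetaP tau : upper_half_plane tau ->
  exists2 c : C, c != 0 & forall z, theta11 tau z = c * thetaP tau z.
Proof.
move=> ht.
have zero1 z : theta11 tau z = 0 <-> theta11 tau (z + 1) = 0.
  by rewrite theta11D1 //; split=> [->|/eqP]; rewrite ?oppr0 // oppr_eq0 => /eqP.
have zerot z : theta11 tau z = 0 <-> theta11 tau (z + tau) = 0.
  rewrite theta11Dtau //; split=> [->|/eqP]; rewrite ?mulr0 ?oppr0 //.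
  by rewrite oppr_eq0 mulf_eq0 (negbTE (ce_neq0 _)) => /eqP.
have th0 l : lattice tau l -> theta11 tau (0 + l) = 0.
  by move=> hl; apply: (proj1 (lattice_zero zero1 zerot hl 0)); exact: theta11_0.
have [g hg gE] := thetaP_division ht (fun z => hol_theta11 z ht) th0.
have g1 z : g (z + 1) = g z.
  apply/eqP; rewrite -subr_eq0; apply/eqP.
  apply: (@mul_thetaP_eq0 _ tau 0 (fun z => g (z + 1) - g z) ht).
    move=> w; apply: contB; last exact: hol_cont.
    apply: hol_cont; apply: (@hol_comp _ (fun z => z + 1)) => //.
    by apply: holD; [exact: hol_id | exact: hol_cst].
  move=> w; have := theta11D1 w ht; rewrite !gE !subr0 thetaPD1 mulrN => /oppr_inj.
  by rewrite mulrBl => ->; rewrite subrr.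
have gt z : g (z + tau) = g z.
  apply/eqP; rewrite -subr_eq0; apply/eqP.
  apply: (@mul_thetaP_eq0 _ tau 0 (fun z => g (z + tau) - g z) ht).
    move=> w; apply: contB; last exact: hol_cont.
    apply: hol_cont; apply: (@hol_comp _ (fun z => z + tau)) => //.
    by apply: holD; [exact: hol_id | exact: hol_cst].
  move=> w; have := theta11Dtau w ht; rewrite !gE !subr0 thetaPDtau // mulrN => /oppr_inj.
  rewrite mulrCA => /(mulfI (ce_neq0 _)).
  by rewrite mulrBl => ->; rewrite subrr.
have E z : theta11 tau z = g 0 * thetaP tau z.
  by rewrite gE (elliptic_const ht hg g1 gt z) subr0.
exists (g 0) => //; have [z] := theta11_neq0 ht; apply: contraNneq => g0.
by rewrite E g0 mul0r.
Qed.

End ThetaSeries.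

(** * Points of exact order n *)

Section JordanTotient.
Local Open Scope nat_scope.

(** The elements of exact order n in (Z/n)^2; their number is Jordan's totient J_2(n). *)
Definition primitive_pairs (n : nat) : {set 'I_n * 'I_n} :=
  [set ab : 'I_n * 'I_n | coprime (gcdn ab.1 ab.2) n].

Lemma coprime_gcd_mod a b m : coprime (gcdn (a %% m) (b %% m)) m = coprime (gcdn a b) m.
Proof.
rewrite /coprime -!gcdnA; congr (_ == 1).
by rewrite (gcdn_modl b m) gcdnCA gcdn_modl gcdnCA.
Qed.

(** The Chinese remainder theorem in each coordinate; by [coprime_gcd_mod] primitivity depends on
    residues only. *)
Lemma primitive_pairsM m n : 0 < m -> 0 < n -> coprime m n ->
  #|primitive_pairs (m * n)| = #|primitive_pairs m| * #|primitive_pairs n|.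
Proof.
move=> m0 n0 co.
pose f (a : 'I_(m * n)) : 'I_m * 'I_n := (Ordinal (ltn_pmod a m0), Ordinal (ltn_pmod a n0)).
have f_inj : injective f.
  move=> a b [e1 e2]; apply/val_inj => /=.
  have : a = b %[mod m * n] by apply/eqP; rewrite chinese_remainder // e1 e2 !eqxx.
  by rewrite !modn_small.
pose F (ab : 'I_(m * n) * 'I_(m * n)) := (((f ab.1).1, (f ab.2).1), ((f ab.1).2, (f ab.2).2)).
have F_inj : injective F.
  move=> [a b] [c d] /= [e1 e2 e3 e4]; congr (_, _); apply: f_inj; rewrite /f; congr (_, _); exact: val_inj.
have F_bij : bijective F.
  by apply: inj_card_bij => //; rewrite !card_prod !card_ord; lia.
rewrite -cardsX -(card_imset _ F_inj); congr #|pred_of_set _|; apply/setP => x.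
have [G FG GF] := F_bij.
apply/imsetP/idP => [[[a b]]|].
  rewrite !inE /= coprimeMr => /andP[h1 h2] -> /=.
  by rewrite !coprime_gcd_mod h1 h2.
move=> hx; exists (G x); last by rewrite GF.
move: hx; rewrite -{1}(GF x); case: (G x) => a b; rewrite !inE /= !coprime_gcd_mod.
by rewrite coprimeMr.
Qed.

(** The excluded pairs have both entries divisible by p, which leaves p^(2l) - p^(2l-2). *)
Lemma card_primitive_pairs_prime_pow p l : prime p -> 0 < l ->
  #|primitive_pairs (p ^ l)| = (p.-1 * p ^ l.-1) * (p.+1 * p ^ l.-1).
Proof.
move=> pp l0; pose n := p ^ l; pose M : {set 'I_n} := [set a : 'I_n | p %| a].
have p1 := prime_gt1 pp; have n0 : 0 < n by rewrite expn_gt0 prime_gt0.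
have nE : n = p * p ^ l.-1 by rewrite -expnS prednK.
have cn a : coprime a n = ~~ (p %| a) by rewrite coprime_pexpr // coprime_sym prime_coprime.
have cM : #|M| = p ^ l.-1.
  have h : #|~: M| = totient n.
    rewrite totient_count_coprime big_mkord -sum1_card big_mkcond.
    by apply: eq_bigr => a _; rewrite !inE coprime_sym cn; case: (p %| a).
  have := cardsC M; rewrite h card_ord totient_pfactor //; move: #|M| => c; rewrite nE.
  by move: (p ^ l.-1) => q; rewrite -{2}(prednK (prime_gt0 pp)) mulSn => /addIn.
have -> : primitive_pairs (p ^ l) = ~: finset.setX M M.
  by apply/setP => -[a b]; rewrite !inE /= -/n cn dvdn_gcd.
have := cardsC (finset.setX M M); rewrite cardsX cM card_prod card_ord -/n.
move: #|~: finset.setX M M| => c; rewrite nE; move: (p ^ l.-1) => q.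
have := prime_gt0 pp; case: (p) => // p' _ /=; nia.
Qed.

Lemma card_primitive_pairs n : 0 < n -> #|primitive_pairs n| = totient n * psi n.
Proof.
move=> n0; rewrite totientE // /psi -big_split /=.
have main (s : seq nat) : uniq s -> all prime s -> (forall p, p \in s -> 0 < logn p n) ->
    #|primitive_pairs (\prod_(p <- s) p ^ logn p n)| =
    \prod_(p <- s) (p.-1 * p ^ (logn p n).-1 * (p.+1 * p ^ (logn p n).-1)) /\
    0 < \prod_(p <- s) p ^ logn p n.
  elim: s => [_ _ _|p s IH /= /andP[ps us] /andP[pp hs] hl].
    rewrite !big_nil; split => //.
    have -> : primitive_pairs 1 = [set: 'I_1 * 'I_1].
      by apply/setP => -[a b]; rewrite !inE coprimen1.
    by rewrite cardsT card_prod card_ord.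
  have [e pos] := IH us hs (fun q hq => hl q ltac:(by rewrite inE hq orbT)).
  have lp := hl p (mem_head _ _); rewrite !big_cons; split; last by rewrite muln_gt0 expn_gt0 prime_gt0.
  have pl0 : 0 < p ^ logn p n by rewrite expn_gt0 prime_gt0.
  rewrite primitive_pairsM //; first by rewrite e card_primitive_pairs_prime_pow.
  rewrite coprimeXl // prime_coprime // Euclid_dvd_prod // big_has; apply/negP => /hasP[q qs /= h].
  have qp := allP hs _ qs; move: h; rewrite Euclid_dvdX // => /andP[+ _].
  by rewrite dvdn_prime2 // => /eqP pq; rewrite pq qs in ps.
have nE : n = \prod_(p <- primes n) p ^ logn p n.
  by rewrite {1}(prod_prime_decomp n0) prime_decompE big_map.
have [] := main (primes n); rewrite ?primes_uniq //.
- by apply/allP => p; rewrite mem_primes => /and3P[].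
- by move=> p hp; rewrite logn_gt0.
by move=> <- _; apply: (congr1 (fun m => #|primitive_pairs m|)).
Qed.

End JordanTotient.

(** * Lattice coordinates of torsion points *)

Section TorsionPoints.
Variable R : realType.
Local Notation C := R[i].
Implicit Types (tau x y : C).

Lemma lattice_coords tau (a b c d : R) : upper_half_plane tau ->
  a%:C * tau + b%:C = c%:C * tau + d%:C -> a = c /\ b = d.
Proof.
case: tau => u v; rewrite /upper_half_plane /= => v0 /eqP; rewrite eq_complex /= => /andP[/eqP h1 /eqP h2].
have ac : a = c.
  by apply: (mulIf (lt0r_neq0 v0)); move: h2; rewrite !mul0r !addr0.
by split => //; move: h1; rewrite ac; lra.
Qed.

Lemma lattice_coords_int tau (a b c d : int) : upper_half_plane tau ->
  a%:~R * tau + b%:~R = c%:~R * tau + d%:~R -> a = c /\ b = d.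
Proof.
move=> ht; rewrite -!(rmorph_int (real_complex R)) => /(lattice_coords ht)[/eqP + /eqP].
by rewrite !eqr_int => /eqP -> /eqP ->.
Qed.

(** A common divisor d > 1 of a, b and n would already put x (n / d) into the lattice. *)
Lemma exact_order_coprime tau n x (a b : int) : (0 < n)%N -> exact_order tau n x ->
  x *+ n = a%:~R * tau + b%:~R -> gcdn (gcdn `|a|%N `|b|%N) n = 1%N.
Proof.
move=> n0 [_ hm] e; set d := gcdn _ n.
have d0 : (0 < d)%N by rewrite gcdn_gt0 n0 orbT.
have [//|/eqP d1] := eqVneq d 1%N.
have dn : (d %| n)%N by apply: dvdn_gcdr.
have da : (d %| `|a|)%N by apply: dvdn_trans (dvdn_gcdl _ _) _; apply: dvdn_gcdl.
have db : (d %| `|b|)%N by apply: dvdn_trans (dvdn_gcdl _ _) _; apply: dvdn_gcdr.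
have /dvdzP[a' ha] : (d %| a)%Z by rewrite dvdzE.
have /dvdzP[b' hb] : (d %| b)%Z by rewrite dvdzE.
exfalso; apply: (hm (n %/ d)%N).
  by rewrite divn_gt0 // dvdn_leq //= ltn_Pdiv //; lia.
exists a', b'; have dC : (d%:R : C) != 0 by rewrite pnatr_eq0 -lt0n.
apply: (mulfI dC); rewrite mulr_natl -mulrnA divnK // e ha hb !intrM.
by have -> : (d%:Z)%:~R = d%:R :> C by []; ring.
Qed.

Lemma exact_orderN tau n x : exact_order tau n x -> exact_order tau n (- x).
Proof.
have N y : lattice tau y -> lattice tau (- y).
  by move=> [a [b ->]]; exists (- a), (- b); rewrite !mulrNz; ring.
move=> [h1 h2]; split; first by rewrite mulNrn; apply: N.
by move=> m hm; rewrite mulNrn => /N; rewrite opprK; exact: h2.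
Qed.

End TorsionPoints.

(** * Counting inversion orbits *)

Section Orbits.
Variable R : realType.
Local Notation C := R[i].
Implicit Types (tau x y : C).

Lemma exact_orderD tau n x l : exact_order tau n x -> lattice tau l -> exact_order tau n (x + l).
Proof.
move=> [h1 h2] hl; split; first by rewrite mulrnDl; apply: latticeD => //; exact: latticeMn.
move=> m hm; rewrite mulrnDl => h; apply: (h2 m hm).
by rewrite -[x *+ m](addrK (l *+ m)); apply: latticeB => //; exact: latticeMn.
Qed.

Lemma exact_order_div tau n (a b : 'I_n) : upper_half_plane tau -> coprime (gcdn a b) n ->
  exact_order tau n ((a%:R * tau + b%:R) / n%:R).
Proof.
move=> ht co; have n0 : (0 < n)%N by apply: leq_ltn_trans (ltn_ord a).
have nC : n%:R != 0 :> C by rewrite pnatr_eq0 -lt0n.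
split.
  exists (Posz a), (Posz b); rewrite -[(_ / _) *+ n]mulr_natr divfK //.
move=> m /andP[m0 mn] [c [d e]].
have : (Posz (m * a))%:~R * tau + (Posz (m * b))%:~R = (c * n)%:~R * tau + (d * n)%:~R.
  rewrite -[_%:~R]/((m * a)%:R : C) -[(Posz (m * b))%:~R]/((m * b)%:R : C) !natrM !intrM.
  have -> : (Posz n)%:~R = n%:R :> C by [].
  have -> : c%:~R * n%:R * tau + d%:~R * n%:R = (c%:~R * tau + d%:~R) * n%:R :> C by ring.
  by rewrite -e -[(_ / _) *+ m]mulr_natr; field.
move=> /(lattice_coords_int ht)[e1 e2].
have d1 : (n %| m * a)%N by rewrite -[(m * a)%N]/`|Posz (m * a)|%N e1 abszM dvdn_mull.
have d2 : (n %| m * b)%N by rewrite -[(m * b)%N]/`|Posz (m * b)|%N e2 abszM dvdn_mull.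
have : (n %| m * gcdn a b)%N by rewrite muln_gcdr dvdn_gcd d1 d2.
rewrite Gauss_dvdl; last by rewrite coprime_sym.
by move=> /(dvdn_leq m0); rewrite leqNgt mn.
Qed.

(** Pairwise incongruence modulo the lattice, in the recursive shape in which [theta_divide_seq]
    splits off one zero at a time. *)
Fixpoint lattice_distinct tau (s : seq C) : Prop :=
  if s is x :: s' then (forall y, y \in s' -> ~ lattice tau (y - x)) /\ lattice_distinct tau s'
  else True.

Lemma lattice_distinct_nth tau s :
  (forall i j, (i < size s)%N -> (j < size s)%N -> i <> j -> ~ lattice tau (s`_j - s`_i)) ->
  lattice_distinct tau s.
Proof.
elim: s => [//|x s IH] h; split.
  move=> y /(nthP 0)[j js <-]; exact: (h 0%N j.+1).
by apply: IH => i j hi hj ij; apply: (h i.+1 j.+1) => //; case.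
Qed.

Lemma lattice_distinct_cat tau s t : lattice_distinct tau s -> lattice_distinct tau t ->
  (forall x y, x \in s -> y \in t -> ~ lattice tau (y - x)) -> lattice_distinct tau (s ++ t).
Proof.
elim: s => [//|x s IH] /= [h1 h2] ht hst; split.
  by move=> y; rewrite mem_cat => /orP[/h1//|/hst]; apply; rewrite mem_head.
by apply: IH => // u v us; apply: hst; rewrite inE us orbT.
Qed.

Variables (tau : C) (n : nat) (s : seq C).
Hypotheses (ht : upper_half_plane tau) (n3 : (3 <= n)%N) (hs : inversion_orbit_lifts tau n s).

Let exact_nth i : (i < size s)%N -> exact_order tau n s`_i.
Proof. by move=> hi; apply: hs.1; apply: mem_nth. Qed.

Let orbit_inj i j : (i < size s)%N -> (j < size s)%N ->
  lattice tau (s`_j - s`_i) \/ lattice tau (s`_j + s`_i) -> i = j.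
Proof.
move=> hi hj h; have [k [_ uk]] := hs.2 _ (exact_nth hj).
have ki : k = Ordinal hi by apply: uk.
have kj : k = Ordinal hj by apply: uk; left; rewrite subrr; exact: lattice0.
by have := etrans (esym ki) kj => -[].
Qed.

(** Here [3 <= n] enters: a point of exact order n differs from its negative. *)
Let double_not_lattice i : (i < size s)%N -> ~ lattice tau (s`_i + s`_i).
Proof. by move=> hi; have [_ /(_ 2%N)] := exact_nth hi; rewrite mulr2n; apply; lia. Qed.

Lemma orbit_distinct : lattice_distinct tau (s ++ [seq - x | x <- s]).
Proof.
apply: lattice_distinct_cat.
- by apply: lattice_distinct_nth => i j hi hj ij h; apply: ij; apply: orbit_inj => //; left.
- apply: lattice_distinct_nth => i j; rewrite size_map => hi hj ij.
  rewrite !(nth_map 0) // -opprD => /latticeN; rewrite opprK => h.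
  by apply: ij; apply: orbit_inj => //; left.
move=> x _ /(nthP 0)[i hi <-] /mapP[y /(nthP 0)[j hj <-] ->].
rewrite -opprD => /latticeN; rewrite opprK => h.
have ij : i = j by apply: orbit_inj => //; right.
by move: h; rewrite ij; apply: double_not_lattice.
Qed.

(** An index and a sign determine a torsion point. Reducing modulo n the coordinates of n times this
    point gives a bijection onto [primitive_pairs n], so twice the number of orbits is totient(n)
    psi(n). *)
Lemma orbit_size : size s = nu n.
Proof.
have n0 : (0 < n)%N by lia.
have nC : n%:R != 0 :> C by rewrite pnatr_eq0 -lt0n.
pose pt (ie : 'I_(size s) * bool) := if ie.2 then s`_ie.1 else - s`_ie.1.
have pt_exact ie : exact_order tau n (pt ie).
  by rewrite /pt; case: ie => i [] /=; [|apply: exact_orderN]; exact: exact_nth (ltn_ord i).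
have /choice[A hA] : forall ie, exists ab : int * int, pt ie *+ n = ab.1%:~R * tau + ab.2%:~R.
  by move=> ie; have [[a [b e]] _] := pt_exact ie; exists (a, b).
have nZ : (n : int) != 0 by rewrite -lt0n.
have rlt (a : int) : (`|(a %% n)%Z| < n)%N.
  by have := modz_ge0 a nZ; have := @ltz_pmod a n n0; lia.
pose r (a : int) : 'I_n := Ordinal (rlt a).
have rE (a : int) : a = (a %/ n)%Z * n + (r a : nat).
  by rewrite /= gez0_abs ?modz_ge0 // -divz_eq.
have r_uniq (a c : int) (k : 'I_n) : a = c * n + (k : nat) -> r a = k.
  move=> e; apply/val_inj => /=; rewrite e modzMDl modz_small ?absz_nat //.
  by rewrite ltz_nat ltn_ord.
pose g ie := (r (A ie).1, r (A ie).2).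
have g_inj : injective g.
  move=> [i e] [j e'] [/= h1 h2].
  have l : lattice tau (pt (j, e') - pt (i, e)).
    exists (((A (j, e')).1 %/ n)%Z - ((A (i, e)).1 %/ n)%Z), (((A (j, e')).2 %/ n)%Z - ((A (i, e)).2 %/ n)%Z).
    apply: (mulIf nC); rewrite mulrBl ![pt _ * _]mulr_natr !hA.
    rewrite [in (A (j, e')).1%:~R](rE (A (j, e')).1) [in (A (j, e')).2%:~R](rE (A (j, e')).2).
    rewrite [in (A (i, e)).1%:~R](rE (A (i, e)).1) [in (A (i, e)).2%:~R](rE (A (i, e)).2) /= h1 h2.
    rewrite !(intrD, intrM, mulrNz); have -> : (Posz n)%:~R = n%:R :> C by [].
    by ring.
  have ij : i = j.
    apply/val_inj; apply: orbit_inj; [exact: ltn_ord | exact: ltn_ord |].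
    move: l; rewrite /pt /=.
    case: e e' {h1 h2} => -[]; rewrite ?opprK; try tauto.
      by rewrite -opprD => /latticeN; rewrite opprK; right.
    by move=> /latticeN; rewrite opprD opprK; left.
  subst j; congr (_, _); move: l; rewrite /pt /=; case: e e' {h1 h2} => -[] //; rewrite ?opprK.
    by rewrite -opprD => /latticeN; rewrite opprK => /(double_not_lattice (ltn_ord i)).
  by move=> /(double_not_lattice (ltn_ord i)).
have img : primitive_pairs n = (g @: [set: 'I_(size s) * bool])%SET.
  apply/setP => -[a b]; apply/idP/imsetP => [|[ie _ ->]].
    rewrite inE /= => co; have ex := exact_order_div ht co; set y := (_ / _) in ex.
    have [i [hi _]] := hs.2 y ex.
    have [e [l hl ye]] : exists e, exists2 l, lattice tau l & pt (i, e) = y + l.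
      case: hi => hi.
        by exists true, (- (y - s`_i)); [exact: latticeN | rewrite /pt /=; ring].
      by exists false, (- (y + s`_i)); [exact: latticeN | rewrite /pt /=; ring].
    exists (i, e); [by rewrite inE | have [c [d lE]] := hl].
    have := hA (i, e); rewrite ye mulrnDl -[y *+ n]mulr_natr divfK // lE -[(_ + _) *+ n]mulr_natr.
    have -> : (a%:R : C) * tau + b%:R + (c%:~R * tau + d%:~R) * n%:R =
       (c * n + (a : nat))%:~R * tau + (d * n + (b : nat))%:~R.
      rewrite !(intrD, intrM); have -> : (Posz n)%:~R = n%:R :> C by [].
      have -> : (Posz a)%:~R = a%:R :> C by []; have -> : (Posz b)%:~R = b%:R :> C by [].
      ring.
    move=> /(lattice_coords_int ht)[e1 e2].
    by congr (_, _); apply/esym; [exact: r_uniq (esym e1) | exact: r_uniq (esym e2)].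
  rewrite inE /= /coprime.
  pose l := ((A ie).1 %/ n)%Z%:~R * tau + ((A ie).2 %/ n)%Z%:~R : C.
  have ex : exact_order tau n (pt ie - l).
    by apply: exact_orderD => //; apply: latticeN; exact: lattice_int.
  apply/eqP; apply: (@exact_order_coprime _ tau n (pt ie - l) (Posz (r (A ie).1)) (Posz (r (A ie).2)) n0 ex).
  rewrite mulrnBl hA {1}(rE (A ie).1) {1}(rE (A ie).2) -[l *+ n]mulr_natr /l.
  rewrite !(intrD, intrM); have -> : (Posz n)%:~R = n%:R :> C by [].
  ring.
have := card_primitive_pairs n0; rewrite img card_imset // cardsT card_prod card_ord card_bool -nu_double //.
by rewrite muln2 => /double_inj.
Qed.

End Orbits.

(** * Siegel modular forms and Fourier-Jacobi coefficients *)

Section Siegel.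
Variable R : realType.
Local Notation C := R[i].

Definition mx2 (T : Type) (a b c d : T) : 'M[T]_2 :=
  \matrix_(i, j) (if i == 0 then (if j == 0 then a else b) else (if j == 0 then c else d)).

Lemma mx2P (T : Type) (A B : 'M[T]_2) : A 0 0 = B 0 0 -> A 0 1 = B 0 1 -> A 1 0 = B 1 0 -> A 1 1 = B 1 1 ->
  A = B.
Proof.
move=> h00 h01 h10 h11; apply/matrixP => i j.
have ord2 (k : 'I_2) : k = 0 \/ k = 1.
  by case: k => [[|[|//]] hk]; [left|right]; apply/val_inj.
by case: (ord2 i) => ->; case: (ord2 j) => ->.
Qed.

Lemma mx2_mul (K : pzSemiRingType) (a b c d a' b' c' d' : K) : mx2 a b c d *m mx2 a' b' c' d' =
  mx2 (a * a' + b * c') (a * b' + b * d') (c * a' + d * c') (c * b' + d * d').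
Proof. by apply: mx2P; rewrite !mxE !big_ord_recl big_ord0 !mxE /= addr0. Qed.

Lemma mx2_add (K : nmodType) (a b c d a' b' c' d' : K) : mx2 a b c d + mx2 a' b' c' d' =
  mx2 (a + a') (b + b') (c + c') (d + d').
Proof. by apply: mx2P; rewrite !mxE. Qed.

Lemma mx2_opp (K : zmodType) (a b c d : K) : - mx2 a b c d = mx2 (- a) (- b) (- c) (- d).
Proof. by apply: mx2P; rewrite !mxE. Qed.

Lemma mx2_tr (T : Type) (a b c d : T) : (mx2 a b c d)^T = mx2 a c b d.
Proof. by apply: mx2P; rewrite !mxE. Qed.

Lemma mx2_map (S T : Type) (f : S -> T) (a b c d : S) : map_mx f (mx2 a b c d) = mx2 (f a) (f b) (f c) (f d).
Proof. by apply: mx2P; rewrite !mxE. Qed.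

Lemma mx2_1 (K : pzSemiRingType) : 1%:M = mx2 1 0 0 1 :> 'M[K]_2.
Proof. by apply: mx2P; rewrite !mxE. Qed.

Lemma mx2_det (K : comPzRingType) (a b c d : K) : \det (mx2 a b c d) = a * d - b * c.
Proof.
rewrite (expand_det_row _ 0) !big_ord_recl big_ord0 addr0 /cofactor !det_mx11 !mxE /=.
by rewrite expr0 expr1; ring.
Qed.

Lemma siegel_pointE (t1 z t2 : C) : siegel_point t1 z t2 = mx2 t1 z z t2.
Proof. by apply: mx2P; rewrite !mxE. Qed.

(** Positive definiteness of the imaginary part expressed by its leading minors. *)
Definition siegel_dom (t1 z t2 : C) :=
  0 < complex.Im t1 /\ complex.Im z ^+ 2 < complex.Im t1 * complex.Im t2.

Lemma siegel_domP (t1 z t2 : C) : siegel_dom t1 z t2 -> siegel_half_space (siegel_point t1 z t2).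
Proof.
move=> [h1 h2]; rewrite siegel_pointE; split; first by rewrite mx2_tr.
move=> v v0; rewrite mx2_map !mxE !big_ord_recl big_ord0 !mxE !big_ord_recl !big_ord0 !mxE /=.
rewrite !addr0; set a := v _ _; set b := v _ _.
have ab : a != 0 \/ b != 0.
  have [a0|] := eqVneq a 0; [right | by left]; apply: contraNneq v0 => b0.
  apply/eqP/rowP => j; rewrite mxE; case: j => [[|[|//]] hj].
    by rewrite -[RHS]a0; congr (v _ _); apply/val_inj.
  by rewrite -[RHS]b0; congr (v _ _); apply/val_inj.
move: (complex.Im t1) (complex.Im z) (complex.Im t2) h1 h2 => y1 y y2 h1 h2.
rewrite -(pmulr_rgt0 _ h1).
have -> : y1 * ((a * y1 + b * y) * a + (a * y + b * y2) * b) = (a * y1 + b * y) ^+ 2 + b ^+ 2 * (y1 * y2 - y ^+ 2) by ring.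
have d0 : 0 < y1 * y2 - y ^+ 2 by lra.
have [b0|b0] := eqVneq b 0.
  rewrite b0 mul0r expr0n /= mul0r !addr0 exprn_even_gt0 //= mulf_neq0 ?(lt0r_neq0 h1) //.
  by case: ab => //; rewrite b0 eqxx.
by apply: ltr_wpDl; [exact: sqr_ge0 | rewrite mulr_gt0 // exprn_even_gt0].
Qed.

Definition mx4 (A B D E : 'M[int]_2) : 'M[int]_(2 + 2) := block_mx A B D E.

Lemma mx4_Sp4Z (A B D E : 'M[int]_2) : A^T *m D = D^T *m A -> B^T *m E = E^T *m B ->
  A^T *m E - D^T *m B = 1%:M -> is_Sp4Z (mx4 A B D E).
Proof.
move=> h1 h2 h3; rewrite /is_Sp4Z /symplectic_form tr_block_mx !mulmx_block.
rewrite !mulmx0 !mulmxN !mulmx1 !add0r !addr0 !mulNmx.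
rewrite h1 h2 !addNr [- _ + A^T *m E]addrC h3; congr (block_mx 0 _ _ 0).
by rewrite -[1%:M in RHS]trmx1 -h3 raddfB /= !trmx_mul !trmxK opprB addrC.
Qed.

(** The image point [t'] is certified by multiplying with the denominator, which avoids computing an
    inverse matrix. *)
Lemma siegel_transform (k : int) (G : 'M[C]_2 -> C) (A B D E : 'M[int]_2) (t t' : 'M[C]_2) :
  siegel_modular_form k G -> is_Sp4Z (mx4 A B D E) -> siegel_half_space t ->
  \det (map_mx intr D *m t + map_mx intr E) != 0 ->
  map_mx intr A *m t + map_mx intr B = t' *m (map_mx intr D *m t + map_mx intr E) ->
  G t' = \det (map_mx intr D *m t + map_mx intr E) ^ k * G t.
Proof.
move=> [_ hG] hg ht du e; have := hG _ _ hg ht.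
rewrite /siegel_action /siegel_denom /mx4 block_mxKul block_mxKur block_mxKdl block_mxKdr.
by rewrite e mulmxK // unitmxE unitfE.
Qed.

Variables (k : int) (G : 'M[C]_2 -> C).
Hypothesis hG : siegel_modular_form k G.
Local Notation g t1 z t2 := (G (siegel_point t1 z t2)).

Lemma siegel_translate_z (t1 z t2 : C) : siegel_dom t1 z t2 -> g t1 (z + 1) t2 = g t1 z t2.
Proof.
move=> /siegel_domP ht.
have sp : is_Sp4Z (mx4 (mx2 1 0 0 1) (mx2 0 1 1 0) (mx2 0 0 0 0) (mx2 1 0 0 1)).
  by apply: mx4_Sp4Z; rewrite ?mx2_tr ?mx2_1 !mx2_mul ?mx2_opp ?mx2_add; apply: mx2P; rewrite !mxE.
have := siegel_transform (t' := siegel_point t1 (z + 1) t2) hG sp ht.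
rewrite !siegel_pointE !mx2_map !mx2_mul !mx2_add mx2_mul !mx2_det.
rewrite !(rmorphN, rmorph0, rmorph1, mul0r, mul1r, mulr1, mulr0, addr0, add0r, subr0, sub0r) oner_neq0.
by move=> -> //; rewrite exp1rz mul1r.
Qed.

(** The action t -> U t U^T of the unipotent matrix U with rows (1, 0) and (1, 1). On Fourier-Jacobi
    coefficients it becomes the law for z -> z + t1. *)
Lemma siegel_shear (t1 z t2 : C) : siegel_dom t1 z t2 ->
  g t1 (z + t1) (t2 + (2 * z + t1)) = g t1 z t2.
Proof.
move=> /siegel_domP ht.
have sp : is_Sp4Z (mx4 (mx2 1 0 1 1) (mx2 0 0 0 0) (mx2 0 0 0 0) (mx2 1 (-1) 0 1)).
  by apply: mx4_Sp4Z; rewrite ?mx2_tr ?mx2_1 !mx2_mul ?mx2_opp ?mx2_add; apply: mx2P; rewrite !mxE.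
have := siegel_transform (t' := siegel_point t1 (z + t1) (t2 + (2 * z + t1))) hG sp ht.
rewrite !siegel_pointE !mx2_map !mx2_mul !mx2_add mx2_mul !mx2_det.
rewrite !(rmorphN, rmorph0, rmorph1, mul0r, mul1r, mulr1, mulr0, addr0, add0r, subr0, sub0r) oner_neq0.
move=> -> //; first by rewrite exp1rz mul1r.
by congr mx2; ring.
Qed.

(** Converts the expansion in q2 into one in q1. *)
Lemma siegel_swap (t1 z t2 : C) : siegel_dom t1 z t2 -> g t2 z t1 = (-1) ^ k * g t1 z t2.
Proof.
move=> /siegel_domP ht.
have sp : is_Sp4Z (mx4 (mx2 0 1 1 0) (mx2 0 0 0 0) (mx2 0 0 0 0) (mx2 0 1 1 0)).
  by apply: mx4_Sp4Z; rewrite ?mx2_tr ?mx2_1 !mx2_mul ?mx2_opp ?mx2_add; apply: mx2P; rewrite !mxE.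
have := siegel_transform (t' := siegel_point t2 z t1) hG sp ht.
rewrite !siegel_pointE !mx2_map !mx2_mul !mx2_add mx2_mul !mx2_det.
rewrite !(rmorphN, rmorph0, rmorph1, mul0r, mul1r, mulr1, mulr0, addr0, add0r, subr0, sub0r) oppr_eq0 oner_neq0.
by move=> ->.
Qed.

(** The inversion of SL_2(Z) embedded in the first variable; on z = 0 it leaves t2 fixed, so it is
    compatible with the limit in t2. *)
Lemma siegel_inversion (t1 t2 : C) : siegel_dom t1 0 t2 -> g (- t1^-1) 0 t2 = t1 ^ k * g t1 0 t2.
Proof.
move=> hd; have /siegel_domP ht := hd.
have t0 : t1 != 0 by apply: contraTneq hd.1 => ->; rewrite /= ltxx.
have sp : is_Sp4Z (mx4 (mx2 0 0 0 1) (mx2 (-1) 0 0 0) (mx2 1 0 0 0) (mx2 0 0 0 1)).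
  by apply: mx4_Sp4Z; rewrite ?mx2_tr ?mx2_1 !mx2_mul ?mx2_opp ?mx2_add; apply: mx2P; rewrite !mxE.
have := siegel_transform (t' := siegel_point (- t1^-1) 0 t2) hG sp ht.
rewrite !siegel_pointE !mx2_map !mx2_mul !mx2_add mx2_mul !mx2_det.
rewrite !(rmorphN, rmorph0, rmorph1, mul0r, mul1r, mulr1, mulr0, addr0, add0r, subr0, sub0r) t0.
by move=> -> //; rewrite mulNr mulVf.
Qed.

End Siegel.

(** * Power series on a punctured disc *)

Section PowerSeries.
Variable R : realType.
Local Notation C := R[i].
Implicit Types (q : C) (a b : nat -> C).

Definition pterm a q (m : nat) : C := a m * q ^+ m.

Lemma series_terms_bounded (u : nat -> C) l : clim (series u) l -> exists2 B, 0 < B & forall n, cabs (u n) <= B.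
Proof.
move=> /clim_bounded[B B0 hB]; exists (B + B); first lra.
move=> n; have -> : u n = series u n.+1 - series u n by rewrite seriesSr addrC addKr.
by apply: (le_trans (cabsD _ _)); rewrite cabsN; apply: lerD.
Qed.

Lemma series_drop (u : nat -> C) m n : (forall i, (i < m)%N -> u i = 0) ->
  series u (n + m)%N = \sum_(0 <= i < n) u (i + m)%N.
Proof.
move=> h; rewrite /series /= (@big_cat_nat _ _ _ m) //= ?leq_addl //.
rewrite big_nat big1 ?add0r; last by move=> i /andP[_ /h].
by rewrite -{1}[m]add0n big_addn addnK.
Qed.

(** Convergence at one radius bounds the terms there and makes the series converge geometrically,
    hence uniformly, on smaller discs. Convergence is only assumed for [q] non-zero, because the
    exponential never takes the value 0. *)
Lemma power_series_hol a (rho : R) : 0 < rho ->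
  (forall q, 0 < cabs q < rho -> exists l, clim (series (pterm a q)) l) ->
  exists2 F : C -> C, (forall q, cabs q < rho -> hol F q) /\ F 0 = a 0%N &
    forall q, cabs q < rho -> clim (series (pterm a q)) (F q).
Proof.
move=> rho0 conv.
have c0 : clim (series (pterm a 0)) (a 0%N).
  apply: (@clim_unshift _ _ _ 1); apply: clim_ext (clim_cst (a 0%N)) _ => n.
  rewrite addn1 /series /= big_nat_recl // /pterm expr0 mulr1 big1 ?addr0 // => i _.
  by rewrite expr0n /= mulr0.
have {}conv q : cabs q < rho -> exists l, clim (series (pterm a q)) l.
  have [->|q0] := eqVneq q 0; first by exists (a 0%N).
  by move=> hq; apply: conv; rewrite cabs_gt0 q0.
pose F q := limn (series (pterm a q) : nat -> C^o).
have FE q : cabs q < rho -> clim (series (pterm a q)) (F q).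
  by move=> /conv[l hl]; rewrite /F (clim_lim hl).
exists F => //; split; last exact: clim_lim.
move=> q hq; have q0 := cabs_ge0 q.
(* Two intermediate radii: [cabs q < r < r1 < rho]. *)
pose r := (2 * cabs q + rho) / 3; pose r1 := (cabs q + 2 * rho) / 3.
have r1E : cabs (r1%:C : C) = r1 by rewrite cabs_real ger0_norm // /r1; lra.
have [l hl] := conv r1%:C ltac:(rewrite r1E /r1; lra).
have [B B0 hB] := series_terms_bounded hl.
have r10 : 0 < r1 by rewrite /r1; lra.
have hs : 0 <= r / r1 < 1.
  apply/andP; split; first by rewrite divr_ge0 //; [rewrite /r; lra | exact: ltW].
  by rewrite ltr_pdivrMr // mul1r /r /r1; lra.
have bound w : cabs w <= r -> forall i, cabs (pterm a w i) <= B * (r / r1) ^+ i.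
  move=> hw i; have := hB i; rewrite /pterm !cabsM !cabsX r1E => h.
  rewrite expr_div_n; apply: (@le_trans _ _ (cabs (a i) * r ^+ i)).
    apply: ler_wpM2l; first exact: cabs_ge0.
    by apply: lerXn2r; rewrite ?nnegrE ?cabs_ge0 //; apply: le_trans hw; exact: cabs_ge0.
  have r0 : 0 <= r by apply: le_trans hw; exact: cabs_ge0.
  have -> : B * (r ^+ i / r1 ^+ i) = B / r1 ^+ i * r ^+ i by ring.
  by apply: ler_wpM2r; [exact: exprn_ge0 | rewrite ler_pdivlMr // exprn_gt0].
apply: (@hol_limit _ (fun n w => series (pterm a w) n) _ _ (r - cabs q)); first by rewrite /r; lra.
  move=> n w _; apply: hol_sum => i; apply: holM; first exact: hol_cst.
  by apply: holX; exact: hol_id.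
move=> e e0.
have K0 : 0 <= B / (1 - r / r1) by rewrite divr_ge0 //; lra.
have [N hN] := geometric_small hs K0 e0.
exists N.+1 => n w Nn hw; have wr : cabs w <= r by have := cabs_subl w q; lra.
have [l' hl' hn] := geometric_series_ratio hs (bound w wr).
rewrite /F (clim_lim hl') cabsB; apply: (le_trans (hn n)).
by have := hN n.-1; rewrite prednK ?(leq_ltn_trans _ Nn) // => h; apply: ltW; apply: h; lia.
Qed.

(** The constant terms agree by continuity at 0; subtracting them and dividing by q shifts the
    coefficients. *)
Lemma power_series_unique a b (rho : R) : 0 < rho ->
  (forall q, 0 < cabs q < rho -> exists l, clim (series (pterm a q)) l /\ clim (series (pterm b q)) l) ->
  forall m, a m = b m.
Proof.
move=> rho0 h m.
have const c d : (forall q, 0 < cabs q < rho ->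
    exists l, clim (series (pterm c q)) l /\ clim (series (pterm d q)) l) -> c 0%N = d 0%N.
  move=> hcd.
  have [F [hF F0] FE] := power_series_hol rho0 (fun q hq => let: ex_intro l h := hcd q hq in ex_intro _ l h.1).
  have [G [hG G0] GE] := power_series_hol rho0 (fun q hq => let: ex_intro l h := hcd q hq in ex_intro _ l h.2).
  apply/eqP; rewrite -F0 -G0 -subr_eq0; apply/eqP.
  apply: (@cont_eq0 _ (fun q => F q - G q) 0 rho rho0).
    by apply: contB; apply: hol_cont; [apply: hF | apply: hG]; rewrite cabs0.
  move=> q; rewrite subr0 => hq; have [l [h1 h2]] := hcd q hq.
  have q1 : cabs q < rho by case/andP: hq.
  by rewrite (clim_unique (FE q q1) h1) (clim_unique (GE q q1) h2) subrr.
elim: m a b h => [|m IH] a b h; first exact: const.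
have ab0 : a 0%N = b 0%N by exact: const.
apply: (IH (fun m => a m.+1) (fun m => b m.+1)) => q hq.
have [l [h1 h2]] := h q hq; have q0 : q != 0 by rewrite -cabs_gt0; case/andP: hq.
have sh (c : nat -> C) : c 0%N = a 0%N -> clim (series (pterm c q)) l ->
    clim (series (pterm (fun m => c m.+1) q)) (q^-1 * (l - a 0%N)).
  move=> c0 hc; have := climMl q^-1 (climB (clim_shift 1 hc) (clim_cst (a 0%N))) => /clim_ext; apply => n.
  rewrite addn1 /series /= big_nat_recl // /pterm expr0 mulr1 c0 addrC addKr mulr_sumr.
  by apply: eq_bigr => i _; rewrite exprS; field.
by exists (q^-1 * (l - a 0%N)); split; apply: sh.
Qed.

Lemma ce_horizontal q (y : R) : cabs q = expR (- (2 * pi * y)) -> exists2 x : R, 0 <= x <= 1 & ce (x +i* y) = q.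
Proof.
move=> hq; have q0 : q != 0 by rewrite -cabs_gt0 hq expR_gt0.
have p20 : 2 * pi != 0 :> R by rewrite mulf_neq0 ?pnatr_eq0 // gt_eqF // pi_gt0.
have [t tq] := ce_surj q0.
have ty : complex.Im t = y.
  by have := cabs_ce t; rewrite tq hq => /expR_inj /oppr_inj /(mulfI p20).
pose x := complex.Re t - (Num.floor (complex.Re t))%:~R; exists x.
  by have := floor_itv (complex.Re t); rewrite intrD /x => /andP[? ?]; apply/andP; split; lra.
rewrite -tq -(ceDint (x +i* y) (Num.floor (complex.Re t))) -(rmorph_int (real_complex R)).
congr ce; rewrite -ty; case: (t) @x => a b /=; apply/eqP; rewrite eq_complex /=.
by rewrite subrK addr0 !eqxx.
Qed.

End PowerSeries.

(** * Fourier-Jacobi coefficients of a Siegel modular form *)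

Section FourierJacobi.
Variable R : realType.
Local Notation C := R[i].
Variables (k : int) (G : 'M[C]_2 -> C) (phi : nat -> C -> C -> C).
Hypotheses (hG : siegel_modular_form k G) (hphi : fourier_jacobi_expansion G phi).
Local Notation g t1 z t2 := (G (siegel_point t1 z t2)).

Lemma siegel_hol_z (t1 z t2 : C) : siegel_dom t1 z t2 -> hol (fun w => g t1 w t2) z.
Proof.
move=> /siegel_domP hd; have [hh _] := hG.
have := hh (t1, z, t2) hd => hdiff.
have := @diff_derivable _ _ _ _ _ ((0, 1, 0) : C^o * C^o * C^o) hdiff.
move=> /cvg_ex[l /cvgrPdist_lt hl]; apply: (@slope_hol _ _ _ l) => e e0.
have /hl/nbhs_ballP[d /= d0 hd'] : 0 < e%:C by rewrite ltcR.
have d_real : d = (complex.Re d)%:C.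
  by case: d d0 {hd'} => a b; rewrite ltcE /= => /andP[/eqP ->].
have d1 : 0 < complex.Re d by move: d0; rewrite {1}d_real ltcR.
exists (complex.Re d) => // w hw; have [->|wz] := eqVneq w z.
  by rewrite !subrr mulr0 subrr cabs0 mulr0.
have wz0 : w - z != 0 by rewrite subr_eq0.
have := hd' (w - z); rewrite /ball /= sub0r normrN -cabsE d_real ltcR => /(_ hw wz0) /=.
rewrite !scaler0 !add0r -cabsE ltcR.
have -> : (w - z) *: (1 : C^o) + z = w by rewrite -[_ *: _]/((w - z) * 1) mulr1 subrK.
rewrite -[_ *: _]/(_ * _) => h.
have -> : g t1 w t2 - g t1 z t2 - l * (w - z) = - ((l - (w - z)^-1 * (g t1 w t2 - g t1 z t2)) * (w - z)).
  by field.
by rewrite cabsN cabsM ler_wpM2r ?cabs_ge0 // ltW.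
Qed.

Lemma siegel_cont (t1 z t2 : C) : siegel_dom t1 z t2 -> forall e : R, 0 < e ->
  exists2 d : R, 0 < d & forall t1' z' t2', cabs (t1' - t1) < d -> cabs (z' - z) < d -> cabs (t2' - t2) < d ->
    cabs (g t1' z' t2' - g t1 z t2) < e.
Proof.
move=> /siegel_domP hd e e0; have [hh _] := hG.
have := differentiable_continuous (hh (t1, z, t2) hd) => /cvgrPdist_lt hl.
have /hl/nbhs_ballP[d /= d0 hd'] : 0 < e%:C by rewrite ltcR.
have d_real : d = (complex.Re d)%:C.
  by case: d d0 {hd'} => a b; rewrite ltcE /= => /andP[/eqP ->].
have d1 : 0 < complex.Re d by move: d0; rewrite {1}d_real ltcR.
exists (complex.Re d) => // t1' z' t2' h1 h2 h3.
have := hd' (t1', z', t2'); rewrite -cabsE ltcR cabsB; apply.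
by split => /=; [split|]; rewrite /ball /= -cabsE d_real ltcR cabsB.
Qed.

Lemma fj_clim (t1 z t2 : C) : siegel_dom t1 z t2 ->
  clim (series (pterm (fun m => phi m t1 z) (ce t2))) (g t1 z t2).
Proof. by move=> /siegel_domP /hphi h; apply/climP. Qed.

(** The condition of [siegel_dom] on t2 reads |q2| < [fj_radius t1 z]. *)
Definition fj_radius (t1 z : C) : R := expR (- (2 * pi * (complex.Im z ^+ 2 / complex.Im t1))).

Lemma siegel_dom_q (t1 z q : C) : upper_half_plane t1 -> 0 < cabs q < fj_radius t1 z ->
  exists2 t2, ce t2 = q & siegel_dom t1 z t2.
Proof.
move=> ht /andP[]; rewrite cabs_gt0 => /ce_surj[t2 <-].
rewrite cabs_ce ltr_expR ltrN2 ltr_pM2l; last by rewrite mulr_gt0 // pi_gt0.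
by rewrite ltr_pdivrMr // mulrC => h; exists t2.
Qed.

Lemma fj_unique (t1 z : C) (b : nat -> C) : upper_half_plane t1 ->
  (forall t2, siegel_dom t1 z t2 -> clim (series (pterm b (ce t2))) (g t1 z t2)) ->
  forall m, phi m t1 z = b m.
Proof.
move=> ht hb; apply: (@power_series_unique _ (fun m => phi m t1 z) b (fj_radius t1 z) (expR_gt0 _)).
move=> q /(siegel_dom_q ht)[t2 <- hd]; exists (g t1 z t2); split; [exact: fj_clim | exact: hb].
Qed.

Lemma phi_period1 m (t1 z : C) : upper_half_plane t1 -> phi m t1 (z + 1) = phi m t1 z.
Proof.
move=> ht; apply: (fj_unique ht (b := fun m => phi m t1 z)) => t2 [h1 h2].
have hd : siegel_dom t1 z t2 by split => //; move: h2; case: (z) => a b /=; rewrite addr0.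
by rewrite (siegel_translate_z hG hd); exact: fj_clim.
Qed.

Lemma phi_shear m (t1 z : C) : upper_half_plane t1 ->
  phi m t1 (z + t1) * ce (2 * z + t1) ^+ m = phi m t1 z.
Proof.
move=> ht; apply/esym.
apply: (fj_unique ht (b := fun m => phi m t1 (z + t1) * ce (2 * z + t1) ^+ m)) => t2 hd.
rewrite -(siegel_shear hG hd).
have hd' : siegel_dom t1 (z + t1) (t2 + (2 * z + t1)).
  case: hd; case: (t1) (z) (t2) => [a b] [c d] [e f] /= h1 h2; split => //=.
  nra.
apply: clim_ext (fj_clim hd') _ => n; rewrite /series /=; apply: eq_bigr => i _.
by rewrite /pterm ceD exprMn mulrA mulrAC.
Qed.

Lemma phi_eq0 m (t1 z : C) : upper_half_plane t1 ->
  (forall t2, siegel_dom t1 z t2 -> g t1 z t2 = 0) -> phi m t1 z = 0.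
Proof.
move=> ht h0; apply: (fj_unique ht (b := fun _ => 0)) => t2 hd; rewrite h0 //.
apply: clim_ext (clim_cst 0) _ => n; rewrite /series /= big1 // => i _.
by rewrite /pterm mul0r.
Qed.

(** When the lower coefficients vanish, q2^(-m) G extends holomorphically to q2 = 0 with value
    [phi m]. The estimate is [cauchy_diff0] on the circle |q2| = e^(-2 pi y), so a bound for G on
    one horizontal segment controls all larger heights. *)
Lemma leading_coeff m (t1 z t2 : C) (y B : R) : upper_half_plane t1 ->
  (forall j, (j < m)%N -> phi j t1 z = 0) -> siegel_dom t1 z (0 +i* y) -> y < complex.Im t2 ->
  (forall x : R, 0 <= x <= 1 -> cabs (g t1 z (x +i* y)) <= B) ->
  cabs (ce (- (m%:R * t2)) * g t1 z t2 - phi m t1 z) <=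
    B * expR (2 * pi * y) ^+ m / (expR (2 * pi * (complex.Im t2 - y)) - 1).
Proof.
move=> ht h0 hy yt hB.
have [F [hF F0] FE] : exists2 F : C -> C, (forall q, cabs q < fj_radius t1 z -> hol F q) /\ F 0 = phi m t1 z &
    forall t, siegel_dom t1 z t -> g t1 z t = ce t ^+ m * F (ce t).
  have sh t : siegel_dom t1 z t ->
      clim (series (pterm (fun j => phi (m + j)%N t1 z) (ce t))) (ce (- (m%:R * t)) * g t1 z t).
    move=> hd; have := climMl (ce (- (m%:R * t))) (clim_shift m (fj_clim hd)) => /clim_ext; apply => n.
    rewrite series_drop; last by move=> i im; rewrite /pterm h0 // mul0r.
    rewrite /series /= mulr_sumr; apply: eq_bigr => i _; rewrite /pterm (addnC i) exprD ceN -ceX.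
    by have := ce_neq0 t; move: (ce t) => c c0; field; rewrite expf_neq0.
  have [F [hF F0] FE] := @power_series_hol _ (fun j => phi (m + j)%N t1 z) (fj_radius t1 z) (expR_gt0 _)
    ltac:(by move=> q /(siegel_dom_q ht)[t <- hd]; exists (ce (- (m%:R * t)) * g t1 z t); exact: sh).
  exists F; first by rewrite addn0 in F0.
  move=> t hd; have qt : cabs (ce t) < fj_radius t1 z.
    rewrite cabs_ce ltr_expR ltrN2 ltr_pM2l ?mulr_gt0 ?pi_gt0 //.
    by rewrite ltr_pdivrMr //; case: hd => _; rewrite mulrC.
  rewrite (clim_unique (FE _ qt) (sh t hd)) mulrA ceX -ceD addrC addNr ce0 mul1r //.
have hd : siegel_dom t1 z t2.
  by case: hy => h1 /= h2; split => //; apply: (lt_trans h2); rewrite ltr_pM2l.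
have p0 := @pi_gt0 R; have p20 : 0 < 2 * pi :> R by lra.
pose r : R := expR (- (2 * pi * y)); have r0 : 0 < r by exact: expR_gt0.
have rr : r < fj_radius t1 z.
  rewrite ltr_expR ltrN2 ltr_pM2l // ltr_pdivrMr //; case: hy => _ /=; by rewrite mulrC.
have qr : cabs (ce t2) < r by rewrite cabs_ce ltr_expR ltrN2 ltr_pM2l.
have FB q : cabs q = r -> cabs (F q) <= B * expR (2 * pi * y) ^+ m.
  move=> hq; have q0 : q != 0 by rewrite -cabs_gt0 hq.
  have [x hx tx] := ce_horizontal hq.
  have hxd : siegel_dom t1 z (x +i* y) by case: hy.
  have := FE _ hxd; rewrite tx => e.
  have -> : F q = q ^- m * g t1 z (x +i* y) by rewrite e mulKf // expf_neq0.
  rewrite mulrC cabsM cabsV cabsX hq; apply: ler_pM; rewrite ?cabs_ge0 ?invr_ge0 ?exprn_ge0 ?cabs_ge0 //.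
  - exact: ltW.
  - exact: hB.
  by rewrite /r expRN exprVn invrK.
have := @cauchy_diff0 _ F (fj_radius t1 z) r _ (ce t2) hF rr qr FB.
rewrite F0 (FE t2 hd) mulrA ceX -ceD addNr ce0 mul1r => h; apply: (le_trans h).
have B0 : 0 <= B by apply: le_trans (hB 0 ltac:(by rewrite lexx ler01)); exact: cabs_ge0.
rewrite -mulrA; apply: ler_wpM2l; first by rewrite mulr_ge0 ?exprn_ge0 ?expR_ge0.
have -> : r = expR (2 * pi * (complex.Im t2 - y)) * cabs (ce t2).
  by rewrite cabs_ce -expRD /r; congr expR; ring.
have E1 : 1 < expR (2 * pi * (complex.Im t2 - y)) by rewrite expR_gt1 mulr_gt0 // subr_gt0.
have := ce_neq0 t2; rewrite -cabs_gt0; move: (cabs (ce t2)) (expR _) E1 => c E E1 c0.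
rewrite -[X in E * c - X]mul1r -mulrBl invfM mulrCA divff ?gt_eqF // mulr1 //.
Qed.

(** Along t2 = i (y + j + 1) the exponential rate is weakened to 1 / (j + 1), which is easier to sum
    up in later limits. *)
Lemma leading_coeff_shift m (t1 z : C) (y B : R) j : upper_half_plane t1 ->
  (forall j, (j < m)%N -> phi j t1 z = 0) -> siegel_dom t1 z (0 +i* y) ->
  (forall x : R, 0 <= x <= 1 -> cabs (g t1 z (x +i* y)) <= B) ->
  cabs (ce (- (m%:R * (0 +i* (y + j.+1%:R)))) * g t1 z (0 +i* (y + j.+1%:R)) - phi m t1 z) <=
    B * expR (2 * pi * y) ^+ m / j.+1%:R.
Proof.
move=> ht h0 hd hB; have yj : y < complex.Im (0 +i* (y + j.+1%:R)) by rewrite /= ltrDl.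
apply: (le_trans (leading_coeff ht h0 hd yj hB)); rewrite /= [y + _]addrC addrK.
apply: ler_wpM2l.
  rewrite mulr_ge0 ?exprn_ge0 ?expR_ge0 //.
  by apply: le_trans (hB 0 _); rewrite ?lexx ?ler01 ?cabs_ge0.
have p2 := @pi_ge2 R; have j0 : 0 < (j.+1%:R : R) by [].
move: (j.+1%:R : R) j0 {yj} => J j0.
have E1 : J <= expR (2 * pi * J) - 1.
  have := expR_ge1Dx (2 * pi * J).
  have : 1 * J <= 2 * pi * J by apply: ler_wpM2r; [exact: ltW | lra].
  lra.
by rewrite lef_pV2 ?posrE //; lra.
Qed.

(** A locally uniform limit of z -> q2^(-m) G(t1, z, t2), by the rate in [leading_coeff_shift]; the
    vanishing of the lower coefficients is what makes this limit exist. *)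
Lemma phi_hol m (t1 z : C) : upper_half_plane t1 ->
  (forall j w, (j < m)%N -> phi j t1 w = 0) -> hol (phi m t1) z.
Proof.
move=> ht h0; have ht' : 0 < complex.Im t1 := ht.
(* At height [y] every w with |Im w| <= Y is admissible, since Im t1 times y exceeds Y^2. *)
pose Y := `|complex.Im z| + 1; pose y := (Y ^+ 2 + 1) / complex.Im t1.
have Y0 : 0 <= Y by rewrite /Y; have := normr_ge0 (complex.Im z); lra.
have dom w s : `|complex.Im w| <= Y -> y <= complex.Im s -> siegel_dom t1 w s.
  move=> hw hs; split => //; apply: (@lt_le_trans _ _ (complex.Im t1 * y)).
    have -> : complex.Im t1 * y = Y ^+ 2 + 1 by rewrite /y mulrC divfK ?gt_eqF.
    have : `|complex.Im w| ^+ 2 <= Y ^+ 2 by apply: lerXn2r; rewrite ?nnegrE.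
    by rewrite real_normK ?num_real //; lra.
  by rewrite ler_pM2l.
have imb w : cabs (w - z) < 1 -> `|complex.Im w| <= Y.
  move=> hw; have := cabs_Im (w - z); rewrite raddfB /= /Y => k1.
  by have := ler_normD (complex.Im w - complex.Im z) (complex.Im z); rewrite subrK; lra.
have [|B hB] := @box_bounded _ (fun a b x : R => g t1 (z + ((2 * a - 1) +i* (2 * b - 1))) (x +i* y)).
  move=> a b x ha hb hx; pose w := z + ((2 * a - 1) +i* (2 * b - 1)).
  have hw : `|complex.Im w| <= Y.
    rewrite /w raddfD /= /Y; apply: (le_trans (ler_normD _ _)); rewrite lerD2l ler_norml; lra.
  have hd := dom w (x +i* y) hw (lexx _).
  have [d d0 hcont] := siegel_cont hd ltr01.
  exists (cabs (g t1 w (x +i* y)) + 1); exists (d / 5); first lra.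
  move=> a' b' x' ha' hb' hx'.
  have := hcont t1 (z + ((2 * a' - 1) +i* (2 * b' - 1))) (x' +i* y).
  rewrite subrr cabs0 => /(_ d0).
  have -> : z + ((2 * a' - 1) +i* (2 * b' - 1)) - w = (2 * (a' - a)) +i* (2 * (b' - b)).
    rewrite /w; case: (z) => u v; apply/eqP; rewrite eq_complex /=; apply/andP; split; apply/eqP; ring.
  have -> : (x' +i* y) - (x +i* y) = (x' - x)%:C.
    by apply/eqP; rewrite eq_complex /= subrr !eqxx.
  have n2 (v : R) : `|2 * v| = 2 * `|v| by rewrite normrM ger0_norm.
  have c1 : cabs ((2 * (a' - a)) +i* (2 * (b' - b)) : C) < d.
    by apply: (le_lt_trans (cabs_ReIm _)); rewrite /= !n2; lra.
  move=> /(_ c1); rewrite cabs_real => /(_ ltac:(lra)).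
  by have := cabs_subl (g t1 (z + ((2 * a' - 1) +i* (2 * b' - 1))) (x' +i* y)) (g t1 w (x +i* y)); lra.
have hB' w x : cabs (w - z) < 1 -> 0 <= x <= 1 -> cabs (g t1 w (x +i* y)) <= B.
  move=> hw hx.
  have r1 := cabs_Re (w - z); have r2 := cabs_Im (w - z).
  have := hB ((complex.Re (w - z) + 1) / 2) ((complex.Im (w - z) + 1) / 2) x.
  have -> : z + ((2 * ((complex.Re (w - z) + 1) / 2) - 1) +i* (2 * ((complex.Im (w - z) + 1) / 2) - 1)) = w.
    by case: (z) (w) => a b [c d]; apply/eqP; rewrite eq_complex /=; apply/andP; split; apply/eqP; field.
  apply; move=> //; [move: r1 | move: r2]; rewrite ler_norml => /andP[? ?]; apply/andP; split; lra.
pose s (j : nat) : C := 0 +i* (y + j.+1%:R).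
apply: (@hol_limit _ (fun j w => ce (- (m%:R * s j)) * g t1 w (s j)) _ _ 1 ltr01).
  move=> j w hw; apply: holM; first exact: hol_cst.
  by apply: siegel_hol_z; apply: dom; [exact: imb | rewrite /= lerDl].
move=> e e0; pose K := B * expR (2 * pi * y) ^+ m.
have K0 : 0 <= K.
  rewrite mulr_ge0 ?exprn_ge0 ?expR_ge0 //.
  by apply: le_trans (hB' z 0 _ _); rewrite ?subrr ?cabs0 ?lexx ?ler01 ?cabs_ge0.
have [N hN] : exists N : nat, K / e < N%:R.
  by exists (Num.truncn (K / e)).+1; apply: truncnS_gt.
exists N => j w Nj hw.
apply: (le_trans (leading_coeff_shift j ht (fun i => h0 i w) (dom w (0 +i* y) (imb w hw) (lexx _)) (fun x => hB' w x hw))).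
have Nj' : (N%:R : R) <= j.+1%:R by rewrite ler_nat; lia.
rewrite -/K ler_pdivrMr //; move: hN; rewrite ltr_pdivrMr // => hN.
nra.
Qed.

End FourierJacobi.

(** * The product formula *)

Section OrbitExistence.
Variable R : realType.
Local Notation C := R[i].
Variables (tau : C) (n : nat).
Hypotheses (ht : upper_half_plane tau) (n3 : (3 <= n)%N).

Definition torsion_point (ab : 'I_n * 'I_n) : C := (ab.1%:R * tau + ab.2%:R) / n%:R.

Let nC : n%:R != 0 :> C. Proof. by rewrite pnatr_eq0 -lt0n; lia. Qed.

Lemma torsion_point_inj ab cd : lattice tau (torsion_point ab - torsion_point cd) -> ab = cd.
Proof.
case: ab cd => [a b] [c d] [u [v /= e]].
have : (Posz a)%:~R * tau + (Posz b)%:~R = (Posz c + u * n)%:~R * tau + (Posz d + v * n)%:~R.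
  rewrite !(intrD, intrM).
  have -> : (Posz n)%:~R = n%:R :> C by [].
  have -> : (Posz c)%:~R = c%:R :> C by [].
  have -> : (Posz d)%:~R = d%:R :> C by [].
  have e' : a%:R * tau + b%:R = (u%:~R * tau + v%:~R) * n%:R + (c%:R * tau + d%:R).
    by rewrite -e /torsion_point /= mulrBl !divfK // subrK.
  by rewrite -[LHS]/(a%:R * tau + b%:R) e'; ring.
move=> /(lattice_coords_int ht)[e1 e2].
have small (i j : 'I_n) (w : int) : Posz i = Posz j + w * n -> i = j.
  move=> /(congr1 (fun x => (x %% n)%Z)); rewrite addrC modzMDl !modz_small ?ltz_nat ?ltn_ord //.
  by case=> /val_inj.
by rewrite (small _ _ _ e1) (small _ _ _ e2).
Qed.

Lemma torsion_point_exists y : exact_order tau n y ->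
  exists2 ab, ab \in primitive_pairs n & lattice tau (y - torsion_point ab).
Proof.
move=> ex; have [[A [B e]] _] := ex.
have n0 : (0 < n)%N by lia.
have nZ : (n : int) != 0 by rewrite -lt0n.
have rlt (a : int) : (`|(a %% n)%Z| < n)%N.
  by have := modz_ge0 a nZ; have := @ltz_pmod a n n0; lia.
have rE (a : int) : a = (a %/ n)%Z * n + `|(a %% n)%Z|%N.
  by rewrite gez0_abs ?modz_ge0 // -divz_eq.
pose ab := (Ordinal (rlt A), Ordinal (rlt B)).
have l : lattice tau (y - torsion_point ab).
  exists (A %/ n)%Z, (B %/ n)%Z; apply: (mulIf nC).
  rewrite mulrBl [y * _]mulr_natr e /torsion_point divfK // {1}(rE A) {1}(rE B) !(intrD, intrM).
  have -> : (Posz n)%:~R = n%:R :> C by [].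
  by rewrite /=; move: (`|(A %% n)%Z|%N) (`|(B %% n)%Z|%N) => a b; rewrite -![(Posz _)%:~R]/(_%:R); ring.
exists ab => //; rewrite inE /coprime; apply/eqP.
have ex' : exact_order tau n (torsion_point ab).
  by rewrite -[torsion_point ab](subKr y); apply: exact_orderD => //; apply: latticeN.
apply: (@exact_order_coprime _ tau n _ (Posz ab.1) (Posz ab.2) n0 ex').
by rewrite -mulr_natr divfK.
Qed.

(** The vanishing of the lower coefficients mentions no lifts, so a system has to be produced.
    [iota] is negation on primitive pairs, without fixed points because n >= 3. *)
Lemma inversion_orbit_lifts_exist : exists s, inversion_orbit_lifts tau n s.
Proof.
pose T := primitive_pairs n.
have exT ab : ab \in T -> exact_order tau n (torsion_point ab).
  by rewrite inE => co; exact: exact_order_div.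
have /choice[iota hiota] : forall ab, exists cd, ab \in T -> cd \in T /\ lattice tau (torsion_point ab + torsion_point cd).
  move=> ab; have [hab|_] := boolP (ab \in T); last by exists ab.
  have [cd hcd l] := torsion_point_exists (exact_orderN (exT _ hab)).
  by exists cd => _; split => //; move/latticeN: l; rewrite opprB opprK addrC.
have iotaK ab : ab \in T -> iota (iota ab) = ab.
  move=> hab; have [h1 l1] := hiota _ hab; have [h2 l2] := hiota _ h1.
  apply: torsion_point_inj; have := latticeB l2 l1.
  by congr lattice; ring.
have iota_neq ab : ab \in T -> iota ab != ab.
  move=> hab; apply/eqP => e; have [_] := hiota _ hab; rewrite e -mulr2n.
  by have [_ /(_ 2%N)] := exT _ hab; apply; lia.
(* The member of smaller rank represents each pair {ab, iota ab}. *)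
pose sel := [seq ab <- enum T | (enum_rank ab < enum_rank (iota ab))%N].
pose s := [seq torsion_point ab | ab <- sel].
have in_sel ab : (ab \in sel) = (enum_rank ab < enum_rank (iota ab))%N && (ab \in T).
  by rewrite mem_filter mem_enum.
have selT ab : ab \in sel -> ab \in T by rewrite in_sel => /andP[].
have sel_xor ab : ab \in T -> (ab \in sel) = ~~ (iota ab \in sel).
  move=> hab; have [h1 _] := hiota _ hab.
  rewrite !in_sel hab h1 !andbT iotaK // -leqNgt [RHS]leq_eqVlt.
  by rewrite (inj_eq (@ord_inj _)) (inj_eq enum_rank_inj) eq_sym (negbTE (iota_neq _ hab)).
have sel_uniq : uniq sel by rewrite filter_uniq // enum_uniq.
exists s; split; first by move=> x /mapP[ab /selT hab ->]; exact: exT.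
move=> y hy; have [ab hab yab] := torsion_point_exists hy.
have key cd : cd \in sel -> lattice tau (y - torsion_point cd) \/ lattice tau (y + torsion_point cd) ->
    cd = if ab \in sel then ab else iota ab.
  move=> hcd [l|l].
    have e : cd = ab.
      apply: torsion_point_inj; have := latticeB yab l; congr lattice; ring.
    by rewrite -e hcd.
  have hc := selT _ hcd.
  have e : cd = iota ab.
    have [h1 l1] := hiota _ hab; apply: torsion_point_inj.
    have := latticeB (latticeB l yab) l1; congr lattice; ring.
  by rewrite sel_xor // -e hcd.
pose cd := if ab \in sel then ab else iota ab.
have hcd : cd \in sel.
  rewrite /cd; case: ifP => // h.
  by have := sel_xor _ hab; rewrite h => /esym/negbFE.
have ycd : lattice tau (y - torsion_point cd) \/ lattice tau (y + torsion_point cd).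
  rewrite /cd; case: ifP => _; [by left | right].
  have [_ l1] := hiota _ hab; have := latticeD yab l1; congr lattice; ring.
have isz : (index cd sel < size s)%N by rewrite size_map index_mem.
have nths (i : 'I_(size s)) : s`_i = torsion_point (nth cd sel i).
  by rewrite (nth_map cd) //; apply: leq_trans (ltn_ord i) _; rewrite size_map.
exists (Ordinal isz); split; first by rewrite nths /= nth_index.
move=> j; rewrite nths => /key h; apply/val_inj => /=.
have js : (j < size sel)%N by apply: leq_trans (ltn_ord j) _; rewrite size_map.
have e : nth cd sel j = cd := h (mem_nth _ js).
by rewrite -[RHS](index_uniq cd js sel_uniq) e.
Qed.

End OrbitExistence.

(** * Division of a function of index m by a product of theta factors *)

Section ThetaQuotient.
Variable R : realType.
Local Notation C := R[i].
Variable tau : C.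
Hypothesis ht : upper_half_plane tau.
Local Notation P := (thetaP tau).

(** Incongruence guarantees that a factor already split off does not vanish at the remaining zeros,
    which are therefore inherited by the quotient. *)
Lemma theta_divide_seq (L : seq C) (f : C -> C) : lattice_distinct tau L -> (forall z, hol f z) ->
  (forall y l, y \in L -> lattice tau l -> f (y + l) = 0) ->
  exists2 g, (forall z, hol g z) & forall z, f z = g z * \prod_(y <- L) P (z - y).
Proof.
elim: L f => [|x L IH] f; first by move=> _ hf _; exists f => // z; rewrite big_nil mulr1.
move=> /= [hx hL] hf f0.
have [f1 hf1 f1E] := thetaP_division ht hf (fun l => f0 x l (mem_head _ _)).
have [|g hg gE] := IH f1 hL hf1.
  move=> y l yL ll; have := f0 y l; rewrite inE yL orbT => /(_ isT ll); rewrite f1E => /eqP.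
  by rewrite mulf_eq0 (negbTE (thetaP_div_lattice ht (hx y yL) ll)) orbF => /eqP.
by exists g => // z; rewrite f1E gE big_cons; ring.
Qed.

Lemma theta_mul_seq_eq0 (L : seq C) (u : C -> C) : (forall z, cont u z) ->
  (forall z, u z * \prod_(y <- L) P (z - y) = 0) -> forall z, u z = 0.
Proof.
elim: L u => [|x L IH] u hu h; first by move=> z; have := h z; rewrite big_nil mulr1.
apply: (@mul_thetaP_eq0 _ tau x u ht hu).
apply: IH => [z|z]; last by have := h z; rewrite big_cons mulrA.
apply: contM => //; apply: hol_cont; apply: (@hol_comp _ (fun z => z - x)); last exact: hol_thetaP.
by apply: holB; [exact: hol_id | exact: hol_cst].
Qed.

Definition theta_pairs (s : seq C) (z : C) : C := \prod_(x <- s) (P (z - x) * P (z + x)).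

Lemma theta_pairsE s z : theta_pairs s z = \prod_(y <- s ++ [seq - x | x <- s]) P (z - y).
Proof.
by rewrite big_cat big_map /= /theta_pairs big_split /=; congr (_ * _); apply: eq_bigr => x _; rewrite opprK.
Qed.

Lemma theta_pairsD1 s z : theta_pairs s (z + 1) = theta_pairs s z.
Proof.
apply: eq_bigr => x _.
by rewrite addrAC thetaPD1 [z + 1 + x]addrAC thetaPD1 mulrNN.
Qed.

(** The shifts by x and -x cancel in the multipliers, so a pair behaves exactly like a Jacobi form
    of index 1, whatever the lift x. *)
Lemma theta_pairsDtau s z : theta_pairs s (z + tau) * ce (2 * z + tau) ^+ size s = theta_pairs s z.
Proof.
rewrite /theta_pairs; elim: s => [|x s IH]; first by rewrite !big_nil expr0 mulr1.
rewrite !big_cons exprS mulrACA IH; congr (_ * _).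
rewrite [z + tau - x]addrAC [z + tau + x]addrAC !thetaPDtau // mulrNN.
have e : ce (- (tau / 2) - (z - x)) * ce (- (tau / 2) - (z + x)) * ce (2 * z + tau) = 1.
  by rewrite -!ceD -[RHS]ce0; congr ce; field.
apply: etrans (_ : (ce (- (tau / 2) - (z - x)) * ce (- (tau / 2) - (z + x)) * ce (2 * z + tau)) *
    (P (z - x) * P (z + x)) = _); [ring | by rewrite e mul1r].
Qed.

Section Quotient.
Variables (s : seq C) (f : C -> C) (m : nat).
Hypotheses (hs : lattice_distinct tau (s ++ [seq - x | x <- s])) (hf : forall z, hol f z).
Hypotheses (f0 : forall x l, x \in s -> lattice tau l -> f (x + l) = 0 /\ f (- x + l) = 0).
Hypotheses (f1 : forall z, f (z + 1) = f z) (ft : forall z, f (z + tau) * ce (2 * z + tau) ^+ m = f z).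

Let quotient : exists g, [/\ forall z, hol g z, forall z, f z = g z * theta_pairs s z,
  forall z, g (z + 1) = g z & forall z, g (z + tau) * ce (2 * z + tau) ^+ m = g z * ce (2 * z + tau) ^+ size s].
Proof.
have [|g hg gE] := theta_divide_seq hs hf.
  move=> y l; rewrite mem_cat => /orP[ys|/mapP[x xs ->]] ll; first by have [] := f0 ys ll.
  by have [] := f0 xs ll.
have {}gE z : f z = g z * theta_pairs s z by rewrite gE theta_pairsE.
have hshift l z : hol (fun z => g (z + l)) z.
  apply: (@hol_comp _ (fun z => z + l)) => //.
  by apply: holD; [exact: hol_id | exact: hol_cst].
have hE z : hol (fun z => ce (2 * z + tau)) z by exact: hol_ce_lin.
exists g; split => // z; apply/eqP; rewrite -subr_eq0; apply/eqP; move: z.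
  apply: (@theta_mul_seq_eq0 (s ++ [seq - x | x <- s])).
    by move=> z; apply: contB; apply: hol_cont.
  by move=> z; rewrite -theta_pairsE mulrBl -gE -theta_pairsD1 -gE f1 subrr.
apply: (@theta_mul_seq_eq0 (s ++ [seq - x | x <- s])).
  by move=> z; apply: hol_cont; apply: holB; apply: holM => //; apply: holX.
move=> z; rewrite -theta_pairsE mulrBl.
rewrite -{1}theta_pairsDtau.
have := ft z; rewrite !gE => e.
have -> : g (z + tau) * ce (2 * z + tau) ^+ m * (theta_pairs s (z + tau) * ce (2 * z + tau) ^+ size s) =
  (g (z + tau) * theta_pairs s (z + tau) * ce (2 * z + tau) ^+ m) * ce (2 * z + tau) ^+ size s by ring.
by rewrite e; ring.
Qed.

Lemma theta_quotient_const : m = size s -> exists c, forall z, f z = c * theta_pairs s z.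
Proof.
move=> ms; have [g [hg gE g1 gt]] := quotient; exists (g 0) => z.
rewrite gE (elliptic_const ht hg g1 _ z) // => w.
by have := gt w; rewrite ms => /(mulIf (expf_neq0 _ (ce_neq0 _))).
Qed.

Lemma theta_quotient_eq0 : (m < size s)%N -> forall z, f z = 0.
Proof.
move=> ms; have [g [hg gE g1 gt]] := quotient.
(* Two theta factors make up one unit of index, and the even exponent also removes the sign under z
   -> z + 1. *)
pose N := ((size s - m) + (size s - m))%N; pose H z := g z * P z ^+ N.
have hH z : hol H z by apply: holM => //; apply: holX; exact: hol_thetaP.
have H1 z : H (z + 1) = H z.
  by rewrite /H g1 thetaPD1 exprNn /N exprD -expr2 sqrr_sign mul1r.
have Ht z : H (z + tau) = H z.
  set E := ce (2 * z + tau); have E0 : E != 0 by exact: ce_neq0.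
  have e1 : g (z + tau) = g z * E ^+ (size s - m).
    apply: (mulIf (expf_neq0 m E0)); rewrite gt -mulrA -exprD subnK // ltnW //.
  have e2 : P (z + tau) ^+ N * E ^+ (size s - m) = P z ^+ N.
    rewrite /N !exprD -!exprMn thetaPDtau //; congr (_ ^+ _).
    have e : ce (- (tau / 2) - z) * ce (- (tau / 2) - z) * E = 1.
      by rewrite -!ceD -[RHS]ce0; congr ce; field.
    apply: etrans (_ : (ce (- (tau / 2) - z) * ce (- (tau / 2) - z) * E) * (P z * P z) = _); first ring.
    by rewrite e mul1r.
  by rewrite /H e1 -e2; ring.
have H0 z : g z * P z ^+ N = 0.
  have := elliptic_const ht hH H1 Ht z; rewrite /H => ->.
  have N0 : (0 < N)%N by rewrite addn_gt0 subn_gt0 ms.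
  by rewrite thetaP0 expr0n (gtn_eqF N0) mulr0.
have g0 z : g z = 0.
  apply: (@mul_thetaP_eq0 _ tau 0 g ht) => [w|w]; first exact: hol_cont.
  have := H0 w; rewrite subr0 => /eqP; rewrite mulf_eq0 => /orP[/eqP ->|]; first by rewrite mul0r.
  by rewrite expf_eq0 => /andP[_ /eqP ->]; rewrite mulr0.
by move=> z; rewrite gE g0 mul0r.
Qed.

End Quotient.
End ThetaQuotient.

(** * Vanishing below nu(n) and the product formula *)

Section FirstPart.
Variable R : realType.
Local Notation C := R[i].
Variables (n : nat) (k : int) (G : 'M[C]_2 -> C) (phi : nat -> C -> C -> C).
Hypotheses (n3 : (3 <= n)%N) (hG : exact_humbert_form (Posz (n ^ 2)%N) k G).
Hypothesis hphi : fourier_jacobi_expansion G phi.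
Local Notation g t1 z t2 := (G (siegel_point t1 z t2)).

Let hmod : siegel_modular_form k G. Proof. by case: hG. Qed.

Lemma humbert_torsion_eq0 t1 x t2 : exact_order t1 n x -> siegel_dom t1 x t2 -> g t1 x t2 = 0.
Proof.
move=> ex hd; have [[a [b e]] _] := ex; have n0 : (0 < n)%N by lia.
have co := exact_order_coprime n0 ex e.
have [_ hord _] := hG.
(* With n x = a t1 + b, this index has the equation a t1 - n x + b = 0 and discriminant n^2; it is
   primitive because the order of x is exactly n. *)
have [|h [_ hE _]] := hord a (- (n : int)) 0 0 b.
  split.
    rewrite /gcdz /= abszN !gcd0n !absz_nat; congr (Posz _).
    by rewrite gcdnA gcdnAC.
  by rewrite !mulr0 mul0r !subr0 -exprnP sqrrN -rmorphXn.
rewrite (hE _ (siegel_domP hd)).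
have -> : humbert_eqn a (- (n : int)) 0 0 b (siegel_point t1 x t2) = 0.
  rewrite /humbert_eqn !mxE /= mulrNz !mul0r !addr0.
  have -> : a%:~R * t1 + - (Posz n)%:~R * x + b%:~R = a%:~R * t1 + b%:~R - x * n%:R by rewrite -[(Posz n)%:~R]/(n%:R : C); ring.
  by rewrite mulr_natr e subrr.
by rewrite /humbert_ramification; case: ifP => _; rewrite ?expr1 ?expr2 !mul0r.
Qed.

Lemma phi_torsion_eq0 m t1 x : upper_half_plane t1 -> exact_order t1 n x -> phi m t1 x = 0.
Proof. by move=> ht ex; apply: (phi_eq0 hphi m ht) => t2; exact: humbert_torsion_eq0. Qed.

Let phi_zeros m t1 s : upper_half_plane t1 -> inversion_orbit_lifts t1 n s ->
  forall x l, x \in s -> lattice t1 l -> phi m t1 (x + l) = 0 /\ phi m t1 (- x + l) = 0.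
Proof.
move=> ht hs x l xs ll; have ex := hs.1 x xs.
by split; apply: phi_torsion_eq0 => //; apply: exact_orderD => //; exact: exact_orderN.
Qed.

(** Strong induction: holomorphy of [phi m] in z rests on the vanishing of all earlier
    coefficients. *)
Lemma phi_lt_nu m t1 z : (m < nu n)%N -> upper_half_plane t1 -> phi m t1 z = 0.
Proof.
move=> mn ht; have [s hs] := inversion_orbit_lifts_exist ht n3.
elim/ltn_ind: m mn z => m IH mn z.
apply: (@theta_quotient_eq0 _ t1 ht s (phi m t1) m (orbit_distinct n3 hs)).
- move=> w; apply: (phi_hol hmod hphi _ ht) => j v jm; apply: IH => //.
  exact: ltn_trans mn.
- exact: phi_zeros.
- by move=> w; exact: (phi_period1 hmod hphi _ _ ht).
- by move=> w; exact: (phi_shear hmod hphi _ _ ht).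
by rewrite (orbit_size ht n3 hs).
Qed.

Lemma hol_phi_nu t1 z : upper_half_plane t1 -> hol (phi (nu n) t1) z.
Proof.
by move=> ht; apply: (phi_hol hmod hphi _ ht) => j w jn; exact: phi_lt_nu.
Qed.

Lemma phi_nu_theta_pairs t1 s : upper_half_plane t1 -> inversion_orbit_lifts t1 n s ->
  exists c, forall z, phi (nu n) t1 z = c * theta_pairs t1 s z.
Proof.
move=> ht hs; apply: (@theta_quotient_const _ t1 ht s (phi (nu n) t1) (nu n) (orbit_distinct n3 hs)).
- by move=> w; exact: hol_phi_nu.
- exact: phi_zeros.
- by move=> w; exact: (phi_period1 hmod hphi _ _ ht).
- by move=> w; exact: (phi_shear hmod hphi _ _ ht).
by rewrite (orbit_size ht n3 hs).
Qed.

Lemma thetaP_exact_order (t1 x : C) : upper_half_plane t1 -> exact_order t1 n x -> thetaP t1 x != 0.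
Proof.
move=> ht [_ /(_ 1%N)]; rewrite mulr1n => h; apply/eqP => /(thetaP_eq0 ht); apply: h; lia.
Qed.

Lemma theta_pairs0_neq0 (t1 : C) s : upper_half_plane t1 -> inversion_orbit_lifts t1 n s ->
  theta_pairs t1 s 0 != 0.
Proof.
move=> ht hs; rewrite /theta_pairs prodf_seq_neq0; apply/allP => x xs /=.
have px := thetaP_exact_order ht (hs.1 x xs).
by rewrite sub0r add0r thetaPN mulf_neq0 ?oppr_eq0.
Qed.

Lemma phi_nu0_neq0 t1 : generic (phi (nu n)) t1 -> phi (nu n) t1 0 != 0.
Proof.
move=> [ht [z hz]]; have [s hs] := inversion_orbit_lifts_exist ht n3.
have [c cE] := phi_nu_theta_pairs ht hs.
rewrite cE mulf_neq0 ?(theta_pairs0_neq0 ht hs) //.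
by apply: contraNneq hz => c0; rewrite cE c0 mul0r.
Qed.

(** Normalization at z = 0, where oddness turns a pair into [- thetaP t1 x ^+ 2]; this is the origin
    of the sign in the denominators. *)
Lemma phi_nu_product t1 s z : upper_half_plane t1 -> inversion_orbit_lifts t1 n s ->
  phi (nu n) t1 z = phi (nu n) t1 0 *
    \prod_(x <- s) (theta11 t1 (z - x) * theta11 t1 (z + x) / - (theta11 t1 x ^+ 2)).
Proof.
move=> ht hs; have [c cE] := phi_nu_theta_pairs ht hs.
have [d d0 dE] := theta11_thetaP ht.
rewrite !cE -mulrA; congr (_ * _); rewrite /theta_pairs -big_split /= !big_seq.
apply: eq_bigr => x xs; have px := thetaP_exact_order ht (hs.1 x xs).
by rewrite !dE sub0r add0r thetaPN; field; rewrite d0 px.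
Qed.

End FirstPart.

(** * The value at z = 0 *)

Section UnitDisc.
Variable R : realType.
Local Notation C := R[i].
Implicit Types (z q t : C).

(** The Cauchy bound is applied to 1 / f_j. On a circle H is bounded away from 0, so 1 / f_j is
    bounded there and hence at the centre, which is incompatible with f_j(c) tending to 0. *)
Lemma hurwitz (f : nat -> C -> C) (H : C -> C) (c : C) (rho : R) : 0 < rho ->
  (forall j z, cabs (z - c) < rho -> hol (f j) z) -> (forall z, cabs (z - c) < rho -> hol H z) ->
  (forall e : R, 0 < e -> exists N, forall j z, (N <= j)%N -> cabs (z - c) < rho -> cabs (f j z - H z) <= e) ->
  (exists N, forall j z, (N <= j)%N -> cabs (z - c) < rho -> f j z != 0) ->
  (forall z, 0 < cabs (z - c) < rho -> H z != 0) -> H c != 0.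
Proof.
move=> rho0 hf hH lim [N0 nz] Hnz; pose r := rho / 2.
have r0 : 0 < r by rewrite /r; lra.
have rr : r < rho by rewrite /r; lra.
have circle z : cabs z = r -> cabs (c + z - c) = r by rewrite addrC addKr.
have [B B0 hB] := @circ_bounded _ (fun z => (H (c + z))^-1) r (ltW r0) ltac:(
  move=> z hz; apply: hol_cont; apply: holV;
  [apply/hol_shift; apply: hH; rewrite circle | apply: Hnz; rewrite circle // r0]; lra).
(* [2 * e] is a lower bound for |H| on the circle, so an error of [e / 2] leaves |f_j| >= e there
   and, by the Cauchy bound, at [c]. *)
apply/eqP => Hc; pose e := (2 * (B + 1))^-1.
have e0 : 0 < e by rewrite invr_gt0; lra.
have [N hN] := lim (e / 2) ltac:(lra); pose j := maxn N N0.
have jN : (N <= j)%N by rewrite leq_maxl.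
have fj z : cabs (z - c) < rho -> f j z != 0 by apply: nz; rewrite leq_maxr.
have := @cauchy_bound _ (fun z => (f j z)^-1) c rho r (2 * (B + 1)) c.
rewrite subrr cabs0 subr0 => /(_ _ rr r0) h.
have cc : cabs (c - c) < rho by rewrite subrr cabs0.
have {h} h := h (fun z hz => holV (hf j z hz) (fj z hz)) _.
have /h : forall z, cabs (z - c) = r -> cabs (f j z)^-1 <= 2 * (B + 1).
  move=> z hz; rewrite cabsV.
  have zr : cabs (z - c) < rho by rewrite hz.
  have h1 := hN j z jN zr.
  have h2 := hB (z - c) hz; rewrite (addrC c) subrK cabsV in h2.
  have Hz : 0 < cabs (H z) by rewrite cabs_gt0; apply: Hnz; rewrite hz r0.
  have h3 : (B + 1)^-1 <= cabs (H z).
    by rewrite -[X in _ <= X]invrK lef_pV2 ?posrE ?invr_gt0 //; lra.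
  have h4 := cabs_subl (H z) (H z - f j z).
  have e1 : H z - (H z - f j z) = f j z by ring.
  rewrite e1 (cabsB (H z)) in h4.
  have e2 : e = (B + 1)^-1 / 2 by rewrite /e; field; rewrite gt_eqF //; lra.
  have h5 : e <= cabs (f j z) by have : 0 < (B + 1)^-1 by [rewrite invr_gt0; lra]; lra.
  by rewrite -[2 * _]invrK -/e lef_pV2 ?posrE //; lra.
rewrite mulfK ?gt_eqF // cabsV => h6.
have := hN j c jN cc; rewrite Hc subr0 => h7.
have fc : 0 < cabs (f j c) by rewrite cabs_gt0; apply: fj.
have : e <= cabs (f j c).
  by rewrite -[X in _ <= X]invrK lef_pV2 ?posrE ?invr_gt0 //; lra.
lra.
Qed.

(** Below height 1/2, after translating to |Re t| <= 1/2, one has |t|^2 <= 1/2, so inversion at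
    least doubles the imaginary part. The induction counts the doublings. *)
Lemma upper_reduction t : upper_half_plane t -> forall (V : C -> C),
  (forall t, upper_half_plane t -> V (ce (- t^-1)) = V (ce t)) ->
  exists t', 1 / 2 <= complex.Im t' /\ V (ce t) = V (ce t').
Proof.
move=> ht V hV.
have main (j : nat) : forall u, pow2 j.+1 <= complex.Im u -> exists t', 1 / 2 <= complex.Im t' /\ V (ce u) = V (ce t').
  elim: j => [|j IH] u htj.
    by exists u; split => //; move: htj; rewrite /pow2 expr1; lra.
  pose m := Num.floor (complex.Re u + 1 / 2); pose t1 := u + (- m)%:~R.
  have i1 : complex.Im t1 = complex.Im u.
    by rewrite /t1 raddfD /= intC /= addr0.
  have r1 : complex.Re t1 = complex.Re u - m%:~R.
    by rewrite /t1 raddfD /= intC /= mulrNz.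
  have r2 : `|complex.Re t1| <= 1 / 2.
    have := floor_itv (complex.Re u + 1 / 2); rewrite -/m intrD r1 ler_norml => /andP[? ?].
    by apply/andP; split; lra.
  have e1 : V (ce u) = V (ce t1) by rewrite /t1 ceDint.
  have [big|small] := leP (1 / 2) (complex.Im t1); first by exists t1.
  have y0 : 0 < complex.Im t1 by rewrite i1; apply: lt_le_trans htj; apply: pow2_gt0.
  have [|t' [ht' e2]] := IH (- t1^-1); last first.
    by exists t'; split => //; rewrite e1 -e2 hV.
  have yE : complex.Im (- t1^-1) = complex.Im t1 / (complex.Re t1 ^+ 2 + complex.Im t1 ^+ 2).
    by case: (t1) => a b /=; rewrite -[X in - X]mulNr ?mulNr opprK.
  have d0 : 0 < complex.Re t1 ^+ 2 + complex.Im t1 ^+ 2.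
    by rewrite ltr_wpDl ?sqr_ge0 // exprn_gt0.
  rewrite yE ler_pdivlMr //.
  have h1 : complex.Re t1 ^+ 2 + complex.Im t1 ^+ 2 <= 1 / 2.
    have : complex.Re t1 ^+ 2 <= 1 / 4.
      rewrite -real_normK ?num_real // (_ : 1 / 4 = (1 / 2) ^+ 2); last by field.
      by apply: lerXn2r; rewrite ?nnegrE.
    have : complex.Im t1 ^+ 2 <= 1 / 4.
      by rewrite (_ : 1 / 4 = (1 / 2) ^+ 2); [apply: lerXn2r; rewrite ?nnegrE ?ltW | field].
    lra.
  have := pow2_gt0 R j.+1; rewrite -i1 in htj; move: htj; rewrite (pow2S R j.+1).
  nra.
have [j hj] := pow2_small ht.
by apply: (main j); apply: ltW; apply: le_lt_trans hj; apply: pow2_le.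
Qed.

(** Height at least 1/2 means |q| <= e^(-pi) <= 1/4, so by invariance every value of V off q = 0 is
    taken there. [schwarz_weak] halves any global bound on that smaller disc, hence globally, and
    iteration forces V = 0. The first bound comes from the circle of radius 1/2. *)
Lemma modular_const (U : C -> C) : (forall q, cabs q < 1 -> hol U q) ->
  (forall t, upper_half_plane t -> U (ce (- t^-1)) = U (ce t)) ->
  forall q, cabs q < 1 -> U q = U 0.
Proof.
move=> hU hinv; pose V q := U q - U 0.
have hV q : cabs q < 1 -> hol V q by move=> hq; apply: holB; [exact: hU | exact: hol_cst].
have V0 : V 0 = 0 by rewrite /V subrr.
have invV t : upper_half_plane t -> V (ce (- t^-1)) = V (ce t) by move=> ht; rewrite /V hinv.
have red (B : R) : (forall q, cabs q <= 1 / 4 -> cabs (V q) <= B) -> forall q, cabs q < 1 -> cabs (V q) <= B.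
  move=> hB q q1; have [->|q0] := eqVneq q 0; first by apply: hB; rewrite cabs0; lra.
  have [t tq] := ce_surj q0; have ht : upper_half_plane t by rewrite -tq cabs_ce_lt1 in q1.
  have [t' [ht' e]] := upper_reduction ht invV.
  rewrite -tq e; apply: hB; rewrite cabs_ce.
  have p2 := @pi_ge2 R.
  have : expR (- (2 * pi * complex.Im t')) <= expR (- 2) :> R.
    by rewrite ler_expR lerN2; nra.
  move=> h; apply: (le_trans h); rewrite expRN.
  have -> : 1 / 4 = (2 ^+ 2)^-1 :> R by field.
  rewrite lef_pV2 ?posrE ?expR_gt0 ?exprn_gt0 //.
  have -> : expR 2 = expR 1 ^+ 2 :> R by rewrite -expRM_natr mul1r.
  apply: lerXn2r; rewrite ?nnegrE ?expR_ge0 //.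
  by have := expR_ge1Dx (1 : R); lra.
have [B B0 hB] := @circ_bounded _ V (1 / 2) ltac:(lra) ltac:(move=> z hz; apply: hol_cont; apply: hV; lra).
have bound0 : forall q, cabs q < 1 -> cabs (V q) <= 2 * B.
  apply: red => q hq.
  apply: (le_trans (cauchy_bound0 hV _ _ hB)); try lra.
  rewrite ler_pdivrMr; last by lra.
  nra.
have bound k : forall q, cabs q < 1 -> cabs (V q) <= 2 * B * pow2 k.
  elim: k => [|k IH]; first by rewrite /pow2 expr0 mulr1.
  apply: red => q hq; have := schwarz_weak hV V0 IH hq.
  by rewrite (pow2S R k); lra.
move=> q q1; apply/eqP; rewrite -subr_eq0; apply/eqP; apply: cabs_small => e e0.
have [k hk] := pow2_small (ltac:(rewrite divr_gt0 //; lra) : 0 < e / (2 * B + 1)).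
apply: (le_trans (bound k q q1)); move: hk; rewrite ltr_pdivlMr; last lra.
by have := pow2_gt0 R k; nra.
Qed.

Lemma hol_exprz (f : C -> C) z (k : int) : hol f z -> f z != 0 -> hol (fun w => f w ^ k) z.
Proof.
move=> hf fz; case: k => k; first exact: holX.
by apply: holV; [exact: holX | rewrite expf_neq0].
Qed.

(* the valence formula for modular forms without zeros, by applying the maximum principle
   to h^12 / Delta^k or its inverse *)
Lemma modular_nonvanishing (h H : C -> C) (k : int) : (forall q, cabs q < 1 -> hol H q) ->
  (forall t, upper_half_plane t -> H (ce t) = h t) ->
  (forall t, upper_half_plane t -> h t != 0) ->
  (forall t, upper_half_plane t -> h (- t^-1) = t ^ k * h t) ->
  exists2 c, c != 0 & forall t, upper_half_plane t -> h t = c * Delta t ^ (k %/ 12)%Z.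
Proof.
move=> hH Hh h0 hk.
have i0 : upper_half_plane ('i%C : C) by rewrite /upper_half_plane /= ltr01.
have [|[N [K [hK K0 HK]]]] := zero_order (c := 0) (rho := 1) (f := H) ltac:(move=> z; rewrite subr0; exact: hH) ltr01.
  move=> z; have := z (ce 'i%C); rewrite subr0 upper_lt1 // => /(_ isT).
  by rewrite Hh // => /eqP; rewrite (negbTE (h0 _ i0)).
have {}hK q : cabs q < 1 -> hol K q by move=> q1; apply: hK; rewrite subr0.
have {}HK q : H q = q ^+ N * K q by rewrite HK subr0.
have Knz q : cabs q < 1 -> K q != 0.
  move=> q1; have [->//|q0] := eqVneq q 0; have [t tq] := ce_surj q0.
  have ht : upper_half_plane t by rewrite -tq cabs_ce_lt1 in q1.
  by have := h0 t ht; rewrite -Hh // tq HK mulf_eq0 negb_or => /andP[].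
pose D q : C := qprod q 1 ^+ 24.
have hD q : cabs q < 1 -> hol D q by move=> q1; apply: holX; exact: hol_qprod_q.
have Dnz q : cabs q < 1 -> D q != 0 by move=> q1; rewrite expf_neq0 // qprod1_neq0.
have DE t : upper_half_plane t -> Delta t = ce t * D (ce t) by move=> ht; rewrite DeltaE.
have Dinv t : upper_half_plane t -> Delta (- t^-1) = t ^+ 12 * Delta t by exact: Delta_inversion.
have Dnz' t : upper_half_plane t -> Delta t != 0.
  by move=> ht; rewrite DE // mulf_neq0 ?ce_neq0 ?Dnz ?upper_lt1.
clearbody D; move: (@Delta R) DE Dinv Dnz' => E DE Dinv Dnz'.
pose w t := h t ^+ 12 * E t ^ (- k).
have w_nz t : upper_half_plane t -> w t != 0.
  by move=> ht; rewrite mulf_neq0 ?expf_neq0 ?h0 // expfz_neq0 // Dnz'.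
have w_inv t : upper_half_plane t -> w (- t^-1) = w t.
  move=> ht; rewrite /w (hk t ht) (Dinv t ht).
  have t0 := upper_neq0 ht; move: (h t) (E t) (Dnz' t ht) => b d d0.
  rewrite exprMn exprzMl ?unitfE ?expf_neq0 //.
  rewrite mulrACA.
  have -> : (t ^ k) ^+ 12 * (t ^+ 12) ^ (- k) = 1; last by rewrite mul1r.
  by rewrite !exprnP !exprz_exp mulrN (mulrC k) -expfzDr // subrr expr0z.
(* The order at q = 0 of the invariant quotient [w]; the cofactor [M] has neither zeros nor poles in
   the unit disc. *)
pose a : int := 12%:Z * N - k.
pose M q := K q ^+ 12 * D q ^ (- k).
have wE t : upper_half_plane t -> w t = ce t ^ a * M (ce t).
  move=> ht; rewrite /w /M /a DE // -Hh // HK.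
  have c0 := ce_neq0 t; have := Dnz _ (upper_lt1 ht).
  move: (ce t) (K (ce t)) (D (ce t)) c0 => q b d q0 d0.
  rewrite exprMn exprzMl ?unitfE // mulrACA expfzDr //; congr (_ * _ * _).
  by rewrite -exprM mulnC exprnP PoszM.
have hM q : cabs q < 1 -> hol M q.
  move=> q1; apply: holM; first by apply: holX; exact: hK.
  by apply: hol_exprz; [exact: hD | exact: Dnz].
have Mnz q : cabs q < 1 -> M q != 0.
  by move=> q1; rewrite mulf_neq0 ?expf_neq0 ?Knz // expfz_neq0 // Dnz.
clearbody M.
have kN : k = 12%:Z * N.
  have [a0|a0|a0] := ltrgtP a 0; last by move: a0; rewrite /a => /eqP; rewrite subr_eq0 => /eqP.
  - exfalso; pose b := `|a|%N.
    have ab : a = - (b : int) by rewrite /b; lia.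
    have b0 : (0 < b)%N by rewrite /b; lia.
    pose U q := q ^+ b * (M q)^-1.
    have UE t : upper_half_plane t -> U (ce t) = (w t)^-1.
      by move=> ht; rewrite /U wE // ab -invr_expz invfM invrK.
    have U0 : U 0 = 0 by rewrite /U expr0n gtn_eqF //= mul0r.
    have : U (ce 'i%C) = U 0; last by rewrite UE // U0 => /eqP; rewrite invr_eq0 (negbTE (w_nz _ i0)).
    apply: modular_const; last by rewrite upper_lt1.
      move=> q q1; apply: holM; first by apply: holX; exact: hol_id.
      by apply: holV; [exact: hM | exact: Mnz].
    by move=> t ht; rewrite !UE ?w_inv //; exact: upper_inv.
  exfalso; pose b := `|a|%N.
  have ab : a = (b : int) by rewrite /b; lia.
  have b0 : (0 < b)%N by rewrite /b; lia.
  pose U q := q ^+ b * M q.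
  have UE t : upper_half_plane t -> U (ce t) = w t by move=> ht; rewrite /U wE // ab.
  have U0 : U 0 = 0 by rewrite /U expr0n gtn_eqF //= mul0r.
  have : U (ce 'i%C) = U 0; last by rewrite UE // U0 => /eqP; rewrite (negbTE (w_nz _ i0)).
  apply: modular_const; last by rewrite upper_lt1.
    move=> q q1; apply: holM; first by apply: holX; exact: hol_id.
    exact: hM.
  by move=> t ht; rewrite !UE ?w_inv //; exact: upper_inv.
have kdiv : (k %/ 12)%Z = N by rewrite kN mulKz.
pose W q := K q / D q ^+ N.
have hW q : cabs q < 1 -> hol W q.
  move=> q1; apply: holM; first exact: hK.
  by apply: holV; [apply: holX; exact: hD | rewrite expf_neq0 ?Dnz].
have WE t : upper_half_plane t -> W (ce t) = h t / E t ^+ N.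
  move=> ht; rewrite /W -Hh // HK DE //; have := ce_neq0 t; move: (ce t) => q q0.
  by rewrite exprMn -mulf_div divff ?mul1r // expf_neq0.
exists (W 0); first by rewrite /W mulf_neq0 ?invr_neq0 ?expf_neq0 ?Knz ?Dnz // cabs0 ltr01.
move=> t ht; rewrite kdiv -exprnP -(modular_const hW _ (upper_lt1 ht)).
  by rewrite WE // divfK // expf_neq0 ?Dnz'.
move=> t' ht'; have t0 := upper_neq0 ht'; rewrite !WE ?hk ?Dinv //; last exact: upper_inv.
by rewrite exprMn kN -mulf_div -exprM exprnP PoszM divff ?mul1r // expfz_neq0.
Qed.

End UnitDisc.

#[local] Opaque Delta.

(** * The value at z = 0 as a power of the discriminant *)

Section SecondPart.
Variable R : realType.
Local Notation C := R[i].
Variables (n : nat) (k : int) (G : 'M[C]_2 -> C) (phi : nat -> C -> C -> C).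
Hypotheses (n3 : (3 <= n)%N) (hG : exact_humbert_form (Posz (n ^ 2)%N) k G).
Hypothesis hphi : fourier_jacobi_expansion G phi.
Local Notation g t1 z t2 := (G (siegel_point t1 z t2)).

Let hmod : siegel_modular_form k G. Proof. by case: hG. Qed.

Lemma siegel_dom0 (t1 t2 : C) : upper_half_plane t1 -> upper_half_plane t2 -> siegel_dom t1 0 t2.
Proof. by move=> h1 h2; split => //=; rewrite expr0n mulr_gt0. Qed.

Lemma q1_expansion (t2 : C) : upper_half_plane t2 -> exists2 F : C -> C,
  (forall q, cabs q < 1 -> hol F q) & forall t1, upper_half_plane t1 -> F (ce t1) = g t1 0 t2.
Proof.
move=> h2; have [|F [hF _] FE] := @power_series_hol _ (fun m => phi m t2 0) 1 ltr01.
  move=> q /andP[]; rewrite cabs_gt0 => /ce_surj[t <-].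
  by rewrite cabs_ce_lt1 => ht; exists (g t2 0 t); apply: (fj_clim hphi); exact: siegel_dom0.
exists (fun q => (-1) ^ k * F q) => [q q1|t1 h1].
  by apply: holM; [exact: hol_cst | exact: hF].
rewrite (siegel_swap hmod (siegel_dom0 h2 h1)); congr (_ * _).
by apply: clim_unique (FE _ (upper_lt1 h1)) _; apply: (fj_clim hphi); exact: siegel_dom0.
Qed.

(* On the locus z = 0, Re t2 = 0 the equation of a Humbert surface forces
   n^2 = b^2 + 4 (d x - c)^2 y / v + 4 d^2 v y, where t1 = x + i v and t2 = i y *)
Lemma humbert_neq0 (t1 : C) (y : R) : upper_half_plane t1 -> 0 < y ->
  n%:R ^+ 2 < 4 * complex.Im t1 * y -> n%:R ^+ 2 * complex.Im t1 < 4 * y -> g t1 0 (0 +i* y) != 0.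
Proof.
case: t1 => x v; rewrite /upper_half_plane /= => v0 y0 h1 h2; apply/eqP => g0.
have hd : siegel_dom (x +i* v) 0 (0 +i* y) by apply: siegel_dom0.
have [_ _ /(_ _ (siegel_domP hd) g0)[a [b [c [d [e [[gcd1 disc] eqn]]]]]]] := hG.
have [reE imE] : a%:~R * x + d%:~R * (v * y) + e%:~R = 0 :> R /\ a%:~R * v + c%:~R * y - d%:~R * x * y = 0 :> R.
  move: eqn; rewrite /humbert_eqn !mxE /= -!(rmorph_int (real_complex R)) => /eqP.
  rewrite eq_complex /= => /andP[/eqP e1 /eqP e2].
  by split; [rewrite -e1 | rewrite -e2]; ring.
have discR : b%:~R ^+ 2 - 4 * a%:~R * c%:~R - 4 * d%:~R * e%:~R = n%:R ^+ 2 :> R.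
  have /(congr1 (fun m : int => m%:~R : R)) := disc.
  rewrite -[b ^ 2]/(b ^+ 2) !rmorphB rmorphXn !rmorphM /= => ->.
  by rewrite expr2.
have eE : e%:~R = - a%:~R * x - d%:~R * (v * y) :> R by lra.
have avE : a%:~R * v = (d%:~R * x - c%:~R) * y :> R by lra.
have key : n%:R ^+ 2 * v = b%:~R ^+ 2 * v + 4 * (d%:~R * x - c%:~R) ^+ 2 * y + 4 * d%:~R ^+ 2 * (v * y) * v :> R.
  rewrite -discR eE.
  have -> : (b%:~R ^+ 2 - 4 * a%:~R * c%:~R - 4 * d%:~R * (- a%:~R * x - d%:~R * (v * y))) * v =
    b%:~R ^+ 2 * v + 4 * (d%:~R * x - c%:~R) * (a%:~R * v) + 4 * d%:~R ^+ 2 * (v * y) * v :> R by ring.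
  by rewrite avE; ring.
have sq (m : int) : m != 0 -> 1 <= m%:~R ^+ 2 :> R.
  move=> m0; rewrite -rmorphXn /= -[1]/(1%:~R) ler_int; lia.
have b2 : 0 <= b%:~R ^+ 2 * v :> R by rewrite mulr_ge0 ?sqr_ge0 // ltW.
have vy : 0 < v * y * v by rewrite !mulr_gt0.
(* In [key] a non-zero d contributes at least 4 v y v, more than n^2 v by the first size condition;
   the second condition then excludes a non-zero c. *)
have d0 : d = 0.
  apply/eqP; apply: contraTT isT => /sq d1.
  have : 0 <= (d%:~R * x - c%:~R) ^+ 2 * y :> R by rewrite mulr_ge0 ?sqr_ge0 // ltW.
  have : n%:R ^+ 2 * v < 4 * v * y * v by rewrite ltr_pM2r.
  by nra.
have c0 : c = 0.
  apply/eqP; apply: contraTT isT => /sq c1; move: key; rewrite d0 mul0r sub0r sqrrN expr0n /= => key.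
  have : 1 * y <= c%:~R ^+ 2 * y by rewrite ler_wpM2r // ltW.
  by nra.
have a0 : a = 0.
  move: avE; rewrite d0 c0 mul0r subrr mul0r => /eqP; rewrite mulf_eq0 (gt_eqF v0) orbF intr_eq0 => /eqP //.
have e0 : e = 0.
  by apply/eqP; rewrite -(intr_eq0 R) eE a0 d0 !mulr0z oppr0 !mul0r subrr.
(* Only (0, b, 0, 0, 0) is left: primitivity gives |b| = 1, while b^2 = n^2. *)
move: disc gcd1; rewrite a0 c0 d0 e0 !mulr0 !subr0 /gcdz /= !gcdn0 ?gcd0n.
by rewrite -[b ^ 2]/(b * b) => /(congr1 absz); rewrite abszM => + [b1]; rewrite b1 /=; nia.
Qed.

Lemma exp_level (l : R) : 0 < l -> exists y : R, expR (- (2 * pi * y)) = l.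
Proof.
move=> l0; exists (- ln l / (2 * pi)); have p0 : 2 * pi != 0 :> R by rewrite mulf_neq0 ?pnatr_eq0 // gt_eqF // pi_gt0.
by rewrite mulrC divfK // opprK lnK.
Qed.

(** Points on the imaginary axis tending to the cusp, in the form of [leading_coeff_shift] for y =
    1. *)
Let s (j : nat) : C := 0 +i* (1 + j.+1%:R).
Let scaled j t : C := ce (- ((nu n)%:R * s j)) * g t 0 (s j).

Let s_upper j : upper_half_plane (s j).
Proof. by rewrite /upper_half_plane /= addr_gt0. Qed.

(** Uniformity on all of |q1| <= r, where Im t1 is unbounded: for t2 on the segment at height 1, G
    is holomorphic in q1, and a Cauchy bound reduces the estimate to the circle |q1| = r', that is,
    to a compact set of pairs (t1, t2). *)
Lemma scaled_bound (r : R) : r < 1 -> exists2 K : R, 0 <= K & forall j t,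
  upper_half_plane t -> cabs (ce t) <= r -> cabs (scaled j t - phi (nu n) t 0) <= K / j.+1%:R.
Proof.
move=> r1; have [r0|r0] := ltP r 0.
  by exists 0 => // j t _; have := cabs_ge0 (ce t); lra.
pose r' := (1 + r) / 2; have [r'0 rr' r'1] : [/\ 0 < r', r < r' & r' < 1] by rewrite /r'; split; lra.
have [Y hY] := exp_level r'0.
have Y0 : 0 < Y.
  by move: r'1; rewrite -hY expR_lt1 oppr_lt0 pmulr_rgt0 // mulr_gt0 // pi_gt0.
have upY (x : R) : upper_half_plane (x +i* Y) by [].
have up1 (x : R) : upper_half_plane (x +i* 1) by exact: ltr01.
have [|B hB] := @box_bounded _ (fun a _ x : R => g (a +i* Y) 0 (x +i* 1)).
  move=> a b x _ _ _; have [d d0 hd] := siegel_cont hmod (siegel_dom0 (upY a) (up1 x)) ltr01.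
  exists (cabs (g (a +i* Y) 0 (x +i* 1)) + 1); exists d => // a' b' x' ha' _ hx'.
  have dist (u v w : R) : cabs ((u +i* w) - (v +i* w)) = `|u - v|.
    by rewrite -cabs_real; congr cabs; apply/eqP; rewrite eq_complex /= subrr !eqxx.
  have := hd (a' +i* Y) 0 (x' +i* 1); rewrite subrr cabs0 !dist => /(_ ha' d0 hx').
  by have := cabs_subl (g (a' +i* Y) 0 (x' +i* 1)) (g (a +i* Y) 0 (x +i* 1)); lra.
have B0 : 0 <= B by apply: le_trans (hB 0 0 0 _ _ _); rewrite ?cabs_ge0 ?lexx ?ler01.
pose B' := B * r' / (r' - r).
have B'0 : 0 <= B' by rewrite divr_ge0 ?mulr_ge0 //; lra.
exists (B' * expR (2 * pi * 1) ^+ nu n); first by rewrite mulr_ge0 ?exprn_ge0 ?expR_ge0.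
move=> j t ht tr.
apply: (leading_coeff_shift hphi) => //; last first.
- move=> x hx; have [F hF FE] := q1_expansion (up1 x).
  rewrite -FE //; apply: (le_trans (cauchy_bound0 (r := r') (B := B) hF r'1 (le_lt_trans tr rr') _)).
    move=> q hq; rewrite -hY in hq; have [a ha <-] := ce_horizontal hq.
    by rewrite (FE _ (upY a)); apply: (hB a 0 x ha _ hx); rewrite lexx ler01.
  rewrite /B'; apply: ler_wpM2l; first by rewrite mulr_ge0 // ltW.
  by rewrite lef_pV2 ?posrE //; lra.
- exact: siegel_dom0.
by move=> i hi; apply: (phi_lt_nu n3 hG hphi).
Qed.

Lemma scaled_clim t : upper_half_plane t -> clim (scaled^~ t) (phi (nu n) t 0).
Proof.
move=> ht e e0; have [K K0 hK] := scaled_bound (upper_lt1 ht).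
have [N hN] : exists N : nat, K / e < N%:R by exists (Num.truncn (K / e)).+1; apply: truncnS_gt.
exists N => j Nj; apply: (le_lt_trans (hK j t ht (lexx _))).
have Nj' : (N%:R : R) <= j.+1%:R by rewrite ler_nat; lia.
rewrite ltr_pdivrMr //; move: hN; rewrite ltr_pdivrMr // => hN; nra.
Qed.

Lemma phi_nu0_inversion t : upper_half_plane t -> phi (nu n) (- t^-1) 0 = t ^ k * phi (nu n) t 0.
Proof.
move=> ht; apply: clim_unique (scaled_clim (upper_inv ht)) _.
apply: clim_ext (climMl (t ^ k) (scaled_clim ht)) _ => j.
by rewrite /scaled (siegel_inversion hmod (siegel_dom0 ht (s_upper j))) mulrCA.
Qed.

Lemma scaled_expansion : exists2 F : nat -> C -> C, (forall j q, cabs q < 1 -> hol (F j) q) &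
  forall j t, upper_half_plane t -> F j (ce t) = scaled j t.
Proof.
have /choice[F hF] : forall j, exists F : C -> C, (forall q, cabs q < 1 -> hol F q) /\
    forall t, upper_half_plane t -> F (ce t) = scaled j t.
  move=> j; have [F hF FE] := q1_expansion (s_upper j).
  exists (fun q => ce (- ((nu n)%:R * s j)) * F q); split => [q q1|t ht]; last by rewrite FE.
  by apply: holM; [exact: hol_cst | exact: hF].
by exists F => j; have [] := hF j.
Qed.

Let bound_small (K e : R) : 0 <= K -> 0 < e -> exists N : nat, forall j, (N <= j)%N -> K / j.+1%:R <= e.
Proof.
move=> K0 e0; exists (Num.truncn (K / e)).+1 => j hj.
have hN : K / e < j.+1%:R.
  by apply: (lt_le_trans (truncnS_gt _)); rewrite ler_nat (leq_trans hj).
by rewrite ler_pdivrMr // mulrC -ler_pdivrMr // ltW.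
Qed.

(** The uniform estimates concern q1 non-zero, so the singularity of the limit at q1 = 0 has to be
    removed. *)
Lemma phi_nu0_expansion : exists2 H : C -> C, (forall q, cabs q < 1 -> hol H q) &
  forall t, upper_half_plane t -> H (ce t) = phi (nu n) t 0.
Proof.
have [F hF FE] := scaled_expansion.
have /choice[L hL] : forall q, exists l, 0 < cabs q < 1 -> clim (F^~ q) l.
  move=> q; have [/andP[]|] := boolP (0 < cabs q < 1); last by exists 0.
  rewrite cabs_gt0 => /ce_surj[t <-]; rewrite cabs_ce_lt1 => ht.
  exists (phi (nu n) t 0) => _; apply: clim_ext (scaled_clim ht) _ => j.
  by rewrite FE.
have LE t : upper_half_plane t -> L (ce t) = phi (nu n) t 0.
  move=> ht; apply: (@clim_unique _ (F^~ (ce t))).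
    by apply: hL; rewrite upper_lt1 // cabs_gt0 ce_neq0.
  by apply: clim_ext (scaled_clim ht) _ => j; rewrite FE.
(* The factor q makes the convergence uniform across q = 0, where [L] has an arbitrary value;
   [division] takes the factor away again. *)
have hol1 c : cabs c < 1 -> hol (fun q => q * L q) c.
  move=> c1; have rho0 : 0 < (1 - cabs c) / 2 by lra.
  have ball q : cabs (q - c) < (1 - cabs c) / 2 -> cabs q <= (1 + cabs c) / 2.
    by move=> hq; have := cabs_subl q c; lra.
  apply: (@hol_limit _ (fun j q => q * F j q) _ _ _ rho0).
    move=> j q /ball hq; apply: holM; first exact: hol_id.
    by apply: hF; lra.
  move=> e e0; have [K K0 hK] := scaled_bound (r := (1 + cabs c) / 2) ltac:(lra).
  have [N hN] := bound_small K0 e0; exists N => j q Nj /ball hq.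
  have [->|q0] := eqVneq q 0; first by rewrite !mul0r subrr cabs0 ltW.
  have q1 : cabs q < 1 by lra.
  rewrite -mulrBr cabsM; have [t tq] := ce_surj q0.
  have ht : upper_half_plane t by rewrite -tq cabs_ce_lt1 in q1.
  have := hK j t ht; rewrite -FE // -LE // tq => /(_ hq) h.
  by apply: le_trans (hN j Nj); apply: le_trans h; rewrite ler_piMl ?cabs_ge0 // ltW.
have [|H hH HE] := @division _ (fun q => q * L q) 0 1 _ ltr01.
  by move=> q; rewrite subr0; exact: hol1.
exists H => [q q1|t ht]; first by apply: hH; rewrite subr0.
have := HE (ce t); rewrite mul0r add0r subr0 => /(mulfI (ce_neq0 t)) <-.
exact: LE.
Qed.

(* By humbert_neq0 the approximations scaled j have no zeros on a given compact set for large j. *)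
Lemma phi_nu0_nonvanishing t0 t : generic (phi (nu n)) t0 -> upper_half_plane t -> phi (nu n) t 0 != 0.
Proof.
move=> gen ht; have [H hH HE] := phi_nu0_expansion; have [F hF FE] := scaled_expansion.
have qa1 := upper_lt1 ht; rewrite -HE //.
have qa0 : 0 < cabs (ce t) by rewrite cabs_gt0 ce_neq0.
move: (ce t) qa0 qa1 => qa qa0 qa1.
have [|r0 r0p isol] := disc_zero_isolated hH qa1.
  by exists (ce t0); [exact: upper_lt1 gen.1 | rewrite HE ?(phi_nu0_neq0 n3 hG hphi) //; exact: gen.1].
(* The disc of radius [m] around [qa] stays inside the punctured unit disc and contains no other
   zero of [H]. *)
pose m := Num.min r0 (Num.min (cabs qa) (1 - cabs qa)) / 2.
have [m0 mr mq m1] : [/\ 0 < m, m < r0, m < cabs qa & m < 1 - cabs qa].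
  have i0 : 0 < Num.min r0 (Num.min (cabs qa) (1 - cabs qa)) by rewrite !lt_min r0p qa0; lra.
  have i1 : Num.min r0 (Num.min (cabs qa) (1 - cabs qa)) <= r0 by rewrite ge_min lexx.
  have i2 : Num.min r0 (Num.min (cabs qa) (1 - cabs qa)) <= cabs qa by rewrite !ge_min lexx !orbT.
  have i3 : Num.min r0 (Num.min (cabs qa) (1 - cabs qa)) <= 1 - cabs qa by rewrite !ge_min lexx !orbT.
  by rewrite /m; split; lra.
have ball z : cabs (z - qa) < m -> cabs qa - m <= cabs z <= cabs qa + m.
  move=> hz; have := cabs_subl z qa; have := cabs_subl qa z; rewrite cabsB => h1 h2.
  by apply/andP; split; lra.
have pre z : cabs (z - qa) < m -> exists2 u, ce u = z & upper_half_plane u.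
  move=> /ball /andP[z1 z2]; have : z != 0 by rewrite -cabs_gt0; lra.
  move=> /ce_surj[u zu]; exists u => //; rewrite /upper_half_plane -cabs_ce_lt1 zu; lra.
apply: (@hurwitz _ F H qa m m0).
- by move=> j z /ball/andP[_ h]; apply: hF; lra.
- by move=> z /ball/andP[_ h]; apply: hH; lra.
- move=> e e0; have [K K0 hK] := scaled_bound (r := cabs qa + m) ltac:(lra).
  have [N hN] := bound_small K0 e0; exists N => j z Nj hz.
  have /andP[_ z2] := ball z hz; have [u zu hu] := pre z hz.
  by apply: (le_trans _ (hN j Nj)); rewrite -zu FE // HE //; apply: hK; rewrite ?zu.
- have [v2 hv2] := exp_level (l := cabs qa - m) ltac:(lra).
  have [v1 hv1] := exp_level (l := cabs qa + m) ltac:(lra).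
  have p20 : 0 < 2 * pi :> R by rewrite mulr_gt0 // pi_gt0.
  have v10 : 0 < v1.
    have : expR (- (2 * pi * v1)) < 1 by rewrite hv1; lra.
    by rewrite expR_lt1 oppr_lt0 pmulr_rgt0.
  (* On the disc v1 <= Im t1 <= v2, so y > M implies both size conditions of [humbert_neq0]. *)
  pose M := n%:R ^+ 2 / v1 + n%:R ^+ 2 * v2.
  exists (Num.truncn M).+1 => j z Nj hz.
  have /andP[z1 z2] := ball z hz; have [u zu hu] := pre z hz.
  have [u1 u2] : v1 <= complex.Im u /\ complex.Im u <= v2.
    move: z1 z2; rewrite -zu cabs_ce -hv1 -hv2 !ler_expR !lerN2 !(ler_pM2l p20).
    by split.
  rewrite -zu FE // mulf_neq0 ?ce_neq0 //.
  have hM : M < 1 + j.+1%:R.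
    by apply: (lt_le_trans (truncnS_gt _)); rewrite [1 + _]addrC natr1 ler_nat; apply: (leq_trans Nj); rewrite ltnW.
  have n20 : 0 <= n%:R ^+ 2 :> R by exact: sqr_ge0.
  have q0 : 0 <= n%:R ^+ 2 / v1 by rewrite divr_ge0 // ltW.
  have q1 : n%:R ^+ 2 = n%:R ^+ 2 / v1 * v1 by rewrite divfK // gt_eqF.
  have q2 : 0 <= n%:R ^+ 2 * v2 by rewrite mulr_ge0 //; lra.
  have y0 : 0 < 1 + j.+1%:R :> R by rewrite addr_gt0.
  apply: humbert_neq0 => //.
  + move: (1 + j.+1%:R) y0 hM => y y0 hM.
    apply: (@le_lt_trans _ _ (n%:R ^+ 2 / v1 * complex.Im u)); first by rewrite {1}q1 ler_wpM2l.
    rewrite [X in _ < X]mulrAC ltr_pM2r //; rewrite /M in hM; lra.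
  rewrite /M in hM; have : n%:R ^+ 2 * complex.Im u <= n%:R ^+ 2 * v2 by rewrite ler_wpM2l.
  lra.
by move=> z /andP[z0 zm]; apply: isol; rewrite z0; lra.
Qed.

Lemma phi_nu0_Delta : exists2 c : C, c != 0 & forall t, generic (phi (nu n)) t ->
  phi (nu n) t 0 = c * Delta t ^ (k %/ 12)%Z.
Proof.
have [[t0 gen]|none] := pselect (exists t, generic (phi (nu n)) t); last first.
  (* Without a generic point the claim is vacuous, and 1 is a default constant. *)
  by exists 1 => [|t gen]; [exact: oner_neq0 | case: none; exists t].
have [H hH HE] := phi_nu0_expansion.
have [c c0 cE] := modular_nonvanishing hH HE (fun t => phi_nu0_nonvanishing gen) phi_nu0_inversion.
by exists c => // t [ht _]; exact: cE.
Qed.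

End SecondPart.

Theorem proposition6p2 (R : realType) (n : nat) (k : int)
    (G : 'M[R[i]]_2 -> R[i]) (phi : nat -> R[i] -> R[i] -> R[i]) :
  (3 <= n)%N ->
  exact_humbert_form (Posz (n ^ 2)%N) k G ->
  fourier_jacobi_expansion G phi ->
  (forall tau1 : R[i], generic (phi (nu n)) tau1 ->
     forall s : seq R[i], inversion_orbit_lifts tau1 n s ->
     forall z : R[i],
       phi (nu n) tau1 z =
       phi (nu n) tau1 0 *
       \prod_(x <- s) (theta11 tau1 (z - x) * theta11 tau1 (z + x)
                       / - (theta11 tau1 x ^+ 2)))
  /\
  (exists2 c : R[i], c != 0 &
     forall tau1 : R[i], generic (phi (nu n)) tau1 ->
       phi (nu n) tau1 0 = c * Delta tau1 ^ (k %/ 12)%Z).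
Proof.
move=> n3 hG hphi; split; last exact: phi_nu0_Delta n3 hG hphi.
by move=> t [ht _] s hs z; exact: phi_nu_product n3 hG hphi _ _ _ ht hs.
Qed.
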